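(* Let $R$ be a ring that is not von Neumann regular. The following are equivalent. (1) Every non-injective simple right $R$-module is indigent. (2) One of the following statements holds: (i) $R$ is a right V-ring; or (ii) $R$ is a right hereditary right Noetherian ring and, for any right $R$-module $M$, either $M$ is indigent or $\mathrm{Soc}(M)=\mathrm{Soc}(N)$, where $N$ is the largest injective submodule of $M$; or (iii) $R\cong S\times T$, where $S$ is a semisimple Artinian ring and $T$ is an indecomposable matrix ring over a local QF-ring.
   Context: Rings are associative with identity; the semisimple factor $S$ is allowed to be the zero ring. A module $M$ is called $N$-subinjective if for every module $K$ containing $N$ as a submodule, every homomorphism $N\to M$ extends to a homomorphism $K\to M$. The subinjectivity domain of $M$ is $\underline{\mathfrak{In}}^{-1}(M)=\{N : M \text{ is } N\text{-subinjective}\}$. A module $M$ is indigent if $\underline{\mathfrak{In}}^{-1}(M)$ is exactly the class of injective modules. A ring $R$ is a right V-ring if all simple right $R$-modules are injective. $\mathrm{Soc}(M)$ is the socle of $M$. QF means quasi-Frobenius. *)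

(* Defs.v *)
From HB Require Import structures.
From mathcomp Require Import all_boot all_algebra.
From mathcomp Require Import boolp classical_sets.

Set Implicit Arguments.
Unset Strict Implicit.
Unset Printing Implicit Defensive.

Import GRing.Theory.
Local Open Scope ring_scope.
Local Open Scope classical_set_scope.

(* Rings are [pzRingType]s, so the zero ring is included.  A right R-module is
   an [lmodType] over the converse ring R^c: [a *: v] stands for v . a, and
   a *: (b *: v) = (b * a) *: v when the product is taken in R.  The
   module-theoretic notions are stated for left modules over an arbitrary ring,
   to be used at R^c.  *)
Notation rmodType R := (lmodType R^c).

(* The right regular module R_R: here a *: x is x * a in R. *)
Notation right_regular R := ((R^c)^o)%type.

Section Submodules.
Context (R : pzRingType) (M : lmodType R).

(* A submodule N of M (a member of the library structure [submodClosed M]),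
   regarded as a module in its own right.  *)
Record submod (N : submodClosed M) :=
  Submod { submod_val : M; submod_valP : submod_val \in N }.

Section Instances.
Variable N : submodClosed M.
HB.instance Definition _ := [isSub for @submod_val N].
HB.instance Definition _ := [Choice of submod N by <:].
HB.instance Definition _ := [SubChoice_isSubLmodule of submod N by <:].
End Instances.

End Submodules.

Section Modules.
Context (R : pzRingType).
Implicit Types M N E P : lmodType R.

(* "K contains N as a submodule" is rendered by an injective linear map. *)
Definition subinjective M N :=
  forall (K : lmodType R) (i : {linear N -> K}), injective i ->
  forall f : {linear N -> M}, exists g : {linear K -> M}, g \o i =1 f.

Definition injective_module E := forall N, subinjective E N.

Definition projective_module P :=
  forall (A B : lmodType R) (p : {linear A -> B}), (forall b, exists a, p a = b) ->
  forall f : {linear P -> B}, exists g : {linear P -> A}, p \o g =1 f.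

Definition indigent M := forall N, subinjective M N <-> injective_module N.

Definition simple_module M :=
  (exists x : M, x != 0) /\
  forall N : submodClosed M, N =i pred1 0 \/ N =i predT.

(* The sum of all simple submodules: the finite sums of elements each of which
   lies in some simple submodule.  *)
Definition Soc M : set M :=
  [set x | exists2 s : seq M, x = \sum_(y <- s) y &
     forall y, y \in s ->
       exists2 N : submodClosed M, simple_module (submod N) & y \in N].

Definition semisimple_module M := @Soc M = [set: M].

Definition noetherian_module M :=
  forall N : nat -> submodClosed M,
    (forall n, {subset N n <= N n.+1}) ->
  exists n, forall m, (n <= m)%N -> N m =i N n.

Definition maximal_submodule M (N : submodClosed M) :=
  ~ (N =i predT) /\
  forall L : submodClosed M, {subset N <= L} -> L =i N \/ L =i predT.

Definition largest_injective_submodule M (N : submodClosed M) :=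
  injective_module (submod N) /\
  forall L : submodClosed M, injective_module (submod L) -> {subset L <= N}.

End Modules.
Arguments Soc {R} M _.

Section Rings.
Implicit Types R S L : pzRingType.

Definition von_neumann_regular R := forall a : R, exists x : R, a = a * x * a.

Definition right_V_ring R :=
  forall M : rmodType R, simple_module M -> injective_module M.

Definition right_noetherian R := noetherian_module (right_regular R).

Definition right_hereditary R :=
  forall I : submodClosed (right_regular R), projective_module (submod I).

(* Holds of the zero ring, whose regular module is an empty sum. *)
Definition semisimple_artinian R := semisimple_module (right_regular R).

(* Nonzeroness is implied: a maximal right ideal is proper. *)
Definition local_ring R :=
  exists2 I : submodClosed (right_regular R), maximal_submodule I &
    forall J : submodClosed (right_regular R), maximal_submodule J -> J =i I.

Definition quasi_Frobenius R :=
  right_noetherian R /\ injective_module (right_regular R).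

Definition ring_iso R S := exists f : {rmorphism R -> S}, bijective f.

Definition zero_ring R := (1 : R) = 0.

Definition indecomposable_ring R :=
  ~ zero_ring R /\
  forall A B : pzRingType, ring_iso R (A * B)%type -> zero_ring A \/ zero_ring B.

End Rings.

(* Main.v *)
Require Import Defs.
From HB Require Import structures.
From mathcomp Require Import all_boot all_algebra.
From mathcomp Require Import boolp classical_sets functions.

Set Implicit Arguments.
Unset Strict Implicit.
Unset Printing Implicit Defensive.

Import GRing.Theory.
Local Open Scope ring_scope.
Local Open Scope classical_set_scope.

(** Suppose first that each non-injective simple module is indigent and that S
    is one; thus a module N such that all maps from N to S extend to every
    module containing N is injective.  In particular a module without nonzero
    maps to S is injective.

    If no injective module maps onto a non-injective simple module, then direct
    sums and quotients of injective modules have no nonzero map to S and are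
    therefore injective, which makes the ring right Noetherian and right
    hereditary.  The sum N of the injective submodules of M is then its largest
    injective submodule, and a simple submodule W outside N forces M to be
    indigent: a map from K to W extended to an injective module containing K
    takes values in N, so it vanishes, and W is indigent
    ([hereditary_case_dichotomy]).

    If an injective module E maps onto S, then any map from a free module to S
    lifts to E, and so extends to all larger modules; hence R and the free
    module of countable rank are injective.  This gives right self-injectivity
    together with the ascending chain condition on right annihilators
    ([dsum_injective_chain]).  Let e be a primitive idempotent with S e <> 0.
    The ring eRe is local, and as many copies of eR as possible are split off R,
    with sum cR; the rest is qR with S q = 0, so that the modules over qR are
    injective.  The Peirce components eRq and qRe vanish ([eRq0], [qRe0]),
    because the images of qR are injective modules without nonzero map to S.
    So R is the product of the semisimple ring qRq and the ring of matrices
    over eRe.  Finally eRe has a nonzero element k annihilated on the right by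
    its radical, all its right ideals are annihilators, and the chain condition
    makes it right Noetherian ([local_noetherian]).

    Conversely, a simple module whose socle is that of its largest injective
    submodule is injective, which settles the hereditary case.  Now let R be the
    product of a semisimple ring and the ring of
    matrices over a local quasi-Frobenius ring L with radical J.  A
    non-injective simple module M corresponds to L / J, and a module N is
    injective as soon as the associated L-module X = Ne is.  If all maps from N
    to M extend to an injective module containing N, then the elements of X
    killed by k lie in X J: such an element has coefficients in J in terms of
    the larger module, because L / kL embeds in a finite power of L
    ([finite_annihilation]), whereas an element outside X J is detected by a
    map to M.  A module with this property is injective ([local_injective]):
    every y with y k <> 0 generates a copy of L, which is injective, so a
    maximal injective submodule is everything. *)

(** * Zorn's lemma and ascending chains *)

Lemma Zorn_above (T : Type) (P : set (set T)) (A0 : set T) : P A0 ->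
  (forall F : set (set T), F !=set0 -> F `<=` P -> total_on F subset ->
     P (\bigcup_(X in F) X)) ->
  exists A, [/\ A0 `<=` A, P A & forall B, P B -> A `<=` B -> B `<=` A].
Proof.
move=> PA0 chainP.
have [F FP totF|A [PA maxA]] := @Zorn_bigcup T [set A | P (A0 `|` A)].
  have [[X0 FX0]|F0] := pselect (F !=set0); last first.
    by rewrite /= bigcup0 ?setU0// => X FX; case: F0; exists X.
  rewrite /=; suff -> : A0 `|` \bigcup_(X in F) X = \bigcup_(X in [set A0 `|` X | X in F]) X.
    apply: chainP; first by exists (A0 `|` X0), X0.
      by move=> _ [X FX <-]; apply: FP.
    move=> _ _ [X FX <-] [Y FY <-].
    by case: (totF X Y FX FY) => ?; [left|right]; apply: setUS.
  apply/seteqP; split=> [x [A0x|[X FX Xx]]|x [_ [X FX <-] [A0x|Xx]]].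
  - by exists (A0 `|` X0); [exists X0 | left].
  - by exists (A0 `|` X); [exists X | right].
  - by left.
  - by right; exists X.
exists (A0 `|` A); split; [by move=> x; left | exact: PA | move=> B PB AB].
apply: contrapT => /existsNP[x /not_implyP[Bx nAx]].
apply: (maxA B) => /=; last first.
  by rewrite setUidr// => y A0y; apply: AB; left.
split=> [y Ay|BA]; first by apply: AB; right.
by apply: nAx; right; apply: BA.
Qed.

Lemma no_maximal_sequence (T : Type) (P : T -> Prop) (lt : T -> T -> Prop) :
  (exists x, P x) -> (forall x, P x -> exists y, P y /\ lt x y) ->
  exists f : nat -> T, forall n, P (f n) /\ lt (f n) (f n.+1).
Proof.
move=> /cid[x0 Px0] step.
have [g gP] : {g : {x | P x} -> {x | P x} &
    forall x, lt (sval x) (sval (g x))}.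
  apply: (@choice _ _ (fun x y => lt (sval x) (sval y))) => -[x Px] /=.
  by have [y [Py ltxy]] := step x Px; exists (exist _ y Py).
exists (fun n => sval (iter n g (exist _ x0 Px0))) => n; split; last exact: gP.
exact: svalP.
Qed.

(** * Submodules, linear maps and quotients *)

Section ModuleTools.
Context (A : pzRingType).
Implicit Types M N K V : lmodType A.

Definition submod_set M (P : set M) :=
  [/\ P 0, forall x y, P x -> P y -> P (x + y) & forall a x, P x -> P (a *: x)].

Section SubmodSet.
Context (M : lmodType A) (P : set M) (Pmod : submod_set P).

Lemma submod_set0 : P 0. Proof. by case: Pmod. Qed.

Lemma submod_setD x y : P x -> P y -> P (x + y).
Proof. by case: Pmod => _ + _; apply. Qed.

Lemma submod_setZ a x : P x -> P (a *: x).
Proof. by case: Pmod => _ _; apply. Qed.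

Lemma submod_setN x : P x -> P (- x).
Proof. by move=> Px; rewrite -scaleN1r; apply: submod_setZ. Qed.

Lemma submod_setB x y : P x -> P y -> P (x - y).
Proof. by move=> Px Py; apply: submod_setD => //; apply: submod_setN. Qed.

Lemma submod_set_sum (I : Type) (r : seq I) (p : pred I) (F : I -> M) :
  (forall i, p i -> P (F i)) -> P (\sum_(i <- r | p i) F i).
Proof.
move=> PF; elim/big_ind: _ => //; [exact: submod_set0 | exact: submod_setD].
Qed.

Lemma ex_submod : exists N : submodClosed M, forall x, (x \in N) = P x :> Prop.
Proof.
pose S : {pred M} := fun x => `[< P x >].
have SE x : (x \in S) = P x :> Prop by rewrite /in_mem /= asboolE.
have cS : GRing.submod_closed S.
  split; first by rewrite SE; apply: submod_set0.
  move=> a x y; rewrite !SE => Px Py.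
  by apply: submod_setD => //; apply: submod_setZ.
pose iS := GRing.isSubmodClosed.Build A M S cS.
pose T : submodClosed M := HB.pack S iS.
by exists T.
Qed.

End SubmodSet.

Lemma submodClosed_set M (N : submodClosed M) : submod_set [set x | x \in N].
Proof.
split=> /= [|x y|a x]; [exact: rpred0 | exact: rpredD | exact: rpredZ].
Qed.

Lemma submodClosedB M (N : submodClosed M) x y :
  x \in N -> y \in N -> x - y \in N.
Proof. exact: (submod_setB (submodClosed_set N)). Qed.

Lemma submodClosedN M (N : submodClosed M) x : x \in N -> - x \in N.
Proof. exact: (submod_setN (submodClosed_set N)). Qed.

Lemma ex_linear M N (f : M -> N) :
  (forall x y, f (x + y) = f x + f y) -> (forall a x, f (a *: x) = a *: f x) ->
  exists g : {linear M -> N}, g =1 f.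
Proof.
move=> fD fZ; have lf : linear f by move=> a x y; rewrite fD fZ.
pose g : {linear M -> N} := HB.pack f (GRing.isLinear.Build A M N _ f lf).
by exists g.
Qed.

Lemma ex_val_linear M (N : submodClosed M) :
  exists i : {linear submod N -> M}, i =1 val.
Proof. exact: ex_linear. Qed.

Lemma submod_set_preim M N (f : {linear M -> N}) (P : set N) :
  submod_set P -> submod_set (f @^-1` P).
Proof.
move=> Pm; split=> /= [|x y Px Py|a x Px].
- by rewrite linear0; apply: submod_set0.
- by rewrite linearD; apply: submod_setD.
- by rewrite linearZ; apply: submod_setZ.
Qed.

Lemma submod_set_image M N (f : {linear M -> N}) (P : set M) :
  submod_set P -> submod_set (f @` P).
Proof.
move=> Pm; split=> /= [|_ _ [x Px <-] [y Py <-]|a _ [x Px <-]].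
- by exists 0; [apply: submod_set0 | rewrite linear0].
- by exists (x + y); [apply: submod_setD | rewrite linearD].
- by exists (a *: x); [apply: submod_setZ | rewrite linearZ].
Qed.

Lemma submod_set_ker M N (f : {linear M -> N}) : submod_set [set x | f x = 0].
Proof.
split=> /= [|x y fx fy|a x fx]; first exact: linear0.
  by rewrite linearD fx fy addr0.
by rewrite linearZ /= fx scaler0.
Qed.

Lemma submod_setT M : submod_set [set: M].
Proof. by []. Qed.

Lemma submod_set_chain M (F : set (set M)) : F !=set0 ->
  (forall P, F P -> submod_set P) -> total_on F subset ->
  submod_set (\bigcup_(P in F) P).
Proof.
move=> [P0 FP0] Fm totF; split=> [|x y [P FP Px] [Q FQ Qy]|a x [P FP Px]].
- by exists P0 => //; apply: submod_set0; apply: Fm.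
- case: (totF P Q FP FQ) => PQ; [exists Q|exists P] => //.
    by apply: submod_setD; [exact: Fm | exact: PQ |].
  by apply: submod_setD; [exact: Fm | | exact: PQ].
- by exists P => //; apply: submod_setZ => //; apply: Fm.
Qed.

Definition setadd M (P Q : set M) : set M :=
  [set z | exists x y, [/\ P x, Q y & z = x + y]].

Lemma submod_set_add M (P Q : set M) :
  submod_set P -> submod_set Q -> submod_set (setadd P Q).
Proof.
move=> Pm Qm; split=> [|_ _ [x [y [Px Qy ->]]] [x' [y' [Px' Qy' ->]]]|a _ [x [y [Px Qy ->]]]].
- exists 0, 0; rewrite addr0.
  by split=> //; apply: submod_set0.
- by exists (x + x'), (y + y'); rewrite addrACA; split=> //; apply: submod_setD.
- by exists (a *: x), (a *: y); rewrite scalerDr; split=> //; apply: submod_setZ.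
Qed.

Lemma setaddl M (P Q : set M) : submod_set Q -> P `<=` setadd P Q.
Proof. by move=> Qm x Px; exists x, 0; rewrite addr0; split=> //; apply: submod_set0. Qed.

Lemma setaddr M (P Q : set M) : submod_set P -> Q `<=` setadd P Q.
Proof. by move=> Pm x Px; exists 0, x; rewrite add0r; split=> //; apply: submod_set0. Qed.

Definition cyclic M (x : M) : set M := [set z | exists a : A, z = a *: x].

Lemma submod_set_cyclic M (x : M) : submod_set (cyclic x).
Proof.
split=> [|_ _ [a ->] [b ->]|b _ [a ->]].
- by exists 0; rewrite scale0r.
- by exists (a + b); rewrite scalerDl.
- by exists (b * a); rewrite scalerA.
Qed.

Lemma cyclic_id M (x : M) : cyclic x x.
Proof. by exists 1; rewrite scale1r. Qed.

End ModuleTools.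

(** The quotient M / N is carried by a system of representatives of the
    cosets, picked out by the choice operator of M. *)
Section Quotient.
Context (A : pzRingType) (M : lmodType A) (N : submodClosed M).

Definition coset_repr (x : M) : M := choose (fun y => y - x \in N) x.

Lemma coset_reprP x : coset_repr x - x \in N.
Proof. by apply: (@chooseP _ (fun y => y - x \in N)); rewrite subrr rpred0. Qed.

Lemma coset_repr_eq x y : (coset_repr x == coset_repr y) = (x - y \in N).
Proof.
apply/eqP/idP => [e|xy].
  have -> : x - y = (coset_repr y - y) - (coset_repr x - x).
    by rewrite e opprB [RHS]addrC addrA subrK.
  by apply: submodClosedB; apply: coset_reprP.
have E z : (z - x \in N) = (z - y \in N).
  have -> : z - x = (z - y) - (x - y) by rewrite opprB addrA subrK.
  apply/idP/idP => [zx|zy]; last exact: submodClosedB.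
  by rewrite -[z - y](subrK (x - y)) rpredD.
rewrite /coset_repr (@eq_choose _ _ (fun z => z - y \in N)) //.
by apply: choose_id; rewrite ?subrr ?rpred0.
Qed.

Lemma coset_repr_id x : coset_repr (coset_repr x) = coset_repr x.
Proof. by apply/eqP; rewrite coset_repr_eq coset_reprP. Qed.

Definition quo := {x : M | coset_repr x == x}.
HB.instance Definition _ := Choice.on quo.

Definition pi_quo (x : M) : quo :=
  exist _ (coset_repr x) (introT eqP (coset_repr_id x)).

Lemma pi_quo_eq x y : (pi_quo x = pi_quo y) <-> x - y \in N.
Proof.
rewrite -coset_repr_eq; split=> [[->]//|/eqP e].
by apply: val_inj.
Qed.

Lemma pi_quoK (u : quo) : pi_quo (val u) = u.
Proof. by apply: val_inj; apply/eqP; exact: (valP u). Qed.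

Definition quo_add (u v : quo) := pi_quo (val u + val v).
Definition quo_opp (u : quo) := pi_quo (- val u).
Definition quo_scale (a : A) (u : quo) := pi_quo (a *: val u).

Lemma val_pi_quo x : val (pi_quo x) - x \in N. Proof. exact: coset_reprP. Qed.

Lemma quo_addE x y : quo_add (pi_quo x) (pi_quo y) = pi_quo (x + y).
Proof. by apply/pi_quo_eq; rewrite opprD addrACA; apply: rpredD; apply: val_pi_quo. Qed.

Lemma quo_oppE x : quo_opp (pi_quo x) = pi_quo (- x).
Proof. by apply/pi_quo_eq; rewrite -opprD; apply: submodClosedN; apply: val_pi_quo. Qed.

Lemma quo_scaleE a x : quo_scale a (pi_quo x) = pi_quo (a *: x).
Proof. by apply/pi_quo_eq; rewrite -scalerBr; apply: rpredZ; apply: val_pi_quo. Qed.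

Fact quo_addA : associative quo_add.
Proof.
move=> u v w; rewrite -(pi_quoK u) -(pi_quoK v) -(pi_quoK w).
by rewrite !quo_addE addrA.
Qed.

Fact quo_addC : commutative quo_add.
Proof. by move=> u v; rewrite /quo_add addrC. Qed.

Fact quo_add0 : left_id (pi_quo 0) quo_add.
Proof. by move=> u; rewrite -(pi_quoK u) quo_addE add0r. Qed.

Fact quo_addN : left_inverse (pi_quo 0) quo_opp quo_add.
Proof. by move=> u; rewrite -(pi_quoK u) quo_oppE quo_addE addNr. Qed.

HB.instance Definition _ :=
  GRing.isZmodule.Build quo quo_addA quo_addC quo_add0 quo_addN.

Fact quo_scaleA a b (u : quo) : quo_scale a (quo_scale b u) = quo_scale (a * b) u.
Proof. by rewrite -(pi_quoK u) !quo_scaleE scalerA. Qed.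

Fact quo_scale1 : left_id 1 quo_scale.
Proof. by move=> u; rewrite -(pi_quoK u) quo_scaleE scale1r. Qed.

Fact quo_scaleDr : right_distributive quo_scale +%R.
Proof.
move=> a u v; rewrite -(pi_quoK u) -(pi_quoK v).
rewrite [pi_quo _ + _]quo_addE !quo_scaleE [in RHS]/GRing.add /= quo_addE.
by rewrite scalerDr.
Qed.

Fact quo_scaleDl (u : quo) : {morph quo_scale^~ u : a b / a + b}.
Proof.
move=> a b; rewrite -(pi_quoK u) !quo_scaleE [in RHS]/GRing.add /= quo_addE.
by rewrite scalerDl.
Qed.

HB.instance Definition _ := GRing.Zmodule_isLmodule.Build A quo
  quo_scaleA quo_scale1 quo_scaleDr quo_scaleDl.

Fact pi_quo_linear : linear pi_quo.
Proof.
move=> a x y; rewrite [RHS]/GRing.add /= [X in quo_add X _]/GRing.scale /=.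
by rewrite quo_scaleE quo_addE.
Qed.
HB.instance Definition _ := GRing.isLinear.Build A M quo _ pi_quo pi_quo_linear.

Lemma pi_quo_eq0 x : (pi_quo x = 0) <-> x \in N.
Proof. by rewrite [0]/GRing.zero /= pi_quo_eq subr0. Qed.

End Quotient.

(** * Baer's criterion *)

Section Baer.
Context (A : pzRingType).
Implicit Types M N K E : lmodType A.

Definition linear_on K E (P : set K) (h : K -> E) :=
  (forall x y, P x -> P y -> h (x + y) = h x + h y) /\
  (forall a x, P x -> h (a *: x) = a *: h x).

Lemma linear_on0 K E (P : set K) (h : K -> E) :
  submod_set P -> linear_on P h -> h 0 = 0.
Proof.
by move=> Pm [_ hZ]; rewrite -(scale0r 0) hZ ?scale0r //; apply: submod_set0.
Qed.

Lemma injective_extend E K (P : set K) (h : K -> E) :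
  injective_module E -> submod_set P -> linear_on P h ->
  exists g : {linear K -> E}, forall x, P x -> g x = h x.
Proof.
move=> Einj Pm [hD hZ]; have [N NE] := ex_submod Pm.
have Pval (u : submod N) : P (val u) by rewrite -NE; apply: submod_valP.
have [i iE] := ex_val_linear N.
have [f fE] : exists f : {linear submod N -> E}, f =1 h \o val.
  by apply: ex_linear => [u v|a u] /=; [exact: (hD (val u) (val v)) | exact: (hZ a (val u))].
have [|g gE] := Einj (submod N) K i _ f.
  by move=> u v; rewrite !iE; apply: val_inj.
exists g => x; rewrite -NE => Nx.
by have := gE (Submod Nx); rewrite /= iE fE.
Qed.

Definition baer M := forall (I : set A^o) (h : A^o -> M),
  submod_set I -> linear_on I h -> exists m, forall x : A, I x -> h x = x *: m.

Lemma injective_baer M : injective_module M -> baer M.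
Proof.
move=> Minj I h Im hI; have [g gE] := injective_extend Minj Im hI.
exists (g 1) => x Ix; rewrite -gE // -linearZ /=.
by congr (g _); rewrite [RHS]mulr1.
Qed.

(** A maximal partial extension, encoded by its graph, is everywhere defined:
    the criterion lets one adjoin any further element x by solving for its
    value on the ideal of all a such that a *: x is already in the domain. *)
Lemma baer_injective M : baer M -> injective_module M.
Proof.
move=> Mbaer N K i inji f.
pose P (G : set (K * M)%type) := submod_set G /\ forall m, G (0, m) -> m = 0.
pose G0 : set (K * M)%type := [set z | exists n, z = (i n, f n)].
have PG0 : P G0.
  split; last by move=> m [n []]; rewrite -(linear0 i) => /inji <- ->; rewrite linear0.
  split=> [|_ _ [n ->] [n' ->]|a _ [n ->]].
  - by exists 0; rewrite !linear0.
  - by exists (n + n'); rewrite !linearD.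
  - by exists (a *: n); rewrite !linearZ.
have [|G [G0G [Gm G0P] maxG]] := Zorn_above PG0.
  move=> F F0 FP totF; split.
    by apply: submod_set_chain => // Q /FP [].
  by move=> m [Q /FP[_ QP] /QP].
have Gfun x m m' : G (x, m) -> G (x, m') -> m = m'.
  move=> Gm1 Gm2; apply/eqP; rewrite -subr_eq0; apply/eqP; apply: G0P.
  have -> : (0, m - m') = (x, m) - (x, m') :> (K * M)%type.
    by rewrite /= -[RHS]/(x - x, m - m') subrr.
  exact: submod_setB.
have Gtot x : exists m, G (x, m).
  pose I : set A^o := [set a | exists m, G ((a : A) *: x, m)].
  have Im : submod_set I.
    split=> [|a b [m Ga] [m' Gb]|a b [m Gb]].
    - by exists 0; rewrite scale0r; apply: (submod_set0 Gm).
    - by exists (m + m'); rewrite scalerDl; apply: (submod_setD Gm Ga Gb).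
    - by exists (a *: m); rewrite -scalerA; apply: (submod_setZ Gm a Gb).
  have [h hP] : {h : A^o -> M & forall a, I a -> G ((a : A) *: x, h a)}.
    apply: (@choice _ _ (fun a m => I a -> G ((a : A) *: x, m))) => a.
    have [[m Ga]|nIa] := pselect (I a); first by exists m.
    by exists 0 => /nIa.
  have hl : linear_on I h.
    split=> [a b Ia Ib|a b Ib].
      apply: (Gfun ((a + b : A) *: x)); first exact: (hP _ (submod_setD Im Ia Ib)).
      by rewrite scalerDl; apply: (submod_setD Gm (hP _ Ia) (hP _ Ib)).
    apply: (Gfun ((a * b : A) *: x)); first exact: (hP _ (submod_setZ Im a Ib)).
    by rewrite -scalerA; apply: (submod_setZ Gm a (hP _ Ib)).
  have [m0 m0P] := Mbaer I h Im hl.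
  exists m0; apply: (maxG (setadd G (cyclic (x, m0)))).
  - split; first exact: submod_set_add (submod_set_cyclic _).
    move=> m [[g1 g2] [_ [Gg [a ->]]]] [/esym e ->].
    have Gax : G (a *: x, - g2).
      have -> : (a *: x, - g2) = - (g1, g2) :> (K * M)%type.
        by rewrite -[RHS]/(- g1, - g2); congr (_, _); apply/eqP; rewrite -addr_eq0 addrC e.
      exact: submod_setN.
    have Ia : I a by exists (- g2).
    rewrite -[_ + _]/(g2 + a *: m0) -m0P // (Gfun _ _ _ (hP a Ia) Gax).
    by rewrite subrr.
  - exact: setaddl (submod_set_cyclic _).
  - by apply: (setaddr Gm); apply: cyclic_id.
have [g gP] := choice Gtot.
have [g' g'E] : exists g' : {linear K -> M}, g' =1 g.
  apply: ex_linear => [x y|a x].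
    by apply: (Gfun (x + y)) => //; apply: (submod_setD Gm (gP x) (gP y)).
  by apply: (Gfun (a *: x)) => //; apply: (submod_setZ Gm a (gP x)).
exists g' => n /=; rewrite g'E; apply: (Gfun (i n)) => //.
by apply: G0G; exists n.
Qed.

Lemma injective_retract M (N : submodClosed M) : injective_module (submod N) ->
  exists p : {linear M -> M},
    (forall x, p x \in N) /\ (forall x, x \in N -> p x = x).
Proof.
move=> Ninj; have [i iE] := ex_val_linear N.
have [|g gE] := Ninj (submod N) M i _ idfun.
  by move=> u v; rewrite !iE; apply: val_inj.
exists (i \o g) => /=; split=> x; first by rewrite iE; apply: submod_valP.
by move=> Nx; have := gE (Submod Nx) => /=; rewrite [i (Submod _)]iE /= => ->; rewrite iE.
Qed.

Lemma injective_subinjective M N : injective_module N -> subinjective M N.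
Proof.
move=> Ninj K i inji f; have [g gE] := Ninj N K i inji idfun.
by exists (f \o g) => x /=; rewrite [g (i x)]gE.
Qed.

End Baer.

(** * Enough injective modules *)

Lemma int_ideal_principal (I : set int) : I 0 ->
  (forall m n, I m -> I n -> I (m + n)) -> (forall m n, I n -> I (m * n)) ->
  exists d : nat, I d%:Z /\ forall n, I n -> (d %| n)%Z.
Proof.
move=> I0 ID IM; have [I1|nI] := pselect (forall n, I n -> n = 0).
  by exists 0%N; split=> // n /I1->; rewrite dvdz0.
have [d [[d0 Id] dmin]] : exists d : nat, ((0 < d)%N /\ I d%:Z) /\
    forall m : nat, (0 < m)%N -> I m%:Z -> (d <= m)%N.
  have ex : exists m : nat, `[< (0 < m)%N /\ I m%:Z >].
    have /existsNP[n /not_implyP[In n0]] := nI.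
    exists `|n|%N; apply/asboolP; split; first by rewrite absz_gt0; apply/eqP.
    by rewrite abszE Num.Theory.normrEsg; apply: IM.
  exists (ex_minn ex); case: ex_minnP => d /asboolP dP dmin; split=> // m m0 Im.
  by apply: dmin; apply/asboolP.
exists d; split=> // n In; rewrite /dvdz.
suff e : (n %% d)%Z = 0 by apply/dvdz_mod0P.
have dn0 : d%:Z != 0 by case: (d) d0.
have : I (n %% d)%Z.
  have -> : (n %% d)%Z = n + (- (n %/ d)%Z) * d by rewrite {2}(divz_eq n d) mulNr addrAC subrr add0r.
  by apply: ID => //; apply: IM.
have := modz_ge0 n dn0; have := ltz_mod n dn0.
case: (n %% d)%Z => [[|r]|//] //.
move=> lt _ Ir; have := dmin r.+1 isT Ir.
by rewrite leqNgt; move: lt; rewrite Num.Theory.ger0_norm // ltz_nat => ->.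
Qed.

Lemma divisible_injective (D : lmodType int) :
  (forall (n : int) (u : D), n != 0 -> exists v, n *: v = u) ->
  injective_module D.
Proof.
move=> Ddiv; apply: baer_injective => I h Im [hD hZ].
have [||d [Id dP]] := int_ideal_principal (submod_set0 Im).
- by move=> m n; apply: (submod_setD Im).
- by move=> m n; apply: (submod_setZ Im m).
have [d0|dn0] := eqVneq d%:Z 0.
  exists 0 => x /dP; rewrite d0 => /dvdzP[q ->]; rewrite mulr0 scaler0.
  exact: (linear_on0 Im).
have [p pE] := Ddiv d%:Z (h d%:Z) dn0.
exists p => x /dP /dvdzP[q ->]; rewrite -scalerA pE.
exact: hZ.
Qed.

Definition rat_int_submod : submodClosed (zmodule rat) :=
  sval (cid (ex_submod (submod_set_cyclic (1 : zmodule rat)))).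

Definition QmodZ : lmodType int := quo rat_int_submod.

Lemma rat_int_submodP (x : rat) : ((x : zmodule rat) \in rat_int_submod) <-> exists n : int, x = n%:~R.
Proof. by rewrite /rat_int_submod; case: cid => S /= ->. Qed.

Lemma QmodZ_injective : injective_module QmodZ.
Proof.
apply: divisible_injective => n u n0; rewrite -(pi_quoK u).
exists (pi_quo rat_int_submod ((val u : rat) / n%:~R : rat)).
rewrite -linearZ; congr (pi_quo _ _); rewrite scalezrE.
by rewrite -[LHS]mulrzr divfK// intr_eq0.
Qed.

(** Some d > 1 divides every n with n x = 0, since x is not 0; then x can be
    sent to the class of 1 / d. *)
Lemma QmodZ_separates (V : zmodType) (x : V) : x != 0 ->
  exists chi : V -> QmodZ, {morph chi : u v / u + v} /\ chi x != 0.
Proof.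
move=> x0; pose I : set int := [set n | x *~ n = 0].
have [d [d2 dP]] : exists d : nat, (1 < d)%N /\ forall n, I n -> (d %| n)%Z.
  have [|||d [Id dP]] := @int_ideal_principal I.
  - by rewrite /I /= mulr0z.
  - by move=> m n; rewrite /I /= => em en; rewrite mulrzDr em en addr0.
  - by move=> m n; rewrite /I /= mulrC mulrzA => ->; rewrite mul0rz.
  case: d => [|[|d]] in Id dP *; last by exists d.+2.
    by exists 2%N; split=> // n /dP; rewrite dvd0z => /eqP->.
  by case/eqP: x0; rewrite -[LHS]mulr1z; apply: Id.
have dn0 : d%:~R != 0 :> rat by rewrite intr_eq0; case: (d) d2.
pose t : QmodZ := pi_quo rat_int_submod (d%:~R^-1 : rat).
have tI n : I n -> n *: t = 0.
  move=> /dP /dvdzP[q ->]; rewrite -linearZ; apply/pi_quo_eq0/rat_int_submodP.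
  by exists q; rewrite scalezrE -mulrzr mulrC intrM mulfK.
have t0 : t != 0.
  apply/eqP => /pi_quo_eq0/rat_int_submodP[n e].
  have : (1 : rat) = (n * d)%:~R by rewrite intrM -e mulVf.
  rewrite -[1]/(1%:~R) => /intr_inj /esym e1.
  have := mulf_eq0 n d%:Z; have : (d %| 1)%Z by apply/dvdzP; exists n; rewrite e1.
  by rewrite dvdz1 => /eqP; case: (d) d2 => [|[|]].
pose C : set (zmodule V) := cyclic (x : zmodule V).
have Cm : submod_set C := submod_set_cyclic _.
have [c cP] : {c : zmodule V -> int & forall z, C z -> z = c z *: (x : zmodule V)}.
  apply: (@choice _ _ (fun z n => C z -> z = n *: (x : zmodule V))) => z.
  have [[n e]|nC] := pselect (C z); [by exists n | by exists 0 => /nC].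
have cE z n : C z -> z = n *: (x : zmodule V) -> c z *: t = n *: t.
  move=> Cz e; apply/eqP; rewrite -subr_eq0 -scalerBl; apply/eqP/tI.
  rewrite /I /= -scalezrE scalerBl -(cP z Cz) {1}e.
  exact: subrr.
have [g gE] : exists g : {linear zmodule V -> QmodZ}, forall z, C z -> g z = c z *: t.
  apply: (injective_extend QmodZ_injective Cm); split=> [y z Cy Cz|a z Cz].
    rewrite -scalerDl; apply: cE; first exact: (submod_setD Cm Cy Cz).
    by rewrite scalerDl -(cP y Cy) -(cP z Cz).
  rewrite scalerA; apply: cE; first exact: (submod_setZ Cm a Cz).
  by rewrite -scalerA -(cP z Cz).
exists g; split; first by move=> u v; apply: (linearD g).
rewrite gE; last exact: cyclic_id.
by rewrite (cE _ 1) ?scale1r //; exact: cyclic_id.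
Qed.

Lemma additive_int (V : zmodType) (D : lmodType int) (f : V -> D) :
  {morph f : u v / u + v} -> forall n v, f (v *~ n) = n *: f v.
Proof.
move=> fD n v.
have f0 : f 0 = 0 by apply: (addIr (f 0)); rewrite -fD !add0r.
have fN u : f (- u) = - f u.
  by apply: (addIr (f u)); rewrite -fD !addNr.
rewrite -[n in RHS]intz scaler_int.
elim/int_rect: n => [|n IH|n IH]; first by rewrite !mulr0z.
  by rewrite -addn1 PoszD !mulrzDr !mulr1z fD IH.
by rewrite !mulrNz fN -addn1 PoszD !mulrzDr !mulr1z fD; move: IH; rewrite !mulrNz fN => /oppr_inj ->.
Qed.

(** Maps X -> Hom_Z(A, Q/Z), i.e. a product of copies of the module coinduced
    from Q/Z, on which A acts through right multiplications on A. *)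
Section Coinduced.
Context (A : pzRingType) (X : Type).

Definition additive_maps : set (X -> A -> QmodZ) :=
  [set phi | forall x a b, phi x (a + b) = phi x a + phi x b].

Fact additive_maps_submod : submod_set additive_maps.
Proof.
split=> /= [x a b|f g fD gD x a b|n f fD x a b].
- by rewrite addr0.
- by rewrite !addrfctE fD gD addrACA.
- by rewrite !scalrfctE fD scalerDr.
Qed.

Definition additive_maps_module : submodClosed (X -> A -> QmodZ) :=
  sval (cid (ex_submod additive_maps_submod)).

Lemma additive_maps_moduleE f : (f \in additive_maps_module) = additive_maps f :> Prop.
Proof. exact: (svalP (cid (ex_submod additive_maps_submod)) f). Qed.

Definition coind := submod additive_maps_module.

HB.instance Definition _ := GRing.Zmodule.on coind.

Definition coind_fun (phi : coind) : X -> A -> QmodZ := val phi.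

Lemma coind_funD phi x : {morph coind_fun phi x : a b / a + b}.
Proof.
by move=> a b; have := submod_valP phi; rewrite additive_maps_moduleE; apply.
Qed.

Lemma coind_eq phi psi : coind_fun phi =2 coind_fun psi -> phi = psi.
Proof. by move=> e; apply: val_inj; apply/funext => x; apply/funext => a; apply: e. Qed.

Lemma ex_coind (f : X -> A -> QmodZ) : (forall x, {morph f x : a b / a + b}) ->
  {phi : coind | coind_fun phi = f}.
Proof.
move=> fD; have Sf : f \in additive_maps_module by rewrite additive_maps_moduleE.
by exists (Submod Sf).
Qed.

Definition coind_scale (a : A) (phi : coind) : coind :=
  sval (@ex_coind (fun x b => coind_fun phi x (b * a))
    (fun x b c => etrans (congr1 _ (mulrDl b c a)) (coind_funD phi x _ _))).

Lemma coind_scaleE a phi x b :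
  coind_fun (coind_scale a phi) x b = coind_fun phi x (b * a).
Proof. by rewrite /coind_scale; case: ex_coind => psi /= ->. Qed.

Lemma coind_funDl phi psi x a :
  coind_fun (phi + psi) x a = coind_fun phi x a + coind_fun psi x a.
Proof. by []. Qed.

Fact coind_scaleA a b phi :
  coind_scale a (coind_scale b phi) = coind_scale (a * b) phi.
Proof. by apply: coind_eq => x c; rewrite !coind_scaleE mulrA. Qed.

Fact coind_scale1 : left_id 1 coind_scale.
Proof. by move=> phi; apply: coind_eq => x c; rewrite coind_scaleE mulr1. Qed.

Fact coind_scaleDr : right_distributive coind_scale +%R.
Proof.
move=> a phi psi; apply: coind_eq => x c.
by rewrite coind_scaleE !coind_funDl !coind_scaleE.
Qed.

Fact coind_scaleDl phi : {morph coind_scale^~ phi : a b / a + b}.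
Proof.
move=> a b; apply: coind_eq => x c.
by rewrite coind_funDl !coind_scaleE mulrDr coind_funD.
Qed.

HB.instance Definition _ := GRing.Zmodule_isLmodule.Build A coind
  coind_scaleA coind_scale1 coind_scaleDr coind_scaleDl.

Lemma coind_funZ (a : A) (phi : coind) x b :
  coind_fun (a *: phi) x b = coind_fun phi x (b * a).
Proof. exact: coind_scaleE. Qed.

Lemma coind_injective : injective_module (coind : lmodType A).
Proof.
apply: baer_injective => I h Im [hD hZ].
have ext x : exists psi : {linear zmodule A -> QmodZ},
    forall b, I b -> psi b = coind_fun (h b) x 1.
  apply: (injective_extend (P := I : set (zmodule A)) QmodZ_injective).
    split=> [|b c|n b Ib]; first exact: (submod_set0 Im).
      exact: (submod_setD Im).
    rewrite scalezrE -mulrzl; exact: (submod_setZ Im _).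
  split=> [b c Ib Ic|n b Ib].
    by rewrite [h _]hD.
  have -> : h (n *: (b : zmodule A)) = n%:~R *: h b.
    by rewrite -hZ // scalezrE -mulrzl.
  rewrite coind_funZ mul1r -(additive_int (coind_funD (h b) x)).
  by congr (coind_fun _ _ _).
have [psi psiE] := choice ext.
have [phi phiE] := @ex_coind (fun x b => psi x b) (fun x b c => linearD (psi x) b c).
exists phi => b Ib; apply: coind_eq => x r.
rewrite coind_funZ phiE psiE; last exact: (submod_setZ Im r).
by rewrite hZ // coind_funZ mul1r.
Qed.

End Coinduced.

(** The element v corresponds to the family of the additive maps sending r to
    chi_x (r v), where chi_x is a character with chi_x (x) <> 0. *)
Lemma enough_injectives (A : pzRingType) (V : lmodType A) :
  exists (E : lmodType A) (j : {linear V -> E}), injective_module E /\ injective j.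
Proof.
have sep (v : V) : exists chi : V -> QmodZ,
    {morph chi : u w / u + w} /\ (v != 0 -> chi v != 0).
  have [->|v0] := eqVneq v 0; last first.
    by have [chi [chiD chiv]] := QmodZ_separates v0; exists chi.
  by exists (fun=> 0); split=> // u w; rewrite addr0.
have [chi chiP] := choice sep.
have jD v x : {morph (fun r : A => chi x (r *: v)) : a b / a + b}.
  by move=> a b; rewrite scalerDl; apply: (chiP x).1.
pose j0 v : coind A V := sval (ex_coind (jD v)).
have j0E v x r : coind_fun (j0 v) x r = chi x (r *: v).
  by rewrite /j0; case: ex_coind => phi /= ->.
have [j jE] : exists j : {linear V -> coind A V}, j =1 j0.
  apply: ex_linear => [u v|a v]; apply: coind_eq => x r.
    by rewrite coind_funDl !j0E scalerDr (chiP x).1.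
  by rewrite coind_funZ !j0E scalerA.
exists (coind A V), j; split; first exact: coind_injective.
move=> u v juv; apply/eqP; rewrite -subr_eq0; apply/negP => /negP uv0.
have := (chiP (u - v)).2 uv0; rewrite -[X in chi _ X]scale1r -j0E -jE.
by rewrite linearB /= juv subrr; case/eqP.
Qed.

(** * Simple and indigent modules *)

Section Simple.
Context (A : pzRingType).
Implicit Types M N K S E : lmodType A.

Lemma simple_set S (P : set S) : simple_module S -> submod_set P ->
  (forall x, P x -> x = 0) \/ (forall x, P x).
Proof.
move=> [_ simp] Pm; have [N NE] := ex_submod Pm.
case: (simp N) => N0; [left=> x; rewrite -NE N0 => /eqP // | right=> x].
by rewrite -NE N0.
Qed.

Lemma simple_gen S (s t : S) : simple_module S -> s <> 0 -> exists a, t = a *: s.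
Proof.
move=> Ssimp s0; case: (simple_set Ssimp (submod_set_cyclic s)) => h.
  by case: s0; apply: h; apply: cyclic_id.
exact: h.
Qed.

Lemma gen_simple S : (exists s : S, s <> 0) ->
  (forall s t : S, s <> 0 -> exists a, t = a *: s) -> simple_module S.
Proof.
move=> [s s0] gen; split; first by exists s; apply/eqP.
move=> N; have [[x [Nx x0]]|N0] := pselect (exists x, x \in N /\ x <> 0).
  right=> t; rewrite [RHS]/in_mem /=.
  by have [a ->] := gen x t x0; rewrite rpredZ.
left=> x; apply/idP/eqP => [Nx|->]; last exact: rpred0.
by apply: contrapT => x0; apply: N0; exists x.
Qed.

Lemma simple_surj M S (f : {linear M -> S}) x : simple_module S -> f x <> 0 ->
  forall s, exists y, f y = s.
Proof.
move=> Ssimp fx s; have [a ->] := simple_gen s Ssimp fx.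
by exists (a *: x); rewrite linearZ.
Qed.

Lemma indigent_hom0 S N : indigent S ->
  (forall (f : {linear N -> S}) x, f x = 0) -> injective_module N.
Proof.
move=> Sind N0; apply/Sind => K i inji f; exists \0 => x /=.
by rewrite N0.
Qed.

(** Injectivity for partial linear maps given by their graph, so that being
    well defined is all that has to be checked. *)
Lemma injective_graph E K (G : set (K * E)%type) : injective_module E ->
  submod_set G -> (forall m, G (0, m) -> m = 0) ->
  exists g : {linear K -> E}, forall x m, G (x, m) -> g x = m.
Proof.
move=> Einj Gm G0.
have Gfun x m m' : G (x, m) -> G (x, m') -> m = m'.
  move=> Gm1 Gm2; apply/eqP; rewrite -subr_eq0; apply/eqP; apply: G0.
  have -> : (0, m - m') = (x, m) - (x, m') :> (K * E)%type.
    by rewrite /= -[RHS]/(x - x, m - m') subrr.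
  exact: submod_setB.
pose P : set K := [set x | exists m, G (x, m)].
have Pm : submod_set P.
  split=> [|x y [m Gx] [n Gy]|a x [m Gx]].
  - by exists 0; apply: (submod_set0 Gm).
  - by exists (m + n); apply: (submod_setD Gm Gx Gy).
  - by exists (a *: m); apply: (submod_setZ Gm a Gx).
have [h hP] : {h : K -> E & forall x, P x -> G (x, h x)}.
  apply: (@choice _ _ (fun x m => P x -> G (x, m))) => x.
  by have [[m Gx]|nP] := pselect (P x); [exists m | exists 0 => /nP].
have [|g gE] := injective_extend (h := h) Einj Pm.
  split=> [x y Px Py|a x Px].
    apply: (Gfun (x + y)); first exact: (hP _ (submod_setD Pm Px Py)).
    exact: (submod_setD Gm (hP _ Px) (hP _ Py)).
  apply: (Gfun (a *: x)); first exact: (hP _ (submod_setZ Pm a Px)).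
  exact: (submod_setZ Gm a (hP _ Px)).
exists g => x m Gx; rewrite gE; last by exists m.
by apply: (Gfun x) => //; apply: hP; exists m.
Qed.

End Simple.

(** * Finitely supported sequences *)

Section DirectSum.
Context (A : pzRingType) (V : lmodType A).

Definition finitely_supported : set (nat -> V) :=
  [set f | exists n, forall i, (n <= i)%N -> f i = 0].

Fact finitely_supported_submod : submod_set finitely_supported.
Proof.
split=> /= [|f g [m fm] [n gn]|a f [n fn]]; first by exists 0%N.
  exists (maxn m n) => i; rewrite geq_max => /andP[mi ni].
  by rewrite !addrfctE fm // gn // addr0.
by exists n => i ni; rewrite scalrfctE fn // scaler0.
Qed.

Definition dsum_module : submodClosed (nat -> V) :=
  sval (cid (ex_submod finitely_supported_submod)).

Lemma dsum_moduleE f : (f \in dsum_module) = finitely_supported f :> Prop.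
Proof. exact: (svalP (cid (ex_submod finitely_supported_submod)) f). Qed.

Definition dsum := submod dsum_module.

HB.instance Definition _ := GRing.Lmodule.on dsum.

Definition dsum_fun (z : dsum) : nat -> V := submod_val z.

Lemma dsum_bound (z : dsum) : exists n, forall i, (n <= i)%N -> dsum_fun z i = 0.
Proof. by have := submod_valP z; rewrite dsum_moduleE. Qed.

Lemma ex_dsum f : finitely_supported f -> exists z : dsum, dsum_fun z = f.
Proof. by rewrite -dsum_moduleE => h; exists (Submod h). Qed.

Lemma dsum_eq (y z : dsum) : dsum_fun y =1 dsum_fun z -> y = z.
Proof. by move=> e; apply: val_inj; apply/funext. Qed.

Lemma dsum_funD (y z : dsum) i : dsum_fun (y + z) i = dsum_fun y i + dsum_fun z i.
Proof. by []. Qed.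

Lemma dsum_funZ a (z : dsum) i : dsum_fun (a *: z) i = a *: dsum_fun z i.
Proof. by []. Qed.

Lemma dsum_fun_sum I (r : seq I) (F : I -> dsum) i :
  dsum_fun (\sum_(k <- r) F k) i = \sum_(k <- r) dsum_fun (F k) i.
Proof. by elim/big_rec2: _ => // k x y _ <-. Qed.

Lemma ex_dsum_delta : exists d : nat -> {linear V -> dsum},
  forall n v i, dsum_fun (d n v) i = if i == n then v else 0.
Proof.
have ex n : exists d : {linear V -> dsum},
    forall v i, dsum_fun (d v) i = if i == n then v else 0.
  have [d0 d0E] : {d0 : V -> dsum &
      forall v, dsum_fun (d0 v) = fun i => if i == n then v else 0}.
    apply: (@choice _ _ (fun v z => dsum_fun z = fun i => if i == n then v else 0)).
    by move=> v; apply: ex_dsum; exists n.+1 => i ni; rewrite gtn_eqF.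
  have [d dE] : exists d : {linear V -> dsum}, d =1 d0.
    apply: ex_linear => [u v|a v]; apply: dsum_eq => i.
      by rewrite [RHS]dsum_funD !d0E; case: eqP => _; rewrite ?addr0.
    by rewrite [RHS]dsum_funZ !d0E; case: eqP => _; rewrite ?scaler0.
  by exists d => v i; rewrite dE d0E.
by have [d dE] := choice ex; exists d.
Qed.

Lemma dsum_expand (d : nat -> {linear V -> dsum}) (z : dsum) n :
  (forall n v i, dsum_fun (d n v) i = if i == n then v else 0) ->
  (forall i, (n <= i)%N -> dsum_fun z i = 0) ->
  z = \sum_(0 <= i < n) d i (dsum_fun z i).
Proof.
move=> dE zn; apply: dsum_eq => i; rewrite dsum_fun_sum.
have [ni|iN] := leqP n i.
  rewrite zn // big_nat big1 // => k /andP[_ kn]; rewrite dE gtn_eqF //.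
  exact: leq_trans kn ni.
rewrite (bigD1_seq i) /= ?iota_uniq ?mem_index_iota ?iN //.
rewrite dE eqxx big1 ?addr0 // => k ki.
by rewrite dE eq_sym (negPf ki).
Qed.

Lemma dsum_hom0 (S : lmodType A) (f : {linear dsum -> S}) :
  (forall (g : {linear V -> S}) v, g v = 0) -> forall z, f z = 0.
Proof.
move=> hom0 z; have [d dE] := ex_dsum_delta; have [n zn] := dsum_bound z.
rewrite (dsum_expand dE zn) linear_sum big1 //= => i _.
exact: (hom0 (f \o d i)).
Qed.

End DirectSum.

(** Free modules are projective; here for the free module of countable rank. *)
Lemma dsum_lift (A : pzRingType) (E S : lmodType A) (p : {linear E -> S})
    (f : {linear dsum A^o -> S}) :
  (forall s, exists t, p t = s) ->
  exists g : {linear dsum A^o -> E}, forall z, p (g z) = f z.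
Proof.
move=> psurj; have [d dE] := ex_dsum_delta A^o.
have [t tE] : {t : nat -> E & forall i, p (t i) = f (d i 1)}.
  by apply: (@choice _ _ (fun i t => p t = f (d i 1))) => i.
have [N NP] := choice (@dsum_bound A A^o).
pose g0 (z : dsum A^o) := \sum_(0 <= i < N z) (dsum_fun z i : A) *: t i.
have g0E z n : (forall i, (n <= i)%N -> dsum_fun z i = 0) ->
    g0 z = \sum_(0 <= i < n) (dsum_fun z i : A) *: t i.
  move=> zn; rewrite /g0; have [nN|Nn] := leqP n (N z).
    rewrite (big_cat_nat _ nN) //= [X in _ + X]big_nat [X in _ + X]big1 ?addr0 //.
    by move=> i /andP[ni _]; rewrite zn // scale0r.
  rewrite (big_cat_nat _ (ltnW Nn)) //= [X in _ = _ + X]big_nat.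
  rewrite [X in _ = _ + X]big1 ?addr0 //.
  by move=> i /andP[ni _]; rewrite NP // scale0r.
have [g gE] : exists g : {linear dsum A^o -> E}, g =1 g0.
  apply: ex_linear => [y z|a z].
    pose n := maxn (N y) (N z).
    have yn i : (n <= i)%N -> dsum_fun y i = 0.
      by rewrite geq_max => /andP[yi _]; apply: NP.
    have zn i : (n <= i)%N -> dsum_fun z i = 0.
      by rewrite geq_max => /andP[_ zi]; apply: NP.
    rewrite (g0E _ n) => [|i ni]; last by rewrite [LHS]dsum_funD yn // zn // addr0.
    rewrite (g0E _ _ yn) (g0E _ _ zn) -big_split /=.
    by apply: eq_bigr => i _; rewrite -scalerDl.
  rewrite (g0E _ (N z)) => [|i ni]; last by rewrite [LHS]dsum_funZ NP // scaler0.
  rewrite /g0 scaler_sumr; apply: eq_bigr => i _.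
  by rewrite scalerA.
exists g => z; rewrite gE {2}(dsum_expand dE (NP z)) !linear_sum /=.
apply: eq_bigr => i _; rewrite linearZ /= tE -linearZ -linearZ /=.
by congr (f (d i _)); apply: mulr1.
Qed.

(** * Chain conditions *)

Section Chains.
Context (A : pzRingType).
Implicit Types (V E : lmodType A) (I : nat -> set A^o).

Lemma ascending_le (T : Type) (I : nat -> set T) :
  (forall n, I n `<=` I n.+1) -> forall m n, (m <= n)%N -> I m `<=` I n.
Proof.
move=> asc m n /subnKC <-; elim: (n - m)%N => [|k IH]; first by rewrite addn0.
by rewrite addnS; apply: subset_trans IH _.
Qed.

(** The chain I_n of ideals gives a map from its union to the direct sum,
    y |-> (y t_n)_n, which has finitely many nonzero coordinates on each I_n.
    An extension to A is determined by a single element of the direct sum, and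
    so kills all the coordinates beyond some point. *)
Lemma dsum_injective_chain V I (t : nat -> V) : injective_module (dsum V) ->
  (forall n, submod_set (I n)) -> (forall n, I n `<=` I n.+1) ->
  (forall n (y : A), I n y -> y *: t n = 0) ->
  exists n0, forall n, (n0 <= n)%N -> forall m (y : A), I m y -> y *: t n = 0.
Proof.
move=> Vinj Im asc It.
pose U := \bigcup_n I n.
have Um : submod_set U.
  split=> [|x y [m _ Ix] [n _ Iy]|a x [m _ Ix]].
  - by exists 0%N => //; apply: (submod_set0 (Im _)).
  - exists (maxn m n) => //; apply: (submod_setD (Im _)).
      exact: (ascending_le asc (leq_maxl m n)).
    exact: (ascending_le asc (leq_maxr m n)).
  - by exists m => //; apply: (submod_setZ (Im _)).
have UE m y : I m y -> U y by move=> Imy; exists m.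
pose G : set (A^o * dsum V)%type :=
  [set yz | U yz.1 /\ forall n, dsum_fun yz.2 n = (yz.1 : A) *: t n].
have [||g gE] := @injective_graph A (dsum V) A^o G Vinj.
- split=> [|[x u] [y v] [/= Ux ux] [/= Uy vy]|a [x u] [/= Ux ux]].
  + by split=> [|n /=]; [apply: (submod_set0 Um) | rewrite scale0r].
  + split=> [|n /=]; first exact: (submod_setD Um Ux Uy).
    by rewrite [LHS]dsum_funD ux vy scalerDl.
  + split=> [|n /=]; first exact: (submod_setZ Um a Ux).
    by rewrite [LHS]dsum_funZ ux scalerA.
- by move=> z [_ /= z0]; apply: dsum_eq => n; rewrite z0 scale0r.
have [n0 n0P] := dsum_bound (g 1).
exists n0 => n n0n m y Imy.
have [z zE] : exists z : dsum V, dsum_fun z = fun n => y *: t n.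
  apply: ex_dsum; exists m => i mi; apply: It.
  exact: (ascending_le asc mi).
have gyz : g y = z by apply: gE; split=> /= [|k]; [apply: UE Imy | rewrite zE].
have := congr1 (fun w => dsum_fun w n) gyz; rewrite zE => <-.
have -> : g y = y *: g 1 by rewrite -linearZ; congr (g _); rewrite [RHS]mulr1.
by rewrite [LHS]dsum_funZ n0P // scaler0.
Qed.

Lemma noetherian_chain I : noetherian_module A^o ->
  (forall n, submod_set (I n)) -> (forall n, I n `<=` I n.+1) ->
  exists n, forall m, (n <= m)%N -> I m `<=` I n.
Proof.
move=> noeth Im asc.
have [N NE] := choice (fun n => ex_submod (Im n)).
have [|n nP] := noeth N; first by move=> n x; rewrite !NE; apply: asc.
by exists n => m nm x; rewrite -!NE nP.
Qed.

Lemma chain_noetherian : (forall I, (forall n, submod_set (I n)) ->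
  (forall n, I n `<=` I n.+1) -> exists n, forall m, (n <= m)%N -> I m `<=` I n) ->
  noetherian_module A^o.
Proof.
move=> ch N asc.
have [||n nP] := ch (fun n => [set x | x \in N n]).
- by move=> n; apply: submodClosed_set.
- by move=> n x; apply: asc.
exists n => m nm x; apply/idP/idP; first exact: (nP m nm).
exact: (ascending_le (I := fun n => [set x | x \in N n]) asc nm).
Qed.

Lemma noetherian_maximal (P : set (set A^o)) : noetherian_module A^o ->
  P !=set0 -> (forall J, P J -> submod_set J) ->
  exists J, P J /\ forall J', P J' -> J `<=` J' -> J' `<=` J.
Proof.
move=> noeth P0 Pm; apply: contrapT => nomax.
have [|I IP] := @no_maximal_sequence _ P (fun J K => J `<=` K /\ ~ (K `<=` J)) P0.
  move=> J0 PJ0; apply: contrapT => noJ; apply: nomax; exists J0; split=> // J PJ IJ.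
  by apply: contrapT => JI; apply: noJ; exists J.
have [||n nP] := @noetherian_chain I noeth.
- by move=> n; apply: Pm; case: (IP n).
- by move=> n; case: (IP n) => _ [].
by case: (IP n) => _ [_]; apply; apply: nP.
Qed.

End Chains.

Lemma submod_val_sum (A : pzRingType) (M : lmodType A) (N : submodClosed M)
    (s : seq (submod N)) : val (\sum_(u <- s) u) = \sum_(u <- s) val u.
Proof. exact: (big_morph val). Qed.

(** * When no injective module maps onto a non-injective simple module *)

(** All of this rests on [hom0_injective] below: a module without nonzero maps
    to S0 is injective. *)
Section HereditaryCase.
Context (A : pzRingType) (S0 : lmodType A).
Hypothesis simpleS0 : simple_module S0.
Hypothesis noninjS0 : ~ injective_module S0.
Hypothesis simple_indigent :
  forall S : lmodType A, simple_module S -> ~ injective_module S -> indigent S.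
Hypothesis injective_hom0 : forall (E : lmodType A) (f : {linear E -> S0}),
  injective_module E -> forall x, f x = 0.

Lemma hom0_injective (N : lmodType A) :
  (forall (f : {linear N -> S0}) x, f x = 0) -> injective_module N.
Proof. exact/indigent_hom0/simple_indigent. Qed.

Lemma injective_image (E Q : lmodType A) (p : {linear E -> Q}) :
  injective_module E -> (forall y, exists x, p x = y) -> injective_module Q.
Proof.
move=> Einj psurj; apply: hom0_injective => f y.
by have [x <-] := psurj y; apply: (injective_hom0 (f \o p)).
Qed.

(** A ring is Noetherian once direct sums of injective modules are injective:
    for a chain I_n, take an injective module containing the product of the
    A / I_n. *)
Lemma hereditary_case_noetherian : noetherian_module A^o.
Proof.
apply: chain_noetherian => I Im asc.
pose prodI : set (nat -> A^o) := [set f | forall n, I n (f n)].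
have prodIm : submod_set prodI.
  split=> [n|f g If Ig n|a f If n]; first exact: (submod_set0 (Im n)).
    exact: (submod_setD (Im n) (If n) (Ig n)).
  exact: (submod_setZ (Im n) a (If n)).
have [N NE] := ex_submod prodIm.
have [E [j [Einj jinj]]] := enough_injectives (quo N).
pose delta n (y : A^o) : nat -> A^o := fun i => if i == n then y else 0.
pose t n := j (pi_quo N (delta n 1)).
have tE n (y : A) : (y *: t n = 0) <-> I n y.
  have -> : y *: t n = j (pi_quo N (delta n y)).
    rewrite /t -!linearZ; congr (j (pi_quo N _)); apply/funext => i.
    rewrite /delta /= -[LHS]/(y *: (if i == n then 1 else 0 : A^o)).
    by case: eqP => _; rewrite ?scaler0 // [LHS]mulr1.
  split=> [|Iy].
    rewrite -(linear0 j) => /jinj /pi_quo_eq0; rewrite NE => /(_ n).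
    by rewrite /delta eqxx.
  have -> : pi_quo N (delta n y) = 0; last exact: linear0.
  apply/pi_quo_eq0; rewrite NE => i; rewrite /delta.
  by case: eqP => [->|_] //; apply: (submod_set0 (Im i)).
have Einj' : injective_module (dsum E).
  apply: hom0_injective => f; apply: dsum_hom0 => g v.
  exact: injective_hom0.
have [|n0 n0P] := dsum_injective_chain (t := t) Einj' Im asc.
  by move=> n y; rewrite tE.
by exists n0 => m _ y Imy; apply/(tE n0)/(n0P n0 _ m).
Qed.

(** If a module X embeds in an injective module E and p : X ->> B, then B
    embeds in the quotient of E by the kernel of p, which is injective; so maps
    from an ideal to B extend to maps from A to that quotient, and these lift
    to E because A is projective. *)
Lemma hereditary_case_projective (I : submodClosed (A^o : lmodType A)) :
  projective_module (submod I).
Proof.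
move=> X B p psurj f.
have [E [j [Einj jinj]]] := enough_injectives X.
have [N NE] := ex_submod (submod_set_image j (submod_set_ker p)).
have Qinj : injective_module (quo N).
  apply: (injective_image (p := pi_quo N) Einj) => u.
  by exists (val u); apply: pi_quoK.
pose G : set (A^o * quo N)%type :=
  [set yu | exists (u : submod I) x, [/\ yu.1 = val u, p x = f u & yu.2 = pi_quo N (j x)]].
have [||g gE] := @injective_graph A (quo N) A^o G Qinj.
- split=> [|[y u] [y' u'] [v [x [/= -> pv ->]]] [v' [x' [/= -> pv' ->]]]|a [y u] [v [x [/= -> pv ->]]]].
  + by exists 0, 0; rewrite /= !linear0.
  + by exists (v + v'), (x + x'); rewrite /= !linearD pv pv'.
  + by exists (a *: v), (a *: x); rewrite /= !linearZ /= pv.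
- move=> u [v [x [/= v0 pv ->]]]; apply/pi_quo_eq0; rewrite NE.
  exists x => //=; rewrite pv.
  have -> : v = 0 by apply: val_inj; exact: esym v0.
  exact: linear0.
have [e eE] : exists e : E, g 1 = pi_quo N e.
  by exists (val (g 1)); rewrite pi_quoK.
have lift (u : submod I) : exists x, j x = (val u : A) *: e /\ p x = f u.
  have [x px] := psurj (f u).
  have gu : g (val u) = pi_quo N (j x) by apply: gE; exists u, x.
  have gu' : g (val u) = pi_quo N ((val u : A) *: e).
    rewrite linearZ /= -eE -linearZ; congr (g _); exact: esym (mulr1 _).
  have : pi_quo N ((val u : A) *: e) = pi_quo N (j x) by rewrite -gu'.
  move/pi_quo_eq; rewrite NE => -[k /= pk jk].
  exists (k + x); rewrite !linearD jk pk subrK add0r; split=> //.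
have [h hP] := choice lift.
have [h' h'E] : exists h' : {linear submod I -> X}, h' =1 h.
  apply: ex_linear => [u v|a u]; apply: jinj.
    by rewrite linearD !(hP _).1 -scalerDl.
  by rewrite linearZ /= !(hP _).1 scalerA.
by exists h' => u /=; rewrite h'E (hP u).2.
Qed.

Section LargestInjective.
Context (M : lmodType A).

Definition injective_sum : set M :=
  [set x | exists2 s : seq M, x = \sum_(y <- s) y &
     forall y, y \in s ->
       exists2 L : submodClosed M, injective_module (submod L) & y \in L].

Lemma injective_sum_submod : submod_set injective_sum.
Proof.
split=> [|_ _ [s -> sP] [s' -> s'P]|a _ [s -> sP]].
- by exists [::]; rewrite ?big_nil.
- exists (s ++ s'); first by rewrite big_cat.
  by move=> y; rewrite mem_cat => /orP[]; [apply: sP | apply: s'P].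
- exists [seq a *: y | y <- s]; first by rewrite big_map scaler_sumr.
  move=> _ /mapP[y /sP[L Linj Ly] ->]; exists L => //.
  exact: rpredZ.
Qed.

(** A map from the sum to S0 vanishes on each injective submodule. *)
Lemma injective_sum_largest : exists N : submodClosed M, largest_injective_submodule N.
Proof.
have [N NE] := ex_submod injective_sum_submod; exists N.
have LN (L : submodClosed M) : injective_module (submod L) -> {subset L <= N}.
  move=> Linj x Lx; rewrite NE; exists [:: x]; first by rewrite big_seq1.
  by move=> y; rewrite inE => /eqP->; exists L.
split=> //; apply: hom0_injective => f [x Nx].
have [s xs sP] : injective_sum x by rewrite -NE.
have sN y : y \in s -> y \in N by move=> /sP[L /LN LN' /LN'].
have fs y (Ny : y \in N) : y \in s -> f (Submod Ny) = 0.
  move=> /sP[L Linj Ly].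
  have [i iE] : exists i : {linear submod L -> submod N}, forall u, val (i u) = val u.
    pose i0 (u : submod L) : submod N := Submod (LN L Linj _ (submod_valP u)).
    have [i iE] : exists i : {linear submod L -> submod N}, i =1 i0.
      by apply: ex_linear => [u v|a u]; apply: val_inj.
    by exists i => u; rewrite iE.
  have -> : Submod Ny = i (Submod Ly) by apply: val_inj; rewrite /= iE.
  exact: (injective_hom0 (f \o i)).
have [s' s'E s'0] : exists2 s' : seq (submod N), s = map val s' & forall u, u \in s' -> f u = 0.
  exists (pmap insub s).
    rewrite (pmap_filter (insubK _)); apply/esym/all_filterP/allP => y ys.
    by rewrite isSome_insub sN.
  move=> u; rewrite mem_pmap_sub => us.
  by have := fs (val u) (submod_valP u) us; congr (f _ = 0); apply: val_inj.
have -> : Submod Nx = \sum_(u <- s') u.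
  by apply: val_inj; rewrite submod_val_sum /= xs {1}s'E big_map.
by rewrite linear_sum big_seq big1 // => u /s'0.
Qed.

End LargestInjective.

(** If all simple submodules lie in N, the socles agree.  Let W be a simple
    submodule with W /\ N = 0.  If the maps from K to M extend to an injective
    module containing K, then a map from K to W, viewed in M, takes values in an
    image of an injective module, hence in N, hence is 0; as W is not injective
    it is indigent, and K is injective. *)
Lemma hereditary_case_dichotomy (M : lmodType A) :
  indigent M \/ exists2 N : submodClosed M, largest_injective_submodule N &
     Soc M = (val : submod N -> M) @` Soc (submod N).
Proof.
have [N [Ninj Nmax]] := injective_sum_largest M.
have [[W [Wsimp [w [Ww nNw]]]]|allN] := pselect (exists W : submodClosed M,
    simple_module (submod W) /\ exists w, w \in W /\ w \notin N).
  left=> K; split; last exact: injective_subinjective.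
  move=> MK.
  have WN0 x : x \in W -> x \in N -> x = 0.
    move=> Wx Nx.
    have [i iE] := ex_val_linear W.
    have Pm := submod_set_preim i (submodClosed_set N).
    case: (simple_set Wsimp Pm) => [P0|PT].
      have := P0 (Submod Wx); rewrite /= iE => /(_ Nx) /(congr1 val) /= //.
    by have := PT (Submod Ww); rewrite /= iE /= (negPf nNw).
  apply: (indigent_hom0 (S := submod W)).
    apply: simple_indigent => // Winj.
    by move/negP: nNw; apply; apply: Nmax Winj _ Ww.
  move=> f x.
  have [i iE] := ex_val_linear W.
  have [E [j [Einj jinj]]] := enough_injectives K.
  have [g gE] := MK E j jinj (i \o f).
  have [L LE] := ex_submod (submod_set_image g (@submod_setT _ E)).
  have Linj : injective_module (submod L).
    have gL e : g e \in L by rewrite LE; exists e.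
    have [g' g'E] : exists g' : {linear E -> submod L}, forall e, val (g' e) = g e.
      have [g' g'E] : exists g' : {linear E -> submod L}, g' =1 fun e => Submod (gL e).
        by apply: ex_linear => [u v|a u]; apply: val_inj; rewrite /= ?linearD ?linearZ.
      by exists g' => e; rewrite g'E.
    apply: (injective_image (p := g') Einj) => y.
    have : val y \in L by apply: submod_valP.
    by rewrite LE => -[e _ ge]; exists e; apply: val_inj; rewrite g'E.
  apply: val_inj; apply: WN0; first exact: submod_valP.
  rewrite -iE; have := gE x => /= <-; apply: Nmax Linj _ _.
  by rewrite LE; exists (j x).
right; exists N => //; apply/seteqP; split=> x.
  move=> [s xs sP].
  have sN y : y \in s -> y \in N.
    move=> /sP[W Wsimp Wy]; apply: contrapT => /negP Ny.
    by apply: allN; exists W; split=> //; exists y.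
  have s'E : s = map val (pmap insub s : seq (submod N)).
    rewrite (pmap_filter (insubK _)); apply/esym/all_filterP/allP => y ys.
    by rewrite isSome_insub sN.
  exists (\sum_(u <- (pmap insub s : seq (submod N))) u); last first.
    by rewrite submod_val_sum xs {2}s'E big_map.
  exists (pmap insub s) => // u; rewrite mem_pmap_sub => us.
  have [W Wsimp Wu] := sP _ us.
  have [i iE] := ex_val_linear N.
  have [W' W'E] := ex_submod (submod_set_preim i (submodClosed_set W)).
  have W'P v : (v \in W') = (val v \in W) :> Prop by rewrite W'E /= iE.
  exists W'; last by rewrite W'P.
  have WN y : y \in W -> y \in N.
    move=> Wy; apply: contrapT => /negP Ny.
    by apply: allN; exists W; split=> //; exists y.
  have [[[z0 Wz0] nz0] _] := Wsimp.
  have W'z0 : (Submod (WN _ Wz0)) \in W' by rewrite W'P.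
  apply: gen_simple.
    exists (Submod W'z0) => /(congr1 (val \o val)) /= z00.
    by move/eqP: nz0; apply; apply: val_inj.
  move=> [[a Na] W'a] [[b Nb] W'b] a0.
  have Wa : a \in W by move: (W'a); rewrite W'P.
  have Wb : b \in W by move: (W'b); rewrite W'P.
  have [|c] := simple_gen (s := Submod Wa) (Submod Wb) Wsimp.
    by move=> /(congr1 val) /= e; apply: a0; apply: val_inj; apply: val_inj.
  by move=> /(congr1 val) /= e; exists c; apply: val_inj; apply: val_inj.
move=> [_ [s -> sP] <-].
exists (map val s); first by rewrite big_map submod_val_sum.
move=> _ /mapP[u /sP[W Wsimp Wu] ->].
have [i iE] := ex_val_linear N.
have [W' W'E] := ex_submod (submod_set_image i (submodClosed_set W)).
exists W'; last by rewrite W'E; exists u => //; rewrite iE.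
have W'P v : v \in W -> val v \in W' by move=> Wv; rewrite W'E; exists v => //; rewrite iE.
have [[[z0 Wz0] nz0] _] := Wsimp.
apply: gen_simple.
  exists (Submod (W'P _ Wz0)) => /(congr1 val) /= e.
  by move/eqP: nz0; apply; apply: val_inj; apply: val_inj.
move=> [a W'a] [b W'b] a0.
have [a' Wa' aE] : exists2 a', a' \in W & val a' = a.
  by move: (W'a); rewrite W'E => -[a' /= Wa']; rewrite iE; exists a'.
have [b' Wb' bE] : exists2 b', b' \in W & val b' = b.
  by move: (W'b); rewrite W'E => -[b' /= Wb']; rewrite iE; exists b'.
have [|c] := simple_gen (s := Submod Wa') (Submod Wb') Wsimp.
  by move=> /(congr1 (val \o val)) /= e; apply: a0; apply: val_inj; rewrite /= -aE.
by move=> /(congr1 (val \o val)) /= e; exists c; apply: val_inj; rewrite /= -aE -bE.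
Qed.

End HereditaryCase.

(** * Right modules and right ideals *)

(** The scalars of a right module over R have type R^c, whose product is the
    opposite one; this operation takes them in R. *)
Definition ract (R : pzRingType) (V : rmodType R) (v : V) (a : R) : V :=
  (a : R^c) *: v.
Notation "v ** a" := (ract v a) (at level 40, left associativity) : ring_scope.

Section RightActions.
Context (R : pzRingType).
Implicit Types (V W : rmodType R) (a b x y : R) (I D : set R).

Lemma ractE V (v : V) a : v ** a = (a : R^c) *: v. Proof. by []. Qed.

Lemma ractA V (v : V) a b : v ** a ** b = v ** (a * b).
Proof. exact: scalerA. Qed.

Lemma ract1 V (v : V) : v ** 1 = v. Proof. exact: scale1r. Qed.

Lemma ractr0 V (v : V) : v ** 0 = 0. Proof. exact: scale0r. Qed.

Lemma ract0r V a : (0 : V) ** a = 0. Proof. exact: scaler0. Qed.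

Lemma ractDr V (v : V) a b : v ** (a + b) = v ** a + v ** b.
Proof. exact: scalerDl. Qed.

Lemma ractDl V (u v : V) a : (u + v) ** a = u ** a + v ** a.
Proof. exact: scalerDr. Qed.

Lemma ractNl V (v : V) a : (- v) ** a = - (v ** a).
Proof. exact: scalerN. Qed.

Lemma ractBl V (u v : V) a : (u - v) ** a = u ** a - v ** a.
Proof. exact: scalerBr. Qed.

Lemma ractBr V (v : V) a b : v ** (a - b) = v ** a - v ** b.
Proof. exact: scalerBl. Qed.

Lemma ract_suml V (I : Type) (r : seq I) (F : I -> V) a :
  (\sum_(i <- r) F i) ** a = \sum_(i <- r) F i ** a.
Proof. exact: scaler_sumr. Qed.

Lemma ract_sumr V (v : V) (I : Type) (r : seq I) (F : I -> R) :
  v ** (\sum_(i <- r) F i) = \sum_(i <- r) v ** F i.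
Proof. exact: (big_morph (fun a => v ** a) (ractDr v) (ractr0 v)). Qed.

Lemma ract_linear V W (f : {linear V -> W}) v a : f (v ** a) = f v ** a.
Proof. exact: linearZ. Qed.

Lemma ract_regular x a : ((x : right_regular R) ** a : R) = x * a.
Proof. by []. Qed.

Definition rideal I := submod_set (I : set (right_regular R)).

Lemma rideal0 I : rideal I -> I 0. Proof. exact: submod_set0. Qed.

Lemma ridealD I x y : rideal I -> I x -> I y -> I (x + y).
Proof. by move=> h; apply: (submod_setD h). Qed.

Lemma ridealN I x : rideal I -> I x -> I (- x).
Proof. by move=> h; apply: (submod_setN h). Qed.

Lemma ridealB I x y : rideal I -> I x -> I y -> I (x - y).
Proof. by move=> h; apply: (submod_setB h). Qed.

Lemma ridealM I x a : rideal I -> I x -> I (x * a).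
Proof. by move=> h; apply: (submod_setZ h (a : R^c)). Qed.

Lemma ex_rideal I : I 0 -> (forall x y, I x -> I y -> I (x + y)) ->
  (forall x a, I x -> I (x * a)) -> rideal I.
Proof. by move=> I0 ID IM; split=> // a x; apply: IM. Qed.

Definition rcyclic V (v : V) : set V := [set z | exists a : R, z = v ** a].

Lemma rcyclic_submod V (v : V) : submod_set (rcyclic v).
Proof. exact: submod_set_cyclic. Qed.

Lemma rcyclic_id V (v : V) : rcyclic v v.
Proof. by exists 1; rewrite ract1. Qed.

Lemma injective_ract V (G : set (right_regular R * V)%type) :
  injective_module V -> submod_set G -> (forall m, G (0, m) -> m = 0) ->
  exists m, forall (x : R) v, G (x, v) -> v = m ** x.
Proof.
move=> Vinj Gm G0; have [g gE] := injective_graph Vinj Gm G0.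
exists (g 1) => x v /gE <-; rewrite -ract_linear.
by congr (g _); exact: esym (mul1r x).
Qed.

Lemma injective_ract_cyclic V x (v : V) : injective_module V ->
  (forall a, x * a = 0 -> v ** a = 0) -> exists m, v = m ** x.
Proof.
move=> Vinj xv.
have [||m mP] := injective_ract (G := rcyclic ((x, v) : (right_regular R * V)%type)) Vinj.
- exact: rcyclic_submod.
- by move=> m [a [/esym xa ->]]; apply: xv.
by exists m; apply: mP; apply: rcyclic_id.
Qed.

Definition rann D : set R := [set y | forall x, D x -> x * y = 0].

Lemma rideal_rann D : rideal (rann D).
Proof.
apply: ex_rideal => [x _|y z Dy Dz x Dx|y a Dy x Dx]; first exact: mulr0.
  by rewrite mulrDr Dy // Dz // addr0.
by rewrite mulrA Dy // mul0r.
Qed.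

(** The ascending chain condition on right annihilators, in the form of the
    existence of maximal ones. *)
Definition rann_acc := forall P : set (set R), P !=set0 ->
  exists D, P D /\ forall D', P D' -> rann D `<=` rann D' -> rann D' `<=` rann D.

Definition rcolon I D : set R := [set y | forall x, D x -> I (x * y)].

Definition rcolon_acc I := forall P : set (set R), P !=set0 ->
  exists D, P D /\ forall D', P D' -> rcolon I D `<=` rcolon I D' ->
    rcolon I D' `<=` rcolon I D.

Lemma rcolon_rideal I D : rideal I -> rideal (rcolon I D).
Proof.
move=> Im; apply: ex_rideal => [x _|y z Dy Dz x Dx|y a Dy x Dx].
- by rewrite mulr0; apply: rideal0.
- by rewrite mulrDr; apply: ridealD => //; [apply: Dy | apply: Dz].
- by rewrite mulrA; apply: ridealM => //; apply: Dy.
Qed.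

Lemma noetherian_rcolon_acc I : right_noetherian R -> rideal I -> rcolon_acc I.
Proof.
move=> noeth Im P [D0 PD0].
have [||J [[D PD <-] Jmax]] :=
    noetherian_maximal (A := R^c) (P := [set rcolon I D | D in P]) noeth.
- by exists (rcolon I D0), D0.
- by move=> _ [D _ <-]; apply: rcolon_rideal.
by exists D; split=> // D' PD'; apply: Jmax; exists D'.
Qed.

Lemma rann_acc_colon : rann_acc <-> rcolon_acc [set 0].
Proof. by []. Qed.

Lemma rideal_zero : rideal [set 0].
Proof.
apply: ex_rideal => [|x y -> ->|x a ->] //; first by rewrite /= addr0.
by rewrite /= mul0r.
Qed.

Lemma noetherian_rann_acc : right_noetherian R -> rann_acc.
Proof. by move=> noeth; apply/rann_acc_colon/noetherian_rcolon_acc/rideal_zero. Qed.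

End RightActions.

(** * Self-injective local rings *)

(** J is the maximal right ideal of the local ring L. *)
Section LocalRing.
Context (L : pzRingType) (J : set L).
Hypothesis Jideal : rideal J.
Hypothesis J1 : ~ J 1.
Hypothesis Junit : forall x, ~ J x -> exists y, x * y = 1.
Hypothesis selfinj : injective_module (right_regular L).
Hypothesis acc : rann_acc L.

(** If x y = 1 and y lay in J, then 1 - y x would be invertible, whereas
    x (1 - y x) = 0. *)
Lemma local_unit (x : L) : ~ J x -> exists y, x * y = 1 /\ y * x = 1.
Proof.
move=> Jx; have [y xy] := Junit Jx; exists y; split=> //.
have Jy : ~ J y.
  move=> Jy; have [|w yxw] := @Junit (1 - y * x).
    move=> h; apply: J1; rewrite -(subrK (y * x) 1).
    by apply: ridealD => //; apply: ridealM.
  have x0 : x = 0.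
    by rewrite -[LHS]mulr1 -yxw mulrA mulrBr mulr1 mulrA xy mul1r subrr mul0r.
  by apply: J1; rewrite -xy x0 mul0r; apply: rideal0.
have [z yz] := Junit Jy.
by rewrite -[x]mulr1 -yz !mulrA -[y * x * y]mulrA xy mulr1.
Qed.

Lemma local_left_ideal (a b : L) : J a -> J (b * a).
Proof.
move=> Ja; apply: contrapT => /local_unit[y [_ yba]].
have ca : (y * b) * a = 1 by rewrite -mulrA.
have [Jc|/local_unit[d [_ dc]]] := pselect (J (y * b)).
  by apply: J1; rewrite -ca; apply: ridealM.
have ad : a = d by rewrite -[LHS]mul1r -dc -mulrA ca mulr1.
by apply: J1; rewrite -dc -ad; apply: ridealM.
Qed.

Lemma local_sub_unit (a : L) : J a -> exists w, (1 - a) * w = 1 /\ w * (1 - a) = 1.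
Proof.
move=> Ja; apply: local_unit => h; apply: J1.
by rewrite -(subrK a 1); apply: ridealD.
Qed.

Lemma local_fixed_zero (m x : L) : J m -> x = m * x -> x = 0.
Proof.
move=> /local_sub_unit[w [_ wm]] e.
by rewrite -[x]mul1r -wm -mulrA mulrBl mul1r -e subrr mulr0.
Qed.

Lemma rann_sub_factor (x y : L) : rann [set x] `<=` rann [set y] -> exists b, y = b * x.
Proof.
move=> xy; apply: (injective_ract_cyclic (V := right_regular L) selfinj) => a xa.
by apply: (xy a) => // _ ->.
Qed.

(** Take a outside A with largest right annihilator.  If m a is outside A too,
    it has the same annihilator as a, so a is a left multiple b m a of it and
    thus 0, because 1 - b m is invertible. *)
Lemma left_socle (A : set L) : A 0 -> ~ A 1 ->
  exists a, ~ A a /\ forall m, J m -> A (m * a).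
Proof.
move=> A0 A1.
have [|D [[a [Aa ->]] amax]] := @acc [set D | exists a, ~ A a /\ D = [set a]].
  by exists [set 1], 1.
exists a; split=> // m Jm; apply: contrapT => Ama.
have [|b ab] := @rann_sub_factor (m * a) a.
  apply: (amax [set m * a]); first by exists (m * a).
  by move=> y y0 _ ->; rewrite -mulrA y0 ?mulr0.
apply: Aa; rewrite (@local_fixed_zero (b * m) a) //; first exact: local_left_ideal.
by rewrite -mulrA.
Qed.

(** Take D for which the right ideal C of all y with D y <= I is largest.
    Then D J <= I: by [left_socle] there is an a outside C with J a <= C, so
    that a belongs to the corresponding ideal for D J. *)
Lemma right_socle (I D0 : set L) : rcolon_acc I -> I 0 ->
  ~ D0 `<=` I -> (forall x a, D0 x -> D0 (x * a)) ->
  exists d, [/\ D0 d, ~ I d & forall m, J m -> I (d * m)].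
Proof.
move=> Iacc I0 D0I D0M.
have [|D [[DD0 DI DM] Dmax]] := @Iacc
    [set D | [/\ D `<=` D0, ~ D `<=` I & forall x a, D x -> D (x * a)]].
  by exists D0; split.
have DJ d m : D d -> J m -> I (d * m).
  move=> Dd Jm; apply: contrapT => ndm.
  pose D' : set L := [set x | exists d m, [/\ D d, J m & x = d * m]].
  have D'D : D' `<=` D by move=> _ [e [n [De Jn ->]]]; apply: DM.
  have D'max : rcolon I D' `<=` rcolon I D.
    apply: Dmax; last by move=> y Dy x /D'D; apply: Dy.
    split; first exact: subset_trans DD0.
      by move=> D'I; apply: ndm; apply: D'I; exists d, m.
    move=> _ a [e [n [De Jn ->]]]; exists e, (n * a).
    by rewrite mulrA; split=> //; apply: ridealM.
  have [|h|a [Da aJ]] := @left_socle (rcolon I D).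
  - by move=> x _; rewrite mulr0.
  - by apply: DI => x /h; rewrite mulr1.
  apply: Da; apply: D'max => _ [e [n [De Jn ->]]].
  by rewrite -mulrA; apply: aJ.
have /existsNP[d /not_implyP[Dd Id]] := DI.
by exists d; split=> //; [apply: DD0 | move=> m; apply: DJ].
Qed.

Lemma ex_socle_elt : exists k, k <> 0 /\ forall m, J m -> k * m = 0.
Proof.
have [|h|//|k [_ k0 kJ]] := @right_socle [set 0] setT ((rann_acc_colon L).1 acc).
- by [].
- by apply: J1; rewrite (h 1 I); apply: rideal0.
by exists k.
Qed.

(** k generates the right socle of L, which is simple and essential. *)
Section SocleElement.
Variable k : L.
Hypotheses (k0 : k <> 0) (kJ : forall m, J m -> k * m = 0).

Lemma socle_elt_rann a : k * a = 0 -> J a.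
Proof.
move=> ka; apply: contrapT => /Junit[y ay]; apply: k0.
by rewrite -[k]mulr1 -ay mulrA ka mul0r.
Qed.

(** The map i + x a |-> k a on I + xL is well defined, because x a in I
    requires a in J; it is a left multiplication. *)
Lemma socle_elt_cogenerates (I : set L) x : rideal I -> ~ I x ->
  exists y, (forall i, I i -> y * i = 0) /\ y * x = k.
Proof.
move=> Im Ix.
pose G1 : set (right_regular L * right_regular L)%type := [set z | I z.1 /\ z.2 = 0].
pose G2 := rcyclic ((x, k) : (right_regular L * right_regular L)%type).
have G1m : submod_set G1.
  split=> [|[a b] [c d] [/= Ia ->] [/= Ic ->]|r [a b] [/= Ia ->]].
  - by split=> //; exact: (rideal0 Im).
  - by split; [exact: (ridealD Im Ia Ic) | exact: addr0].
  - by split; [exact: (submod_setZ Im r Ia) | exact: scaler0].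
have [||y yP] := injective_ract (G := setadd G1 G2) selfinj.
- exact: (submod_set_add G1m (rcyclic_submod _)).
- move=> m [[i v] [_ [[/= Ii ->] [a ->]] [/esym ixa ->]]].
  apply: etrans (add0r _) _; apply: kJ; apply: contrapT => /Junit[b ab].
  apply: Ix; rewrite -[x]mulr1 -ab mulrA; apply: ridealM => //.
  have -> : x * a = - i by apply/eqP; rewrite -addr_eq0 addrC; apply/eqP.
  exact: (ridealN Im Ii).
exists y; split=> [i Ii|]; apply: esym; apply: (yP _ _).
  exact: (setaddl (rcyclic_submod _)).
by apply: (setaddr G1m); apply: rcyclic_id.
Qed.

Lemma socle_elt_essential (I : set L) x : rideal I -> I x -> x <> 0 -> I k.
Proof.
move=> Im Ix x0.
have [//|h|x' a|d [Id d0 dJ]] := @right_socle [set 0] I ((rann_acc_colon L).1 acc).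
- by apply: x0; apply: h.
- exact: ridealM.
have [[a da]|kd] := pselect (rcyclic (k : right_regular L) d).
  have Ja : ~ J a by move=> /kJ ka; apply: d0; rewrite da.
  have [b ab] := Junit Ja.
  rewrite -[k]mulr1 -ab mulrA; apply: ridealM => //.
  by rewrite -ract_regular -da.
have [y [yk yd]] := socle_elt_cogenerates (rcyclic_submod _) kd.
have Jy : J y.
  apply: contrapT => /local_unit[z [_ zy]]; apply: k0.
  by rewrite -[k]mul1r -zy -mulrA yk ?mulr0 //; apply: (rcyclic_id (k : right_regular L)).
suff dl : y * d = 0 by case: k0; rewrite -yd.
apply: contrapT => yd0.
have [|b db] := @rann_sub_factor (y * d) d.
  move=> c /(_ _ erefl) ydc _ ->; apply: dJ; apply: contrapT => /Junit[z cz].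
  by apply: yd0; rewrite -[y * d]mulr1 -cz mulrA ydc mul0r.
apply: d0; apply: (@local_fixed_zero (b * y)); first exact: local_left_ideal.
by rewrite -mulrA.
Qed.

(** By [socle_elt_cogenerates] every right ideal is an annihilator. *)
Lemma local_noetherian : right_noetherian L.
Proof.
apply: chain_noetherian => I Im asc.
pose lann (n : nat) : set L := [set x : L | forall y : L, I n y -> x * y = 0 :> L].
have [|D [[n _ <-] nmax]] := @acc (range lann); first by exists (lann 0%N), 0%N.
exists n => m nm x Ix; apply: contrapT => Inx.
have [y [yI yx]] := socle_elt_cogenerates (Im n) Inx.
apply: k0; rewrite -yx.
have sub : rann (lann n) `<=` rann (lann m).
  by move=> z zn u um; apply: zn => v Iv; exact: (um v (ascending_le asc nm Iv)).
have Pm : range lann (lann m) by exists m.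
have xm : rann (lann m) x by move=> u um; exact: (um x Ix).
exact: (nmax (lann m) Pm sub x xm y yI).
Qed.

(** In other words, L / kL embeds in a finite power of L.  It suffices that its
    socle B / kL does.  A submodule C / kL of the socle for which finitely many
    elements of J suffice can be enlarged by any b in B, at the cost of one
    more element of J, and L is Noetherian. *)
Lemma finite_annihilation : right_noetherian L -> exists js : seq L,
  (forall j, j \in js -> J j) /\
  (forall y, (forall j, j \in js -> j * y = 0) -> exists a, y = k * a).
Proof.
move=> noeth.
pose C0 : set L := rcyclic (k : right_regular L).
have C0m : rideal C0 := rcyclic_submod _.
pose B : set L := [set b | forall m, J m -> C0 (b * m)].
have Bm : rideal B.
  apply: ex_rideal => [m _|x y Bx By m Jm|x a Bx m Jm].
  - by rewrite mul0r; apply: rideal0.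
  - by rewrite mulrDl; apply: ridealD => //; [apply: Bx | apply: By].
  - by rewrite -mulrA; apply: Bx; apply: local_left_ideal.
pose good (C : set L) := exists js : seq L, (forall j, j \in js -> J j) /\
  forall y, C y -> (forall j, j \in js -> j * y = 0) -> C0 y.
have [||C [[Cm C0C CB [js [jsJ jsC]]] Cmax]] := noetherian_maximal (A := L^c)
    (P := [set C | [/\ rideal C, C0 `<=` C, C `<=` B & good C]]) noeth.
- exists C0; split=> //; last by exists [::].
  by move=> x C0x m _; apply: ridealM.
- by move=> C [].
have BC : B `<=` C.
  move=> b Bb; apply: contrapT => nCb.
  pose C' : set L := setadd (C : set (right_regular L)) (rcyclic (b : right_regular L)).
  have C'm : rideal C' := submod_set_add Cm (rcyclic_submod _).
  have CC' : C `<=` C' := setaddl (rcyclic_submod _).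
  have C'b : C' b by apply: (setaddr Cm); apply: (rcyclic_id (b : right_regular L)).
  have C'B : C' `<=` B.
    move=> _ [c [_ [Cc [a ->] ->]]]; exact: (ridealD Bm (CB _ Cc) (ridealM a Bm Bb)).
  have C0C' : C0 `<=` C' by exact: subset_trans CC'.
  suff gC' : good C' by apply: nCb; exact: (Cmax C' (And4 C'm C0C' C'B gC') CC' b C'b).
  have [jsC'|] := pselect (forall y, C' y -> (forall j, j \in js -> j * y = 0) -> C0 y).
    by exists js.
  move=> /existsNP[b' /not_implyP[C'b' /not_implyP[jsb' nC0b']]].
  have [i [iC0 ib']] := socle_elt_cogenerates C0m nC0b'.
  have nCb' : ~ C b' by move=> Cb'; apply: nC0b'; apply: jsC.
  exists (i :: js); split=> [j|y C'y jsy].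
    rewrite inE => /orP[/eqP->|]; last exact: jsJ.
    apply: contrapT => /local_unit[z [_ zi]]; apply: k0.
    rewrite -[k]mul1r -zi -mulrA iC0 ?mulr0 //; exact: (rcyclic_id (k : right_regular L)).
  have [c [_ [Cc [u ->] b'E]]] := C'b'.
  have Ju : ~ J u.
    by move=> Ju; apply: nCb'; rewrite b'E; exact: (ridealD Cm Cc (C0C _ (Bb u Ju))).
  have [w uw] := Junit Ju.
  have [c' [_ [Cc' [a ->] yE]]] := C'y.
  have [d [Cd yd]] : exists d, C d /\ y = d + b' * (w * a).
    exists ((c' : L) - (c : L) * (w * a)); split.
      exact: (ridealB Cm Cc' (ridealM _ Cm Cc)).
    rewrite yE b'E -[LHS]/((c' : L) + b * a) -[X in _ = _ + X * _]/((c : L) + b * u).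
    rewrite mulrDl addrA subrK.
    by congr (_ + _); rewrite !mulrA -[b * u * w]mulrA uw mulr1.
  have C0d : C0 d.
    apply: jsC => // j jjs.
    have : j * y = 0 by apply: jsy; rewrite inE jjs orbT.
    by rewrite yd mulrDr mulrA jsb' // mul0r addr0.
  have : i * y = 0 by apply: jsy; rewrite inE eqxx.
  rewrite yd mulrDr iC0 // add0r mulrA ib' => /socle_elt_rann Jwa.
  apply: (ridealD C0m) => //; have : B b' by apply: C'B.
  by apply.
exists js; split=> // y jsy; apply: contrapT => nC0y.
have [|h|x a jsx j jjs|d [jsd C0d dJ]] := @right_socle C0
    [set y | forall j, j \in js -> j * y = 0] (noetherian_rcolon_acc noeth C0m).
- exact: rideal0.
- by apply: nC0y; apply: h.
- by rewrite mulrA jsx // mul0r.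
by apply: C0d; apply: jsC => //; apply: BC.
Qed.

Section Modules.
Variable X : rmodType L.

(** The subgroup X J. *)
Definition radical_part : set X := [set y | forall Z : set X, Z 0 ->
  (forall u v, Z u -> Z v -> Z (u + v)) -> (forall x m, J m -> Z (x ** m)) -> Z y].

Lemma radical_partM x m : J m -> radical_part (x ** m).
Proof. by move=> Jm Z _ _; apply. Qed.

Lemma radical_part_submod : submod_set radical_part.
Proof.
split=> [Z //|x y Xx Xy Z Z0 ZD ZJ|r x Xx].
  by apply: (ZD); [exact: (Xx Z Z0 ZD ZJ) | exact: (Xy Z Z0 ZD ZJ)].
suff : [set w | radical_part (w ** (r : L))] x by [].
apply: Xx => /= [|u v Xu Xv|y m Jm].
- by rewrite ract0r => Z.
- by rewrite ractDl => Z Z0 ZD ZJ; apply: (ZD); [exact: (Xu Z Z0 ZD ZJ) | exact: (Xv Z Z0 ZD ZJ)].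
- by rewrite ractA; apply: radical_partM; apply: ridealM.
Qed.

(** For Z maximal among the submodules containing X J but not x, the
    submodule x L + Z is everything: X / X J is semisimple. *)
Lemma radical_part_separates (V : rmodType L) (s : V) x :
  (forall m, J m -> s ** m = 0) -> ~ radical_part x ->
  exists f : {linear X -> V}, f x = s.
Proof.
move=> sJ XJx.
have [||Z [XJZ [Zm Zx] Zmax]] := @Zorn_above _
    [set Z : set X | submod_set Z /\ ~ Z x] radical_part.
- by split; first exact: radical_part_submod.
- move=> F F0 FP totF; split; last by move=> [Z /FP[]].
  by apply: submod_set_chain => // Z /FP[].
have xZ y : exists a, Z (y - x ** a).
  have [Zy|nZy] := pselect (Z y); first by exists 0; rewrite ractr0 subr0.
  have [Z'x|nZ'x] := pselect (setadd Z (rcyclic y) x); last first.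
    exfalso; apply: nZy; apply: (Zmax (setadd Z (rcyclic y))).
    - by split=> //; apply: submod_set_add => //; apply: rcyclic_submod.
    - exact: (setaddl (rcyclic_submod _)).
    - by apply: (setaddr Zm); apply: rcyclic_id.
  have [z [_ [Zz [b ->] xE]]] := Z'x.
  have [|c bc] := @Junit b.
    move=> Jb; apply: Zx; rewrite xE; apply: submod_setD => //.
    by apply: XJZ; apply: radical_partM.
  exists c; rewrite xE ractDl ractA bc ract1 opprD addrCA subrr addr0 -ractNl.
  by apply: (submod_setZ Zm (c : L^c)); apply: submod_setN.
have [a aP] := choice xZ.
have fE y b : Z (y - x ** b) -> s ** a y = s ** b.
  move=> yb; apply/eqP; rewrite -subr_eq0 -ractBr; apply/eqP/sJ.
  apply: contrapT => /Junit[c bc]; apply: Zx.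
  rewrite -[x]ract1 -bc -ractA; apply: (submod_setZ Zm (c : L^c)).
  have -> : x ** (a y - b) = (y - x ** b) - (y - x ** a y).
    by rewrite ractBr opprB [RHS]addrC addrA subrK.
  exact: submod_setB.
have [f fa] : exists f : {linear X -> V}, f =1 (fun y => s ** a y).
  apply: ex_linear => [y z|b y].
    rewrite -ractDr; apply: fE; rewrite ractDr opprD addrACA.
    exact: submod_setD.
  rewrite -!ractE ractA; apply: fE; rewrite -ractA -ractBl.
  exact: (submod_setZ Zm b (aP y)).
exists f; rewrite fa -[RHS]ract1; apply: fE.
by rewrite ract1 subrr; apply: submod_set0.
Qed.

(** A maximal injective submodule P is a direct summand.  If the complement is
    nonzero, some y in it has y k <> 0: otherwise it is equal to its product
    with J, and its annihilator A contains each a with J a <= A, against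
    [left_socle].  Then y L is isomorphic to L and P + y L is injective. *)
Lemma local_injective : right_noetherian L ->
  (forall x : X, x ** k = 0 -> radical_part x) -> injective_module X.
Proof.
move=> noeth XkJ.
(* Baer's criterion for P, with maps taking values in X. *)
pose bset (P : set X) := forall (I : set L) (h : right_regular L -> X),
  rideal I -> linear_on (I : set (right_regular L)) h -> (forall x, I x -> P (h x)) ->
  exists p, P p /\ forall x, I x -> h x = p ** x.
have [||P [_ [Pm Pb] Pmax]] := @Zorn_above _
    [set P : set X | submod_set P /\ bset P] [set 0].
- split; first by split=> [|x y -> ->|a x ->] //=; rewrite ?addr0 ?scaler0.
  by move=> I h Im hI h0; exists 0; split=> // x /h0 ->; rewrite ract0r.
- move=> F [P0 FP0] FP totF; split.
    by apply: submod_set_chain => [||//]; [exists P0 | move=> Z /FP[]].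
  move=> I h Im [hD hZ] hF.
  (* By Noetherianity h takes values in a single member of the chain. *)
  have [||K [[P FP' <-] Kmax]] := noetherian_maximal (A := L^c)
      (P := [set I `&` (h @^-1` P : set L) | P in F]) noeth.
  + by exists (I `&` (h @^-1` P0 : set L)), P0.
  + move=> _ [P FP' <-]; have [Pm _] := FP P FP'.
    split=> [|x y [Ix hx] [Iy hy]|a x [Ix hx]].
    * split; first exact: (rideal0 Im).
      by rewrite /= (linear_on0 Im) //; apply: submod_set0.
    * by split; [exact: (ridealD Im Ix Iy) | rewrite /= hD //; apply: submod_setD].
    * by split; [exact: (submod_setZ Im a Ix) | rewrite /= hZ //; apply: submod_setZ].
  have hP x : I x -> P (h x).
    move=> Ix; have [Q FQ Qhx] := hF x Ix.
    case: (totF P Q FP' FQ) => PQ; last exact: PQ.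
    have [] // := Kmax (I `&` (h @^-1` Q : set L)) _ _ x.
    * by exists Q.
    * by move=> y [Iy Py]; split=> //; apply: PQ.
  have [p [Pp pE]] := (FP P FP').2 I h Im (conj hD hZ) hP.
  by exists p; split=> //; exists P.
have [N NE] := ex_submod Pm.
have Ninj : injective_module (submod N).
  apply: baer_injective => I h Im [hD hZ].
  have [|x Ix|p [Pp pE]] := Pb I (fun x => val (h x)) Im.
  - by split=> [x y Ix Iy|a x Ix]; rewrite ?hD ?hZ.
  - by rewrite -NE; apply: submod_valP.
  rewrite -NE in Pp; exists (Submod Pp) => x Ix.
  by apply: val_inj; rewrite /= -[LHS]/(val (h x)) pE.
have [q [qP qid]] := injective_retract Ninj.
have PT x : P x.
  apply: contrapT => nPx.
  have qq y : q (y - q y) = 0 by rewrite linearB (qid _ (qP y)) subrr.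
  have [[y [qy yk]]|noy] := pselect (exists y, q y = 0 /\ y ** k <> 0).
    have yfree a : y ** a = 0 -> a = 0.
      move=> ya; apply: contrapT => a0; apply: yk.
      have yann : rideal [set a | y ** a = 0].
        apply: ex_rideal => [|b c yb yc|b c yb] /=; first exact: ractr0.
          by rewrite ractDr yb yc addr0.
        by rewrite -ractA yb ract0r.
      exact: (socle_elt_essential yann ya a0).
    have yP : P y; last by apply: yk; rewrite -(qid y) ?NE // qy ract0r.
    apply: (Pmax (setadd P (rcyclic y))).
    - split; first by apply: submod_set_add => //; apply: rcyclic_submod.
      move=> I h Im hI hP'; have [hD hZ] := hI.
      have [|z Iz|p [Pp pE]] := Pb I (fun z => q (h z)) Im.
      + by split=> [u v Iu Iv|a u Iu]; rewrite ?hD ?hZ ?linearD ?linearZ.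
      + by rewrite -NE.
      pose G : set (right_regular L * right_regular L)%type :=
        [set za | I za.1 /\ h za.1 = p ** za.1 + y ** za.2].
      have [||c cP] := injective_ract (G := G) selfinj.
      + split=> [|[u a] [v b] [/= Iu hu] [/= Iv hv]|r [u a] [/= Iu hu]].
        * split=> /=; first exact: (rideal0 Im).
          by rewrite (linear_on0 Im hI) !ractr0 addr0.
        * split=> /=; first exact: (ridealD Im Iu Iv).
          by rewrite hD // hu hv !ractDr addrACA.
        * split=> /=; first exact: (submod_setZ Im r Iu).
          by rewrite hZ // hu scalerDr -!ractE !ractA.
      + move=> a [/= I0]; rewrite (linear_on0 Im hI) ractr0 add0r => /esym.
        exact: yfree.
      exists (p + y ** c); split.
        by exists p, (y ** c); split=> //; exists c.
      move=> z Iz; have [p' [_ [Pp' [a ->] hz]]] := hP' z Iz.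
      have hza : h z = p ** z + y ** a.
        by rewrite -pE // {2}hz linearD ract_linear qy ract0r addr0 qid ?NE.
      have az : a = (c : L) * (z : L) by apply: (cP z a).
      by rewrite hza az ractDl ractA.
    - exact: (setaddl (rcyclic_submod _)).
    - by apply: (setaddr Pm); apply: rcyclic_id.
  have [y _|h|a [na aJ]] := @left_socle [set a | forall y, q y = 0 -> y ** a = 0].
  - exact: ractr0.
  - apply: nPx; have := h _ (qq x); rewrite ract1 => /eqP; rewrite subr_eq0 => /eqP ->.
    by rewrite -NE.
  apply: na => y qy.
  have yJ : radical_part y.
    by apply: XkJ; apply: contrapT => yk; apply: noy; exists y.
  suff : (y - q y) ** a = 0 by rewrite qy subr0.
  apply: (yJ [set w | (w - q w) ** a = 0]) => /= [|u v qu qv|u m Jm].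
  - by rewrite linear0 subr0 ract0r.
  - by rewrite linearD opprD addrACA ractDl qu qv addr0.
  - by rewrite ract_linear -ractBl ractA; exact: (aJ m Jm _ (qq u)).
apply: baer_injective => I h Im hI.
by have [p [_ pE]] := Pb I h Im hI (fun x _ => PT _); exists p.
Qed.

End Modules.
End SocleElement.
End LocalRing.

(** * When a non-injective simple module is the image of an injective one *)

Lemma retract_injective (A : pzRingType) (M E : lmodType A)
    (f : {linear M -> E}) (g : {linear E -> M}) :
  injective_module E -> cancel f g -> injective_module M.
Proof.
move=> Einj fK N K i inji h; have [h' h'E] := Einj N K i inji (f \o h).
by exists (g \o h') => x /=; rewrite [h' (i x)]h'E /= fK.
Qed.

Section ImageOfInjective.
Context (R : pzRingType) (S E : rmodType R) (p : {linear E -> S}).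
Hypothesis Sind : indigent S.
Hypothesis Einj : injective_module E.
Hypothesis psurj : forall s, exists t, p t = s.

(** Maps to S from a projective module P factor through E, and so extend to
    every module containing P. *)
Lemma lifting_injective (P : rmodType R) :
  (forall f : {linear P -> S}, exists g : {linear P -> E}, forall x, p (g x) = f x) ->
  injective_module P.
Proof.
move=> lift; apply/Sind => K i inji f.
have [g gE] := lift f; have [h hE] := Einj inji g.
by exists (p \o h) => x /=; rewrite [h (i x)]hE gE.
Qed.

Lemma regular_injective : injective_module (right_regular R).
Proof.
apply: lifting_injective => f; have [t tE] := psurj (f 1).
have [g gE] : exists g : {linear right_regular R -> E}, g =1 (fun x : R => t ** x).
  by apply: ex_linear => [x y|a x]; [apply: ractDr | exact: esym (ractA t (x : R) (a : R))].
exists g => x; rewrite gE ract_linear tE -ract_linear.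
by congr (f _); exact: (mul1r (x : R)).
Qed.

(** In a strictly ascending chain of annihilators of sets D_n, let t_n in D_n
    not annihilate the annihilator of D_(n+1); [dsum_injective_chain] for the
    t_n is contradicted. *)
Lemma regular_rann_acc : rann_acc R.
Proof.
move=> P P0; apply: contrapT => nomax.
have [|D DP] := @no_maximal_sequence _ P
    (fun D D' => rann D `<=` rann D' /\ ~ (rann D' `<=` rann D)) P0.
  move=> D PD; apply: contrapT => noD; apply: nomax; exists D; split=> // D' PD' DD'.
  by apply: contrapT => D'D; apply: noD; exists D'.
have ex n : exists ty : R * R, [/\ D n ty.1, rann (D n.+1) ty.2 & ty.1 * ty.2 <> 0].
  have [_ [_ /existsNP[y /not_implyP[Dy /existsNP[t /not_implyP[Dt ty]]]]]] := DP n.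
  by exists (t, y).
have [ty tyP] := choice ex.
have dinj : injective_module (dsum (right_regular R)).
  by apply: lifting_injective => f; apply: dsum_lift.
have [|||n0 n0P] := dsum_injective_chain (A := R^c) (I := fun n => rann (D n))
    (t := fun n => (ty n).1 : right_regular R) dinj.
- by move=> n; apply: rideal_rann.
- by move=> n; case: (DP n) => _ [].
- by move=> n y Dy; apply: Dy; case: (tyP n).
have [_ Dy] := tyP n0; apply.
exact: (n0P n0 (leqnn _) n0.+1 _ Dy).
Qed.

End ImageOfInjective.

(** * Primitive idempotents of self-injective rings *)

Section Primitive.
Context (R : pzRingType).

Definition primitive (e : R) := [/\ e * e = e, e <> 0 &
  forall g, g * g = g -> e * g = g -> g * e = g -> g = 0 \/ g = e].

(** Among the idempotents f with s f <> 0, one with largest right annihilator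
    is primitive: if f = g + h orthogonally, then s g or s h is not 0. *)
Lemma ex_primitive (S : rmodType R) (s : S) : rann_acc R -> s <> 0 ->
  exists e, primitive e /\ s ** e <> 0.
Proof.
move=> acc s0.
have [|D [[f [-> ff sf]] fmax]] := acc
    [set D | exists f, [/\ D = [set f], f * f = f & s ** f <> 0]].
  by exists [set 1], 1; rewrite mulr1 ract1.
have key g : g * g = g -> f * g = g -> g * f = g -> s ** g <> 0 -> g = f.
  move=> gg fg gf sg.
  have h0 : f * (f - g) = 0.
    apply: (fmax [set g]) => //; first by exists g.
      by move=> y fy _ ->; rewrite -gf -mulrA fy ?mulr0.
    by move=> _ ->; rewrite mulrBr gf gg subrr.
  by apply/eqP; rewrite eq_sym -subr_eq0 -h0 mulrBr ff fg.
exists f; split=> //; split=> // [f0|g gg fg gf].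
  by apply: sf; rewrite f0 ractr0.
have [sg|] := pselect (s ** g = 0); last by move=> /(key g gg fg gf); right.
left; have : f - g = f.
  apply: key; rewrite ?mulrBr ?mulrBl ?ff ?fg ?gf ?gg ?subrr ?subr0 //.
  by rewrite ractBr sg subr0.
by move/eqP; rewrite -subr_eq0 addrAC subrr add0r oppr_eq0 => /eqP.
Qed.

Lemma primitive_idem e : primitive e -> e * e = e.
Proof. by case. Qed.

Hypothesis selfinj : injective_module (right_regular R).
Variable e : R.
Hypothesis eprim : primitive e.

Let ee : e * e = e := primitive_idem eprim.

Definition in_eR (A : set R) := forall y, A y -> e * y = y.

Lemma maximal_complement (A B : set R) : rideal A -> rideal B -> in_eR A ->
  (forall y, A y -> B y -> y = 0) ->
  exists C, [/\ rideal C, in_eR C, A `<=` C, forall y, C y -> B y -> y = 0 &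
    forall C', rideal C' -> in_eR C' -> C `<=` C' ->
      (forall y, C' y -> B y -> y = 0) -> C' `<=` C].
Proof.
move=> Am Bm Ae AB.
have [||C [AC [Cm Ce CB] Cmax]] := @Zorn_above _ [set C : set R |
    [/\ rideal C, in_eR C & forall y, C y -> B y -> y = 0]] A.
- by [].
- move=> F F0 FP totF; split.
  + by apply: (@submod_set_chain R^c (right_regular R) F) => // C /FP[].
  + by move=> y [C /FP[_ Ce _] /Ce].
  + by move=> y [C /FP[_ _ CB] /CB].
by exists C; split=> // C' C'm C'e CC' C'B; apply: Cmax.
Qed.

(** Two independent nonzero right ideals of eR would be separated by an
    idempotent of eRe: enlarging them to complements of each other, the map
    that is the identity on one and zero on the other extends to eR, and by
    maximality its image is the first and its kernel the second. *)
Lemma primitive_uniform (A B : set R) : rideal A -> rideal B ->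
  in_eR A -> in_eR B -> (forall y, A y -> B y -> y = 0) ->
  (forall a, A a -> a = 0) \/ (forall b, B b -> b = 0).
Proof.
move=> Am Bm Ae Be AB.
have [|C [Cm Ce BC CA Cmax]] := maximal_complement Bm Am Be.
  by move=> y By Ay; apply: AB.
have [|C' [C'm C'e AC' C'C C'max]] := maximal_complement Am Cm Ae.
  by move=> y Ay Cy; apply: CA.
pose G1 : set (right_regular R * right_regular R)%type := [set xy | C' xy.1 /\ xy.2 = xy.1].
pose G2 : set (right_regular R * right_regular R)%type := [set xy | C xy.1 /\ xy.2 = 0].
have G1m : submod_set G1.
  split=> [|[a b] [c d] [/= Ca ->] [/= Cc ->]|r [a b] [/= Ca ->]].
  - by split=> //; exact: (rideal0 C'm).
  - by split=> //; exact: (ridealD C'm Ca Cc).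
  - by split=> //; exact: (submod_setZ C'm r Ca).
have G2m : submod_set G2.
  split=> [|[a b] [c d] [/= Ca ->] [/= Cc ->]|r [a b] [/= Ca ->]].
  - by split=> //; exact: (rideal0 Cm).
  - by split; [exact: (ridealD Cm Ca Cc) | exact: addr0].
  - by split; [exact: (submod_setZ Cm r Ca) | exact: scaler0].
have [||z0 z0P] := injective_ract (G := setadd G1 G2) selfinj.
- exact: (submod_set_add G1m G2m).
- move=> m [[a b] [[c d] [[/= Ca ->] [/= Cc ->] [/esym ac ->]]]].
  apply: etrans (addr0 _) _; apply: C'C => //.
  have -> : a = - c by apply/eqP; rewrite -addr_eq0; apply/eqP.
  exact: (ridealN Cm Cc).
pose z : R := e * z0.
have ez : e * z = z by rewrite /z mulrA ee.
have zC' y : C' y -> z * y = y.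
  move=> C'y; rewrite /z -mulrA; have <- : y = (z0 : R) * y; last exact: C'e.
  by apply: (z0P y y); apply: (setaddl G2m).
have zC y : C y -> z * y = 0.
  move=> Cy; rewrite /z -mulrA; have <- : 0 = (z0 : R) * y; last exact: mulr0.
  by apply: (z0P y 0); apply: (setaddr G1m).
clearbody z.
(* By maximality of C, since z is the identity on A. *)
have WC y : e * y = y -> C (z * y) -> C y.
  move=> ey Czy; apply: (Cmax [set y | e * y = y /\ C (z * y)]) => //.
  - apply: ex_rideal => [|a b [ea Ca] [eb Cb]|a b [ea Ca]].
    + by rewrite /= !mulr0; split=> //; apply: rideal0.
    + by rewrite /= !mulrDr ea eb; split=> //; apply: ridealD.
    + by rewrite /= !mulrA ea; split=> //; apply: ridealM.
  - by move=> a [].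
  - by move=> a Ca; split; [apply: Ce | rewrite zC //; apply: rideal0].
  - by move=> a [_ Cza] Aa; apply: CA => //; rewrite -(zC' a) //; apply: AC'.
(* By maximality of C', since the image of eR under z meets C in 0. *)
have zeC' y : e * y = y -> C' (z * y).
  move=> ey; apply: (C'max [set zy | exists y, e * y = y /\ zy = z * y]).
  - apply: ex_rideal => [|_ _ [a [ea ->]] [b [eb ->]]|_ b [a [ea ->]]].
    + by exists 0; rewrite !mulr0.
    + by exists (a + b); rewrite !mulrDr ea eb.
    + by exists (a * b); rewrite !mulrA ea.
  - by move=> _ [a [ea ->]]; rewrite mulrA ez.
  - by move=> a C'a; exists a; rewrite zC' // C'e.
  - by move=> _ [a [ea ->]] Cza; apply: zC; apply: WC.
  - by exists y.
have [_ _ /(_ (z * e)) prim] := eprim.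
have [||| g0 | g1] := prim.
- by rewrite -!mulrA [e * (z * e)]mulrA ez zC' //; apply: zeC'.
- by rewrite mulrA ez.
- by rewrite -mulrA ee.
- left=> a Aa; rewrite -(zC' a); last exact: AC'.
  by rewrite -(Ae a) // mulrA g0 mul0r.
- right=> b Bb; rewrite -(Be b) // -{1}g1 -mulrA Be // zC //; exact: BC.
Qed.

Lemma primitive_injective_unit t : e * t = t -> t * e = t ->
  (forall y, e * y = y -> t * y = 0 -> y = 0) ->
  exists z, [/\ e * z = z, z * e = z, z * t = e & t * z = e].
Proof.
move=> et te tinj.
have [|z0 z0t] := injective_ract_cyclic (x := t) (v := e : right_regular R) selfinj.
  move=> a ta; apply: (tinj (e * a)); first by rewrite mulrA ee.
  by rewrite mulrA te.
pose z : R := e * (z0 : R) * e.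
have zt : z * t = e by rewrite /z -mulrA et -mulrA -[RHS]ee {3}z0t.
have ez : e * z = z by rewrite /z !mulrA ee.
have ze : z * e = z by rewrite /z -mulrA ee.
clearbody z; exists z; split=> //.
have [_ e0 prim] := eprim.
have [|||tz0|//] := prim (t * z).
- by rewrite -mulrA (mulrA z) zt ez.
- by rewrite mulrA et.
- by rewrite -mulrA ze.
by case: e0; rewrite -ee -{1}zt -{1}zt -mulrA (mulrA t) tz0 mul0r mulr0.
Qed.

(** The right ideals of eR annihilated by x and by e - x are independent, so
    one of them is 0 by [primitive_uniform]. *)
Lemma primitive_local x : e * x = x -> x * e = x ->
  (exists z, [/\ e * z = z, z * e = z & x * z = e]) \/
  (exists z, [/\ e * z = z, z * e = z & (e - x) * z = e]).
Proof.
move=> ex xe.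
have idl t : rideal [set y | e * y = y /\ t * y = 0].
  apply: ex_rideal => [|a b [ea ta] [eb tb]|a b [ea ta]] /=.
  - by rewrite !mulr0.
  - by rewrite !mulrDr ea eb ta tb addr0.
  - by rewrite !mulrA ea ta mul0r.
have := primitive_uniform (idl x) (idl (e - x)).
case=> [y []|y []|y [ey xy] [_]|h|h] //.
- by rewrite mulrBl xy subr0 ey.
- have [|z [ez ze _ xz]] := primitive_injective_unit ex xe.
    by move=> y ey xy; apply: h.
  by left; exists z.
- have [|||z [ez ze _ xz]] := @primitive_injective_unit (e - x).
  + by rewrite mulrBr ee ex.
  + by rewrite mulrBl ee xe.
  + by move=> y ey xy; apply: h.
  by right; exists z.
Qed.

End Primitive.

(** * Corner rings *)

Section Corner.
Context (R : pzRingType) (e : R) (ee : e * e = e).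

(** The proof of e * e = e is a parameter of the type because the unit laws of
    the ring eRe depend on it. *)
Definition corner of e * e = e := {x : R | e * x * e == x}.
Local Notation L := (corner ee).

HB.instance Definition _ := Choice.on L.

Lemma cornerP (x : L) : e * val x * e = val x. Proof. exact/eqP/(valP x). Qed.

Lemma corner_mull (x : L) : e * val x = val x.
Proof. by rewrite -(cornerP x) !mulrA ee. Qed.

Lemma corner_mulr (x : L) : val x * e = val x.
Proof. by rewrite -(cornerP x) -!mulrA ee. Qed.

Fact to_corner_subproof (x : R) : e * (e * x * e) * e == e * x * e.
Proof. by rewrite !mulrA ee -mulrA ee. Qed.

Definition to_corner (x : R) : L := exist _ (e * x * e) (to_corner_subproof x).

Lemma val_to_corner x : val (to_corner x) = e * x * e. Proof. by []. Qed.

Lemma to_cornerK (x : L) : to_corner (val x) = x.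
Proof. by apply: val_inj; rewrite val_to_corner cornerP. Qed.

Definition corner_add (x y : L) := to_corner (val x + val y).
Definition corner_opp (x : L) := to_corner (- val x).
Definition corner_mul (x y : L) := to_corner (val x * val y).

Lemma val_corner_add x y : val (corner_add x y) = val x + val y.
Proof. by rewrite val_to_corner mulrDr mulrDl !cornerP. Qed.

Lemma val_corner_opp x : val (corner_opp x) = - val x.
Proof. by rewrite val_to_corner mulrN mulNr cornerP. Qed.

Lemma val_corner_mul x y : val (corner_mul x y) = val x * val y.
Proof. by rewrite val_to_corner mulrA corner_mull -mulrA corner_mulr. Qed.

Fact corner_addA : associative corner_add.
Proof. by move=> x y z; apply: val_inj; rewrite !val_corner_add addrA. Qed.
Fact corner_addC : commutative corner_add.
Proof. by move=> x y; apply: val_inj; rewrite !val_corner_add addrC. Qed.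
Fact corner_add0 : left_id (to_corner 0) corner_add.
Proof.
by move=> x; apply: val_inj; rewrite val_corner_add val_to_corner mulr0 mul0r add0r.
Qed.
Fact corner_addN : left_inverse (to_corner 0) corner_opp corner_add.
Proof.
move=> x; apply: val_inj.
by rewrite val_corner_add val_corner_opp addNr val_to_corner mulr0 mul0r.
Qed.
HB.instance Definition _ :=
  GRing.isZmodule.Build L corner_addA corner_addC corner_add0 corner_addN.

Fact corner_mulA : associative corner_mul.
Proof. by move=> x y z; apply: val_inj; rewrite !val_corner_mul mulrA. Qed.
Fact corner_mul1l : left_id (to_corner 1) corner_mul.
Proof.
by move=> x; apply: val_inj; rewrite val_corner_mul val_to_corner mulr1 ee corner_mull.
Qed.
Fact corner_mul1r : right_id (to_corner 1) corner_mul.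
Proof.
by move=> x; apply: val_inj; rewrite val_corner_mul val_to_corner mulr1 ee corner_mulr.
Qed.
Fact corner_mulDl : left_distributive corner_mul corner_add.
Proof.
move=> x y z; apply: val_inj.
by rewrite val_corner_add !val_corner_mul val_corner_add mulrDl.
Qed.
Fact corner_mulDr : right_distributive corner_mul corner_add.
Proof.
move=> x y z; apply: val_inj.
by rewrite val_corner_add !val_corner_mul val_corner_add mulrDr.
Qed.
HB.instance Definition _ := GRing.Zmodule_isPzRing.Build L
  corner_mulA corner_mul1l corner_mul1r corner_mulDl corner_mulDr.

Lemma val_cornerD (x y : L) : val (x + y) = val x + val y.
Proof. exact: val_corner_add. Qed.

Lemma val_cornerM (x y : L) : val (x * y) = val x * val y.
Proof. exact: val_corner_mul. Qed.

Lemma val_corner0 : val (0 : L) = 0.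
Proof. by apply: etrans (val_to_corner 0) _; rewrite mulr0 mul0r. Qed.

Lemma val_corner1 : val (1 : L) = e.
Proof. by apply: etrans (val_to_corner 1) _; rewrite mulr1 ee. Qed.

Lemma val_corner_sum (I : Type) (r : seq I) (F : I -> L) :
  val (\sum_(i <- r) F i) = \sum_(i <- r) val (F i).
Proof. exact: (big_morph val val_cornerD val_corner0). Qed.

Lemma to_cornerD x y : to_corner (x + y) = to_corner x + to_corner y.
Proof. by apply: val_inj; rewrite val_cornerD !val_to_corner mulrDr mulrDl. Qed.

End Corner.

(** * Semisimple rings *)

Lemma Soc_submod (A : pzRingType) (M : lmodType A) : submod_set (Soc M).
Proof.
split=> [|_ _ [s -> sP] [s' -> s'P]|a _ [s -> sP]].
- by exists [::]; rewrite ?big_nil.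
- exists (s ++ s'); first by rewrite big_cat.
  by move=> y; rewrite mem_cat => /orP[]; [apply: sP | apply: s'P].
- exists [seq a *: y | y <- s]; first by rewrite big_map scaler_sumr.
  by move=> _ /mapP[y /sP[N Nsimp Ny] ->]; exists N => //; apply: rpredZ.
Qed.

(** With M = zR maximal among the right ideals containing the socle but not 1,
    the complement (1 - z)R is simple, hence contained in the socle and in M. *)
Lemma left_identity_semisimple (A : pzRingType) :
  (forall I : set A, rideal I -> exists z, I z /\ forall x, I x -> z * x = x) ->
  semisimple_artinian A.
Proof.
move=> lid; rewrite /semisimple_artinian /semisimple_module.
have Sm := Soc_submod (right_regular A).
suff S1 : Soc (right_regular A) 1.
  apply/seteqP; split=> // x _; have -> : x = (1 : right_regular A) ** (x : A) by exact: esym (mul1r (x : A)).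
  exact: (submod_setZ Sm (x : A^c) S1).
apply: contrapT => nS1.
have [||M [SM [Mm nM1] Mmax]] := @Zorn_above _
    [set M : set A | rideal M /\ ~ M 1] (Soc (right_regular A)).
- by [].
- move=> F F0 FP totF; split; last by move=> [M /FP[]].
  by apply: (@submod_set_chain A^c (right_regular A) F) => // M /FP[].
have [z [Mz zM]] := lid M Mm.
pose w := 1 - z.
have zz : z * z = z by apply: zM.
have zw : z * w = 0 by rewrite /w mulrBr mulr1 zz subrr.
have wM m : M m -> w * m = 0 by move=> Mm'; rewrite /w mulrBl mul1r zM // subrr.
have ww : w * w = w by rewrite {1}/w mulrBl mul1r zw subr0.
have w1 : 1 = z + w by rewrite /w addrC subrK.
clearbody w.
have [N NE] := ex_submod (rcyclic_submod (w : right_regular A)).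
have Nw : (w : right_regular A) \in N by rewrite NE; apply: rcyclic_id.
apply: (nM1); rewrite w1; apply: (ridealD Mm Mz); apply: SM.
exists [:: w : right_regular A]; first by rewrite big_seq1.
move=> y; rewrite inE => /eqP ->; exists N => //.
apply: gen_simple.
  exists (Submod Nw) => /(congr1 val) /= w0; apply: nM1.
  by rewrite w1 [w]w0 addr0.
move=> [a Na] [b Nb] a0.
have [t at_] : rcyclic (w : right_regular A) a by rewrite -NE.
have [t' bt] : rcyclic (w : right_regular A) b by rewrite -NE.
have {}at_ : a = w * t := at_.
have {}bt : b = w * t' := bt.
have wa : w * (a : A) = a by rewrite at_ mulrA ww.
have nMa : ~ M a.
  move=> Ma; apply: a0; apply: val_inj => /=.
  by rewrite -[LHS](zM a Ma) at_ mulrA zw mul0r.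
have : setadd (M : set (right_regular A)) (rcyclic (a : right_regular A)) 1.
  apply: contrapT => n1; apply: nMa.
  apply: (Mmax (setadd (M : set (right_regular A)) (rcyclic (a : right_regular A)))).
  - by split=> //; apply: (submod_set_add Mm (rcyclic_submod _)).
  - exact: (@setaddl A^c (right_regular A) M _ (rcyclic_submod _)).
  - by apply: (@setaddr A^c (right_regular A) M _ Mm); apply: rcyclic_id.
move=> [m [_ [Mm' [r ->] e1]]].
have war : w = (a : A) * r.
  have {}e1 : 1 = (m : A) + (a : A) * r := e1.
  by rewrite -[LHS]mulr1 e1 mulrDr wM // add0r mulrA wa.
exists (r * t' : A); apply: val_inj => /=.
by rewrite bt war -mulrA.
Qed.

(** Let C be maximal among the right ideals with zero intersection with I.  A
    simple right ideal outside I + C could be added to C; so I + C is R, and z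
    is the component of 1 in I. *)
Lemma semisimple_left_identity (A : pzRingType) : semisimple_artinian A ->
  forall I : set A, rideal I -> exists z, I z /\ forall x, I x -> z * x = x.
Proof.
move=> Ass I Im.
have [||C [_ [Cm CI] Cmax]] := @Zorn_above _
    [set C : set A | rideal C /\ forall x, C x -> I x -> x = 0] [set 0].
- by split; [exact: rideal_zero | move=> x ->].
- move=> F F0 FP totF; split.
    by apply: (@submod_set_chain A^c (right_regular A) F) => // C /FP[].
  by move=> x [C /FP[_ CI] /CI].
pose IC : set (right_regular A) := setadd (I : set (right_regular A)) C.
have ICm : submod_set IC := submod_set_add Im Cm.
have simpleIC (N : submodClosed (right_regular A)) y :
    simple_module (submod N) -> y \in N -> IC y.
  move=> Nsimp Ny; apply: contrapT => nICy.
  have [i iE] := ex_val_linear N.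
  have NIC x : x \in N -> IC x -> x = 0.
    move=> Nx ICx; case: (simple_set Nsimp (submod_set_preim i ICm)) => [h|h].
      by have := h (Submod Nx); rewrite /= iE => /(_ ICx) /(congr1 val).
    by case: nICy; have := h (Submod Ny); rewrite /= iE.
  have Nm := submodClosed_set N.
  apply: (nICy); apply: (setaddr Im).
  apply: (Cmax (setadd (C : set (right_regular A)) [set x | x \in N])).
  - split; first exact: (submod_set_add Cm Nm).
    move=> _ [c [m [Cc Nm' ->]]] Icm.
    have m0 : m = 0.
      apply: NIC => //.
      have -> : m = (c + m) + (- c) by rewrite addrAC subrr add0r.
      by exists (c + m), (- c); split=> //; exact: (ridealN Cm Cc).
    by rewrite m0 addr0 in Icm *; apply: CI.
  - exact: (setaddl Nm).
  - exact: (setaddr Cm).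
have [s s1 sP] : Soc (right_regular A) 1 by rewrite Ass.
have IC1 : IC 1.
  rewrite s1 big_seq; apply: (submod_set_sum ICm) => y /sP[N Nsimp Ny].
  exact: simpleIC Nsimp Ny.
have [z [c [Iz Cc zc]]] := IC1.
have {}zc : 1 = (z : A) + (c : A) := zc.
exists z; split=> // x Ix.
have cx0 : (c : A) * x = 0.
  apply: CI; first exact: (ridealM x Cm Cc).
  have -> : (c : A) * x = x - (z : A) * x by rewrite -{2}[x]mul1r zc mulrDl addrAC subrr add0r.
  by apply: (ridealB Im Ix); exact: (ridealM x Im Iz).
by rewrite -[RHS]mul1r zc mulrDl cx0 addr0.
Qed.

(** * Local rings and matrix rings *)

Lemma ring_local (L : pzRingType) (J : set L) : rideal J -> ~ J 1 ->
  (forall x, ~ J x -> exists y, x * y = 1) -> local_ring L.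
Proof.
move=> Jm J1 Junit.
have [I IE] := ex_submod (Jm : submod_set (J : set (right_regular L))).
have proper (K : submodClosed (right_regular L)) x : x \in K -> ~ J x -> K =i predT.
  move=> Kx Jx y; have [z xz] := Junit x Jx.
  have -> : y = (x : right_regular L) ** (z * (y : L)).
    by rewrite -[RHS]/((x : L) * (z * (y : L))) mulrA xz mul1r.
  by rewrite [RHS]/in_mem /= rpredZ.
exists I.
  split=> [IT|K IK].
    by apply: J1; have := IT 1; rewrite [RHS]/in_mem /= => I1; rewrite -IE I1.
  have [[x [Kx Jx]]|KJ] := pselect (exists x, x \in K /\ ~ J x).
    by right; apply: proper Kx Jx.
  left=> x; apply/idP/idP => [Kx|]; last exact: IK.
  by rewrite IE; apply: contrapT => Jx; apply: KJ; exists x.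
move=> K [KT Kmax].
have KI : {subset K <= I}.
  move=> x Kx; rewrite IE; apply: contrapT => Jx; apply: KT.
  exact: proper Kx Jx.
case: (Kmax I KI) => [IK x|IT]; first by rewrite IK.
by case: J1; rewrite -IE IT.
Qed.

(** Conversely the unique maximal right ideal of a local ring consists of the
    elements without right inverse, by Zorn's lemma. *)
Lemma local_ring_ideal (L : pzRingType) : local_ring L -> exists J : set L,
  [/\ rideal J, ~ J 1, forall x, ~ J x -> exists y, x * y = 1 &
    forall K : set L, rideal K -> ~ K 1 -> K `<=` J].
Proof.
move=> [I [IT Imax] Iuniq].
have KI (K : set L) : rideal K -> ~ K 1 -> forall x : right_regular L, K x -> x \in I.
  move=> Km K1 x Kx.
  have [||M [KM [Mm M1] Mmax]] := @Zorn_above _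
      [set M : set L | rideal M /\ ~ M 1] K.
  - by [].
  - move=> F F0 FP totF; split; last by move=> [M /FP[]].
    by apply: (@submod_set_chain L^c (right_regular L) F) => // M /FP[].
  have [N NE] := ex_submod (Mm : submod_set (M : set (right_regular L))).
  have Nmax : maximal_submodule N.
    split=> [NT|P NP]; first by apply: M1; rewrite -NE NT.
    have [P1|nP1] := pselect ((1 : right_regular L) \in P).
      right=> y; rewrite [RHS]/in_mem /=.
      have -> : y = (1 : right_regular L) ** (y : L) by exact: esym (mul1r (y : L)).
      exact: rpredZ.
    left=> y; apply/idP/idP => [Py|]; last exact: NP.
    rewrite NE; apply: (Mmax [set y | (y : right_regular L) \in P]) => //.
      by split; first exact: (submodClosed_set P).
    by move=> z Mz; apply: NP; rewrite NE.
  by rewrite -(Iuniq N Nmax) NE; apply: KM.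
have I1 : ~ ((1 : right_regular L) \in I).
  move=> I1; apply: IT => y; rewrite [RHS]/in_mem /=.
  have -> : y = (1 : right_regular L) ** (y : L) by exact: esym (mul1r (y : L)).
  exact: rpredZ.
exists [set x | (x : right_regular L) \in I]; split=> //.
- exact: submodClosed_set.
- move=> x Ix; apply: contrapT => nx; apply: Ix.
  apply: (KI (rcyclic (x : right_regular L))); [exact: rcyclic_submod | | exact: rcyclic_id].
  by move=> [y /esym xy]; apply: nx; exists y.
Qed.

Lemma local_idempotent (L : pzRingType) (J : set L) (a : L) : rideal J -> ~ J 1 ->
  (forall x, ~ J x -> exists y, x * y = 1) -> a * a = a -> a = 0 \/ a = 1.
Proof.
move=> Jm J1 Junit aa.
have unit1 b : b * b = b -> ~ J b -> b = 1.
  move=> bb /(local_unit Jm J1 Junit)[y [_ yb]].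
  by rewrite -[LHS]mul1r -yb -mulrA bb.
have [Ja|nJa] := pselect (J a); last by right; apply: unit1.
left; have : 1 - a = 1.
  apply: unit1; first by rewrite mulrBl mul1r mulrBr mulr1 aa subrr subr0.
  by move=> J1a; apply: J1; rewrite -(subrK a 1); apply: ridealD.
by move/eqP; rewrite -subr_eq0 addrAC subrr add0r oppr_eq0 => /eqP.
Qed.

(** Row 0 of (delta_mx 0 i) z is row i of z, and z (delta_mx 0 i) has the
    entries of column 0 of z in its column i. *)
Lemma matrix_row_zero (L : pzRingType) n (z : 'M[L]_n.+1) :
  (forall m : 'M[L]_n.+1, z * m = m * z) -> z 0 0 = 0 -> z = 0.
Proof.
move=> zC z00; apply/matrixP => i j; rewrite mxE.
have dz k l : (delta_mx k l * z) = \matrix_(a, b) (if a == k then z l b else 0).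
  apply/matrixP => a b; rewrite !mxE (bigD1 l) //= mxE eqxx andbT.
  rewrite big1 => [|h hl]; last by rewrite mxE (negPf hl) andbF mul0r.
  by rewrite addr0; case: eqP => _; rewrite ?mul1r ?mul0r.
have zd k l : (z * delta_mx k l) = \matrix_(a, b) (if b == l then z a k else 0).
  apply/matrixP => a b; rewrite !mxE (bigD1 k) //= mxE eqxx /=.
  rewrite big1 => [|h hl]; last by rewrite mxE (negPf hl) mulr0.
  by rewrite addr0; case: eqP => _; rewrite ?mulr1 ?mulr0.
have := zC (delta_mx 0 i); rewrite zd dz => /matrixP /(_ 0 j).
by rewrite !mxE eqxx z00; case: eqP.
Qed.

(** A decomposition yields a central idempotent matrix; its corner entry is an
    idempotent of L, so it is 0 or 1. *)
Lemma matrix_local_indecomposable (L : pzRingType) n : local_ring L -> (0 < n)%N ->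
  indecomposable_ring 'M[L]_n.
Proof.
case: n => // n /local_ring_ideal[J [Jm J1 Junit _]] _.
have L10 : (1 : L) <> 0 by move=> e; apply: J1; rewrite e; apply: rideal0.
split=> [z|A B [f [g fK gK]]].
  by apply: L10; have := congr1 (fun m : 'M[L]_n.+1 => m 0 0) z; rewrite !mxE eqxx.
pose p : 'M[L]_n.+1 := g (1, 0).
have pC m : p * m = m * p.
  apply: (can_inj fK); rewrite !rmorphM gK; case: (f m) => a b.
  by rewrite -[LHS]/(1 * a, 0 * b) -[RHS]/(a * 1, b * 0) mul1r mulr1 mul0r mulr0.
have pp : p * p = p.
  apply: (can_inj fK); rewrite !rmorphM gK.
  by rewrite -[LHS]/(1 * 1, 0 * 0) mul1r mul0r.
have p0j j : j != 0 -> p 0 j = 0.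
  move=> j0; have := congr1 (fun m : 'M[L]_n.+1 => m 0 j) (pC (delta_mx 0 0)).
  rewrite !mxE (bigD1 0) //= big1 => [|h h0]; last by rewrite mxE (negPf h0) mulr0.
  rewrite mxE (negPf j0) andbF mulr0 add0r (bigD1 0) //= big1 => [|h h0].
    by rewrite mxE !eqxx mul1r addr0 => <-.
  by rewrite mxE (negPf h0) andbF mul0r.
have aa : p 0 0 * p 0 0 = p 0 0.
  have := congr1 (fun m : 'M[L]_n.+1 => m 0 0) pp.
  by rewrite !mxE (bigD1 0) //= big1 ?addr0 // => h h0; rewrite p0j ?mul0r.
have fp : f p = (1, 0) by rewrite /p gK.
case: (local_idempotent Jm J1 Junit aa) => p00; [left|right].
  have p0 : p = 0 by apply: matrix_row_zero.
  by have := fp; rewrite p0 rmorph0 => -[].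
have q0 : 1 - p = 0.
  apply: matrix_row_zero; first by move=> m; rewrite mulrBl mulrBr mul1r mulr1 pC.
  by rewrite !mxE p00 eqxx subrr.
have : f (1 - p) = 0 by rewrite q0 rmorph0.
by rewrite rmorphB rmorph1 fp => -[_]; rewrite subr0.
Qed.

Lemma ex_rmorphism (R1 R2 : pzRingType) (f : R1 -> R2) :
  (forall x y, f (x + y) = f x + f y) -> f 1 = 1 ->
  (forall x y, f (x * y) = f x * f y) -> exists g : {rmorphism R1 -> R2}, g =1 f.
Proof.
move=> fD f1 fM.
have fB : {morph f : x y / x - y}.
  move=> x y; apply/eqP; rewrite eq_sym subr_eq -fD subrK; exact/eqP.
pose g : {rmorphism R1 -> R2} := HB.pack f (GRing.isZmodMorphism.Build R1 R2 f fB)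
  (GRing.isMonoidMorphism.Build R1 R2 f (conj f1 fM)).
by exists g.
Qed.


(** * Matrix units and the block decomposition *)

Lemma simple_ract (R : pzRingType) (S : rmodType R) (s t : S) :
  simple_module S -> s <> 0 -> exists r : R, t = s ** r.
Proof. by move=> Ssimp s0; have [r ->] := simple_gen t Ssimp s0; exists r. Qed.

(** The idempotent c = u_0 v_0 + ... + u_(n-1) v_(n-1) cuts out n copies of eR. *)
Definition matrix_units (R : pzRingType) (e : R) n (u v : nat -> R) :=
  [/\ forall j, u j * e = u j, forall j, e * v j = v j &
      forall i j, (i < n)%N -> (j < n)%N -> v i * u j = if i == j then e else 0].

Section MatrixUnits.
Context (R : pzRingType) (e : R) (n : nat) (u v : nat -> R).
Hypothesis uv : matrix_units e n u v.
Let c := \sum_(j < n) u j * v j.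

Lemma matrix_units_vc i : (i < n)%N -> v i * c = v i.
Proof.
case: uv => ue ev vu ni; rewrite mulr_sumr (bigD1 (Ordinal ni)) //=.
rewrite mulrA vu // eqxx ev big1 ?addr0 // => j ji; rewrite mulrA vu //.
by rewrite -val_eqE /= eq_sym in ji; rewrite (negPf ji) mul0r.
Qed.

Lemma matrix_units_cu i : (i < n)%N -> c * u i = u i.
Proof.
case: uv => ue ev vu ni; rewrite mulr_suml (bigD1 (Ordinal ni)) //=.
rewrite -mulrA vu // eqxx ue big1 ?addr0 // => j ji; rewrite -mulrA vu //.
by rewrite -val_eqE /= in ji; rewrite (negPf ji) mulr0.
Qed.

Lemma matrix_units_idem : c * c = c.
Proof.
rewrite {2}/c mulr_sumr; apply: eq_bigr => i _.
by rewrite mulrA matrix_units_cu.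
Qed.

End MatrixUnits.

Section Decomposition.
Context (R : pzRingType) (S : rmodType R).
Hypothesis Ssimp : simple_module S.
Hypothesis Snon : ~ injective_module S.
Hypothesis Sind : indigent S.
Hypothesis selfinj : injective_module (right_regular R).
Hypothesis acc : rann_acc R.

Variables (e : R) (s0 : S).
Hypothesis eprim : primitive e.
Hypothesis s0e : s0 ** e = s0.
Hypothesis s00 : s0 <> 0.

Let ee : e * e = e := primitive_idem eprim.

Lemma top_unit x : e * x = x -> x * e = x -> s0 ** x = 0 ->
  exists w, [/\ e * w = w, w * e = w & (e - x) * w = e].
Proof.
move=> ex xe s0x; have [[z [ez ze xz]]|//] := primitive_local selfinj eprim ex xe.
by case: s00; rewrite -s0e -xz -ractA s0x ract0r.
Qed.

(** Copies of eR are split off R as long as the complementary idempotent does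
    not annihilate S; chain condition on right annihilators puts an end to it. *)
Lemma ex_matrix_units : exists n u v, matrix_units e n u v /\
  forall s : S, s ** (1 - \sum_(j < n) u j * v j) = 0.
Proof.
have [|D [[n [u [v [uvP ->]]]] Dmax]] := @acc [set D : set R | exists n u v,
    matrix_units e n u v /\ D = [set (1 - \sum_(j < n) u j * v j)]].
  exists [set (1 - \sum_(j < 0) (0 : R) * 0)], 0%N, (fun=> 0), (fun=> 0).
  by split=> //; split=> // j; rewrite ?mul0r ?mulr0.
exists n, u, v; split=> // s; apply: contrapT.
have cc := matrix_units_idem uvP; have vc := matrix_units_vc uvP.
have cu := matrix_units_cu uvP; have [ue ev vu] := uvP.
set c := \sum_(j < n) u j * v j in cc vc cu Dmax *; set q := 1 - c => sq.
have qq : q * q = q by rewrite /q mulrBr mulr1 mulrBl mul1r cc subrr subr0.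
have cq : c * q = 0 by rewrite /q mulrBr mulr1 cc subrr.
have qc : q * c = 0 by rewrite /q mulrBl mul1r cc subrr.
have [r sr] := simple_ract s0 Ssimp sq.
have [t s0t] := simple_ract (s ** q) Ssimp s00.
(* Maps between eR and qR, both lying over S; their composite on eR is
   invertible, as it is the identity on the top S of eR. *)
pose u1 := q * r * e; pose v0 := e * t * q.
have s0x : s0 ** (e - v0 * u1) = 0.
  have sqq : s ** q ** q = s ** q by rewrite ractA qq.
  by rewrite ractBr s0e /v0 /u1 -!ractA s0e -s0t !sqq -sr s0e subrr.
have ev0 : e * v0 = v0 by rewrite /v0 !mulrA ee.
have u1e : u1 * e = u1 by rewrite /u1 -mulrA ee.
have [||w [ew we]] := top_unit _ _ s0x.
- by rewrite mulrBr ee mulrA ev0.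
- by rewrite mulrBl ee -mulrA u1e.
rewrite opprB addrC subrK => vuw.
pose u0 := u1 * w.
have u0e : u0 * e = u0 by rewrite /u0 -mulrA we.
have qu0 : q * u0 = u0 by rewrite /u0 /u1 !mulrA qq.
have v0q : v0 * q = v0 by rewrite /v0 -mulrA qq.
have v0u0 : v0 * u0 = e by rewrite /u0 mulrA.
have cu0 : c * u0 = 0 by rewrite -qu0 mulrA cq mul0r.
have v0c : v0 * c = 0 by rewrite -v0q -mulrA qc mulr0.
clearbody u0 v0.
pose u' j := if (j < n)%N then u j else if j == n then u0 else 0.
pose v' j := if (j < n)%N then v j else if j == n then v0 else 0.
have c'E : \sum_(j < n.+1) u' j * v' j = c + u0 * v0.
  rewrite big_ord_recr /= /u' /v' ltnn eqxx; congr (_ + _).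
  by apply: eq_bigr => j _; rewrite ltn_ord.
have uv' : matrix_units e n.+1 u' v'.
  split=> [j|j|i j]; rewrite /u' /v'.
  - by case: ifP => // _; case: ifP => // _; rewrite mul0r.
  - by case: ifP => // _; case: ifP => // _; rewrite mulr0.
  have nE k : (k < n.+1)%N -> (k < n)%N = false -> k = n.
    by rewrite ltnS => kn nk; apply/eqP; rewrite eqn_leq kn leqNgt nk.
  case ni: (i < n)%N; case nj: (j < n)%N => iN jN.
  - by rewrite vu.
  - by rewrite (nE j) // eqxx ltn_eqF // -(vc i ni) -mulrA cu0 mulr0.
  - by rewrite (nE i) // eqxx gtn_eqF // -(cu j nj) mulrA v0c mul0r.
  - by rewrite (nE i) // (nE j) // !eqxx.
have sub : rann [set 1 - c] `<=` rann [set 1 - \sum_(j < n.+1) u' j * v' j].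
  move=> y yc _ ->; rewrite c'E; have := yc q erefl.
  rewrite /q mulrBl mul1r => /eqP; rewrite subr_eq0 => /eqP ycy.
  by rewrite mulrBl mul1r mulrDl -ycy -mulrA {3}ycy [v0 * _]mulrA v0c mul0r mulr0 addr0 subrr.
have h := Dmax [set (1 - \sum_(j < n.+1) u' j * v' j)]
  (ex_intro _ n.+1 (ex_intro _ u' (ex_intro _ v' (conj uv' erefl)))) sub u0.
have : (1 - c) * u0 = 0.
  apply: h => // _ ->; rewrite c'E mulrBl mul1r mulrDl cu0 add0r.
  by rewrite -mulrA v0u0 u0e subrr.
rewrite -/q qu0 => u00; case: s00.
by rewrite -s0e -v0u0 u00 mulr0 ractr0.
Qed.

Variables (n : nat) (u v : nat -> R).
Hypothesis uv : matrix_units e n u v.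
Let c := \sum_(j < n) u j * v j.
Let q := 1 - c.
Hypothesis Sq : forall s : S, s ** q = 0.

Let ue j : u j * e = u j. Proof. by case: uv. Qed.
Let ev j : e * v j = v j. Proof. by case: uv. Qed.
Let cc : c * c = c. Proof. exact: (matrix_units_idem uv). Qed.
Let vc i : (i < n)%N -> v i * c = v i. Proof. exact: (matrix_units_vc uv). Qed.
Let cu i : (i < n)%N -> c * u i = u i. Proof. exact: (matrix_units_cu uv). Qed.

Lemma corner_q_idem : q * q = q.
Proof. by rewrite /q mulrBr mulr1 mulrBl mul1r cc subrr subr0. Qed.

Lemma cq_split x : x = x * c + x * q.
Proof. by rewrite -mulrDr /q addrC subrK mulr1. Qed.

Lemma ract_c (s : S) : s ** c = s.
Proof. by rewrite -[RHS]ract1 (cq_split 1) !mul1r ractDr Sq addr0. Qed.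

(** A module generated by N q admits no nonzero map to S. *)
Lemma q_module_injective (N : rmodType R) :
  (forall x : N, exists y r, x = y ** q ** r) -> injective_module N.
Proof.
move=> Nq; apply: (indigent_hom0 Sind) => f x.
by have [y [r ->]] := Nq x; rewrite !ract_linear Sq ract0r.
Qed.

Lemma q_ideal_left_identity (I : set R) : rideal I ->
  (forall x, I x -> exists y r, I y /\ x = y * q * r) ->
  exists z, I z /\ forall x, I x -> z * x = x.
Proof.
move=> Im Iq; have [N NE] := ex_submod (Im : submod_set (I : set (right_regular R))).
have Ninj : injective_module (submod N).
  apply: q_module_injective => -[x Nx].
  have [y [r [Iy xE]]] : exists y r, I y /\ x = y * q * r by apply: Iq; rewrite -NE.
  rewrite -NE in Iy; exists (Submod Iy), r.
  by apply: val_inj; apply: etrans xE _.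
have [p [pN pid]] := injective_retract Ninj.
exists (p 1); rewrite -NE; split=> // x Ix.
have px : p x = x by apply: pid; rewrite NE.
rewrite -[RHS]px -[LHS]/((p 1 : right_regular R) ** x) -ract_linear.
by congr (p _); exact: (mul1r x).
Qed.

(** A nonzero x in eRq would generate an injective right ideal, hence a direct
    summand of eR, hence eR, and S e = 0 because S q = 0. *)
Lemma eRq0 r : e * r * q = 0.
Proof.
pose x := e * r * q.
have ex : e * x = x by rewrite /x !mulrA ee.
have xq : x * q = x by rewrite /x -mulrA corner_q_idem.
have xid : @rideal R (rcyclic (x : right_regular R)) := rcyclic_submod _.
have [|z [[t zE] zx]] := q_ideal_left_identity xid.
  move=> _ [t ->]; exists x, t; rewrite xq; split=> //.
  exact: (rcyclic_id (x : right_regular R)).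
have {}zE : z = x * t := zE.
have xx : z * x = x by apply: zx; apply: (rcyclic_id (x : right_regular R)).
have zz : z * z = z by apply: zx; exists t.
have ez : e * z = z by rewrite zE mulrA ex.
rewrite -/x -xx -ex mulrA; clearbody x.
have [_ _ prim] := eprim.
have [|||ze|ze] := prim (z * e).
- by rewrite -mulrA (mulrA e) ez mulrA zz.
- by rewrite mulrA ez.
- by rewrite -mulrA ee.
- by rewrite ze mul0r.
case: s00; rewrite -s0e -ze -ractA zE -xq -!ractA.
by rewrite Sq !ract0r.
Qed.

Let ec : e * c = e.
Proof. by rewrite -[RHS]subr0 -(eRq0 1) mulr1 /q mulrBr mulr1 opprB addrC subrK. Qed.

Let eRc r : e * r * c = e * r.
Proof. by rewrite [RHS]cq_split eRq0 addr0. Qed.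

Lemma cRq0 r : c * r * q = 0.
Proof.
rewrite /c !mulr_suml big1 // => j _.
have -> : u j * v j * r * q = u j * (e * (v j * r) * q) by rewrite !mulrA ue.
by rewrite eRq0 mulr0.
Qed.

(** * The corner ring eRe *)

Local Notation L := (corner ee).

(** A map h on a right ideal I of eRe extends to the right ideal of all x in eR
    with x u_j in I for all j, by x |-> sum_j h (x u_j) v_j. *)
Lemma corner_selfinjective : injective_module (right_regular L).
Proof.
apply: baer_injective => I h Im [hD hZ].
pose tc x : L := to_corner ee x.
pose I' : set R := [set x | e * x = x /\ forall j, (j < n)%N -> I (tc (x * u j))].
have tcD x y : tc (x + y) = tc x + tc y.
  by apply: val_inj; rewrite val_cornerD !val_to_corner mulrDr mulrDl.
have valxu x j : e * x = x -> val (tc (x * u j)) = x * u j.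
  by move=> ex; rewrite val_to_corner mulrA ex -mulrA ue.
have valvu i r j : val (tc (v i * r * u j)) = v i * r * u j.
  by rewrite val_to_corner !mulrA ev -mulrA ue.
have tcM x r j : e * x = x -> tc (x * r * u j) =
    \sum_(i < n) tc (x * u i) * tc (v i * r * u j).
  move=> ex; apply: val_inj; rewrite val_corner_sum.
  transitivity (\sum_(i < n) x * (u i * v i) * (r * u j)).
    rewrite valxu; last by rewrite mulrA ex.
    have xc : x * c = x by rewrite -{1}ex eRc ex.
    by rewrite -mulr_suml -mulr_sumr -/c xc mulrA.
  by apply: eq_bigr => i _; rewrite val_cornerM valxu // valvu !mulrA.
have hsum m (F : 'I_m -> L) : (forall i, I (F i)) -> h (\sum_(i < m) F i) = \sum_(i < m) h (F i).
  move=> IF; have : I (\sum_(i < m) F i) /\ h (\sum_(i < m) F i) = \sum_(i < m) h (F i).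
    apply: (big_ind2 (fun x y => I x /\ h x = y)) => [|x x' y y' [Ix <-] [Iy <-]|i _].
    - by split; [exact: (submod_set0 Im) | exact: (linear_on0 Im (conj hD hZ))].
    - by split; [exact: (submod_setD Im Ix Iy) | exact: hD].
    - by split.
  by case.
have hM (x y : L) : I x -> h (x * y) = (h x : L) * y by move=> Ix; apply: (hZ y x Ix).
have IM (x y : L) : I x -> I (x * y) by move=> Ix; apply: (submod_setZ Im (y : L^c) Ix).
pose h' (x : R) : R := \sum_(j < n) val (h (tc (x * u j)) : L) * v j.
have I'm : rideal I'.
  apply: ex_rideal => [|x y [ex Ix] [ey Iy]|x r [ex Ix]].
  - split=> [|j jn]; rewrite ?mulr0 // mul0r.
    have -> : tc 0 = 0 by apply: val_inj; rewrite [RHS]val_corner0 val_to_corner mulr0 mul0r.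
    exact: (submod_set0 Im).
  - split=> [|j jn]; first by rewrite mulrDr ex ey.
    rewrite mulrDl tcD; exact: (submod_setD Im (Ix j jn) (Iy j jn)).
  - split=> [|j jn]; first by rewrite mulrA ex.
    rewrite tcM //; apply: (submod_set_sum Im) => i _.
    by apply: IM; apply: Ix.
have h'l : linear_on (I' : set (right_regular R)) (h' : right_regular R -> right_regular R).
  split=> [x y [ex Ix] [ey Iy]|r x [ex Ix]].
    rewrite -[LHS]/(h' ((x : R) + (y : R))) -[RHS]/((h' x : R) + h' y).
    rewrite /h' -big_split /=; apply: eq_bigr => j _.
    have -> : h (tc (((x : R) + (y : R)) * u j)) = (h (tc ((x : R) * u j)) : L) + h (tc ((y : R) * u j)).
      by rewrite mulrDl tcD; apply: hD; [apply: Ix | apply: Iy].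
    by rewrite -mulrDl val_cornerD.
  rewrite -[LHS]/(h' ((x : R) * (r : R))) -[RHS]/(h' x * (r : R)) /h' mulr_suml.
  transitivity (\sum_(j < n) \sum_(i < n)
      val (h (tc ((x : R) * u i)) : L) * (v i * (r : R) * u j * v j)).
    apply: eq_bigr => j _; rewrite tcM // hsum; last by move=> i; apply: IM; apply: Ix.
    rewrite val_corner_sum mulr_suml; apply: eq_bigr => i _.
    rewrite hM; last exact: Ix.
    rewrite val_cornerM val_to_corner -!mulrA; congr (_ * _).
    by rewrite !mulrA ev -[_ * u j * e]mulrA ue.
  rewrite exchange_big; apply: eq_bigr => i _; rewrite -mulr_sumr -[RHS]mulrA; congr (_ * _).
  under eq_bigr do rewrite -mulrA.
  by rewrite -mulr_sumr -/c -(ev i) -[e * v i * r]mulrA eRc.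
have [m0 m0P] := injective_baer selfinj I'm h'l.
exists (tc m0) => x Ix.
have xu j : tc (val x * u j) = (x : L) * tc (u j).
  apply: val_inj; rewrite valxu ?corner_mull // val_cornerM val_to_corner.
  by rewrite -mulrA ue mulrA corner_mulr.
have I'x : I' (val x).
  by split=> [|j jn]; [apply: corner_mull | rewrite xu; apply: IM].
have := m0P _ I'x; rewrite -[_ *: _]/((m0 : R) * val x) /h'.
under eq_bigr do rewrite xu hM // val_cornerM val_to_corner -!mulrA ev.
rewrite -!mulr_sumr -/c ec (corner_mulr (h x : L)) => hx.
apply: val_inj; rewrite -[x *: _]/(tc m0 * (x : L)) val_cornerM val_to_corner.
by rewrite -mulrA (corner_mull (x : L)) -mulrA -hx (corner_mull (h x : L)).
Qed.

(** Right annihilators of subsets of eRe in R are determined by those in eRe,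
    as e R = e R c. *)
Lemma corner_rann (x : L) y : val x * y = 0 <->
  forall j, (j < n)%N -> x * to_corner ee (y * u j) = 0.
Proof.
have E j : val (x * to_corner ee (y * u j)) = val x * y * u j.
  by rewrite val_cornerM val_to_corner -!mulrA ue !mulrA corner_mulr.
split=> [xy j jn|xy]; first by apply: val_inj; rewrite E xy mul0r val_corner0.
have -> : val x * y = val x * y * c.
  by rewrite -(corner_mull x) -[e * val x * y]mulrA eRc.
rewrite /c mulr_sumr big1 // => j _.
by rewrite mulrA -E xy // val_corner0 mul0r.
Qed.

Lemma corner_rann_acc : rann_acc L.
Proof.
move=> P [D0 PD0].
have [|D [[D1 PD1 <-] Dmax]] := @acc [set [set val x | x in D] | D in P].
  by exists [set val x | x in D0], D0.
exists D1; split=> // D' PD' DD' x D'x y D1y.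
have sub : rann [set val x | x in D1] `<=` rann [set val x | x in D'].
  move=> z zD _ [w D'w <-]; apply/corner_rann => j jn; apply: DD' D'w.
  by move=> w' D1w'; move: j jn; apply/corner_rann; apply: zD; exists w'.
apply: val_inj; rewrite val_cornerM val_corner0.
apply: (Dmax [set val x | x in D'] _ sub); [by exists D' | | by exists y].
by move=> _ [w D'w <-]; rewrite -val_cornerM D'x ?val_corner0.
Qed.

(** The maximal right ideal of eRe. *)
Definition top_ann : set L := [set x | s0 ** val x = 0].

Lemma top_ann_rideal : rideal top_ann.
Proof.
apply: ex_rideal => [|x y sx sy|x a sx]; rewrite /top_ann /mkset.
- by rewrite val_corner0 ractr0.
- by rewrite val_cornerD ractDr sx sy addr0.
- by rewrite val_cornerM -ractA sx ract0r.
Qed.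

Lemma top_ann1 : ~ top_ann 1.
Proof. by rewrite /top_ann /mkset val_corner1 s0e. Qed.

Lemma top_ann_unit (x : L) : ~ top_ann x -> exists y, x * y = 1.
Proof.
move=> sx; have [r s0r] := simple_ract s0 Ssimp sx.
have xre : val (x * to_corner ee r) = val x * r * e.
  by rewrite val_cornerM val_to_corner !mulrA corner_mulr.
have [|||w [ew we xw]] := @top_unit (e - val x * r * e).
- by rewrite mulrBr ee !mulrA corner_mull.
- by rewrite mulrBl ee -[_ * e * e]mulrA ee.
- by rewrite ractBr -!ractA -s0r s0e subrr.
exists (to_corner ee r * to_corner ee w); apply: val_inj.
rewrite mulrA val_cornerM xre val_to_corner ew we val_corner1.
by move: xw; rewrite opprB addrC subrK.
Qed.

Local Notation J := top_ann.

Lemma ex_corner_socle : exists k : L, k <> 0 /\ forall m, J m -> k * m = 0.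
Proof.
exact: (ex_socle_elt top_ann_rideal top_ann1 top_ann_unit
  corner_selfinjective corner_rann_acc).
Qed.

Lemma corner_noetherian : right_noetherian L.
Proof.
have [k [k0 kJ]] := ex_corner_socle.
exact: (local_noetherian top_ann_unit corner_selfinjective corner_rann_acc k0 kJ).
Qed.

(** Otherwise eR would be isomorphic to S, and S would be injective. *)
Lemma top_ann_neq0 : exists j, J j /\ j <> 0.
Proof.
apply: contrapT => noj; apply: Snon.
have J0 j : J j -> j = 0.
  by move=> Jj; apply: contrapT => j0; apply: noj; exists j.
have faithful r : s0 ** r = 0 -> e * r = 0.
  move=> s0r; rewrite -eRc /c mulr_sumr big1 // => j _.
  suff : to_corner ee (r * u j) = 0.
    move=> /(congr1 val); rewrite val_to_corner val_corner0 -!mulrA ue => eru.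
    by rewrite [r * _]mulrA mulrA eru mul0r.
  apply: J0; rewrite /top_ann /mkset val_to_corner -!ractA s0e s0r.
  by rewrite !ract0r.
have [g gE] : exists g : {linear right_regular R -> S}, g =1 (fun r : R => s0 ** r).
  by apply: ex_linear => [x y|a x]; [apply: ractDr | exact: esym (ractA s0 (x : R) (a : R))].
have [r rP] := choice (fun s => simple_ract s Ssimp s00).
have rE s a : s = s0 ** a -> e * r s = e * a.
  move=> sa; apply/eqP; rewrite -subr_eq0 -mulrBr; apply/eqP/faithful.
  by rewrite ractBr -rP -sa subrr.
have [f fE] : exists f : {linear S -> right_regular R}, f =1 (fun s => e * r s).
  apply: ex_linear => [s t|a s].
    by rewrite (rE (s + t) (r s + r t)) ?mulrDr // ractDr -!rP.
  rewrite (rE (a *: s) (r s * (a : R))) ?mulrA //.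
  by rewrite -ractA -rP.
apply: (retract_injective (f := f) (g := g) selfinj) => s.
by rewrite gE fE -ractA s0e -rP.
Qed.

(** A socle element k of eRe lies in its radical.  For x in qRe, the map
    kr |-> xr to R modulo the submodule x rad(eR) + cR, which is injective, is
    well defined, so x is z k w up to an element of x rad(eR) and thus lies in
    (qRe) k (eRe); iterating this once, x lies in (qRe) k rad(eRe) = 0. *)
Lemma qRe0 r : q * r * e = 0.
Proof.
have [k [k0 kJ]] := ex_corner_socle.
have [j [Jj j0]] := top_ann_neq0.
have Jk : J k.
  apply: contrapT => /(local_unit top_ann_rideal top_ann1 top_ann_unit)[y [_ yk]].
  by apply: j0; rewrite -[j]mul1r -yk -mulrA kJ // mulr0.
have qq := corner_q_idem.
have key x : q * x = x -> x * e = x -> exists (z : R) (w : L),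
    [/\ q * z = z, z * e = z & x = z * val k * val w].
  move=> qx xe.
  pose I0 : set R := [set y | exists m, [/\ e * m = m, s0 ** m = 0 & q * y = x * m]].
  have I0m : rideal I0.
    apply: ex_rideal => [|y y' [m [em sm qy]] [m' [em' sm' qy']]|y a [m [em sm qy]]].
    - by exists 0; rewrite !mulr0 ractr0.
    - by exists (m + m'); rewrite !mulrDr em em' ractDr sm sm' addr0 qy qy'.
    - by exists (m * a); rewrite !mulrA em -ractA sm ract0r qy.
  have [N NE] := ex_submod (I0m : submod_set (I0 : set (right_regular R))).
  have Qinj : injective_module (quo N).
    apply: (indigent_hom0 Sind) => f y.
    have piE a : pi_quo N (a : right_regular R) = pi_quo N 1 ** a.
      by rewrite -ract_linear; congr (pi_quo N _); exact: esym (mul1r (a : R)).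
    have pic : pi_quo N (c : right_regular R) = 0.
      apply/pi_quo_eq0; rewrite NE; exists 0.
      by rewrite !mulr0 ractr0 /q mulrBl mul1r cc subrr.
    rewrite -(pi_quoK y) piE ract_linear.
    have -> : f (pi_quo N 1) = 0; last exact: ract0r.
    rewrite -(ract_c (f _)).
    by rewrite -ract_linear -piE pic linear0.
  have [a ka|zbar zE] := injective_ract_cyclic (x := val k)
      (v := pi_quo N (x : right_regular R)) Qinj.
    rewrite -ract_linear; apply/pi_quo_eq0; rewrite NE.
    exists (e * a); rewrite -[_ ** a]/(x * a) !mulrA ee qx xe; split=> //.
    rewrite -ractA s0e; apply: contrapT => sa.
    have [t s0t] := simple_ract s0 Ssimp sa.
    pose b := to_corner ee (a * t).
    have [|y by1] := @top_ann_unit b.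
      by rewrite /top_ann /mkset val_to_corner -!ractA s0e -s0t s0e.
    apply: k0; rewrite -[k]mulr1 -by1 mulrA.
    have -> : k * b = 0; last by rewrite mul0r.
    apply: val_inj; rewrite val_cornerM val_to_corner !mulrA corner_mulr ka.
    by rewrite !mul0r val_corner0.
  pose z0 : R := val zbar.
  have : pi_quo N (x : right_regular R) = pi_quo N (z0 * val k : right_regular R).
    rewrite zE -[in LHS](pi_quoK zbar) -ract_linear; congr (pi_quo N _).
  move/pi_quo_eq; rewrite NE => -[m [em sm qxm]].
  have {}qxm : x - q * z0 * val k = x * m by rewrite -qxm -[RHS]/(q * (x - z0 * val k)) mulrBr qx mulrA.
  have [|||w [ew we ww]] := @top_unit (m * e).
  - by rewrite mulrA em.
  - by rewrite -mulrA ee.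
  - by rewrite -ractA sm ract0r.
  exists (q * z0 * e), (to_corner ee w).
  rewrite val_to_corner ew we; split; first by rewrite !mulrA qq.
    by rewrite -[_ * e * e]mulrA ee.
  rewrite -[_ * e * val k]mulrA corner_mull.
  have -> : q * z0 * val k = x * (e - m * e).
    rewrite [RHS]mulrBr xe mulrA -qxm (mulrBl e x) xe -[_ * val k * e]mulrA corner_mulr.
    by rewrite opprB addrC subrK.
  by rewrite -mulrA ww xe.
have qre : q * (q * r * e) = q * r * e by rewrite !mulrA qq.
have ree : q * r * e * e = q * r * e by rewrite -[_ * e * e]mulrA ee.
have [z [w [qz ze ->]]] := key _ qre ree.
have [z' [w' [_ _ ->]]] := key _ qz ze.
have Jwk : J (w' * k).
  exact: (local_left_ideal top_ann_rideal top_ann1 top_ann_unit).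
have kwk : val k * (val w' * val k) = 0 by rewrite -!val_cornerM kJ // val_corner0.
have -> : z' * val k * val w' * val k * val w = z' * (val k * (val w' * val k)) * val w.
  by rewrite !mulrA.
by rewrite kwk mulr0 mul0r.
Qed.

Lemma qRc0 r : q * r * c = 0.
Proof.
rewrite /c mulr_sumr big1 // => j _.
have -> : q * r * (u j * v j) = q * (r * u j) * e * v j by rewrite -{1}(ue j) !mulrA.
by rewrite qRe0 mul0r.
Qed.

Lemma matrix_units_gt0 : (0 < n)%N.
Proof.
case: (posnP n) => // n0; case: s00.
rewrite -(ract_c s0) /c big1 ?ractr0 // => j.
by have := ltn_ord j; rewrite {2}n0.
Qed.

Lemma corner_local : local_ring L.
Proof. exact: (ring_local top_ann_rideal top_ann1 top_ann_unit). Qed.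

Local Notation Q := (corner corner_q_idem).

Lemma corner_q_semisimple : semisimple_artinian Q.
Proof.
have qq := corner_q_idem.
apply: left_identity_semisimple => I Im.
pose I' : set R := [set val x | x in I].
have I'M x (y : R) : I x -> I' (val x * y).
  move=> Ix; exists (x * to_corner qq y); first exact: ridealM.
  rewrite val_cornerM val_to_corner !mulrA corner_mulr.
  by rewrite [RHS]cq_split -{2}(corner_mull x) -[q * val x * y]mulrA qRc0 add0r.
have I'm : rideal I'.
  apply: ex_rideal => [|_ _ [x Ix <-] [y Iy <-]|_ a [x Ix <-]].
  - by exists 0; [apply: rideal0 | rewrite val_corner0].
  - by exists (x + y); [apply: ridealD | rewrite val_cornerD].
  - exact: I'M.
have [|_ [[z Iz <-] zP]] := q_ideal_left_identity I'm.
  move=> _ [x Ix <-]; exists (val x), 1; rewrite mulr1 corner_mulr.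
  by split=> //; exists x.
exists z; split=> // x Ix; apply: val_inj.
by rewrite val_cornerM zP //; exists x.
Qed.

(** The isomorphism is r |-> (q r q, (v_i r u_j)_ij). *)
Lemma decomposition_iso : ring_iso R (Q * 'M[L]_n)%type.
Proof.
have qq := corner_q_idem.
pose tq r : Q := to_corner corner_q_idem r.
pose te r : L := to_corner ee r.
pose f r : (Q * 'M[L]_n)%type := (tq r, \matrix_(i, j) te (v i * r * u j)).
have teE (i j : 'I_n) r : val (te (v i * r * u j)) = v i * r * u j.
  by rewrite val_to_corner !mulrA ev -[_ * u j * e]mulrA ue.
have vq (i : 'I_n) x : v i * x * q = 0 by rewrite -ev -[e * _ * x]mulrA eRq0.
have qu x (i : 'I_n) : q * x * u i = 0 by rewrite -ue mulrA -[q * x * u i]mulrA qRe0.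
have [F FE] : exists F : {rmorphism R -> (Q * 'M[L]_n)%type}, F =1 f.
  apply: ex_rmorphism => [x y||x y].
  - rewrite -[RHS]/(tq x + tq y, (f x).2 + (f y).2).
    congr (_, _); first exact: to_cornerD.
    apply/matrixP => i j; rewrite !mxE; apply: val_inj.
    by rewrite val_cornerD !teE (mulrDr (v i)) (mulrDl _ _ (u j)).
  - rewrite -[RHS]/((1 : Q), (1 : 'M[L]_n)).
    congr (_, _).
    apply/matrixP => i j; rewrite !mxE; apply: val_inj.
    rewrite teE mulr1; case: uv => _ _ vu; rewrite vu //.
    by rewrite -val_eqE; case: eqP => _; rewrite ?val_corner1 ?val_corner0.
  - rewrite -[RHS]/(tq x * tq y, (f x).2 * (f y).2).
    congr (_, _).
      apply: val_inj; rewrite val_cornerM !val_to_corner.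
      have -> : q * x * q * (q * y * q) = q * x * (q * q) * y * q by rewrite !mulrA.
      by rewrite qq [q * (x * y)]mulrA {1}(cq_split (q * x)) qRc0 add0r.
    apply/matrixP => i j; rewrite !mxE; apply: val_inj.
    rewrite teE val_corner_sum.
    under eq_bigr do rewrite !mxE val_cornerM !teE.
    transitivity (v i * x * c * y * u j).
      by rewrite -[v i * x * c]addr0 -(vq i x) -cq_split !mulrA.
    rewrite /c mulr_sumr !mulr_suml; apply: eq_bigr => k _.
    by rewrite !mulrA.
exists F.
pose g (xm : (Q * 'M[L]_n)%type) : R :=
  val xm.1 + \sum_(i < n) \sum_(j < n) u i * val (xm.2 i j) * v j.
exists g => [r|[x m]]; rewrite FE.
  transitivity (q * r * q + c * r * c).
    congr (_ + _); rewrite /c !mulr_suml; apply: eq_bigr => i _; rewrite mulr_sumr.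
    by apply: eq_bigr => j _; rewrite mxE teE !mulrA.
  have E y : y = q * y + c * y by rewrite -mulrDl /q subrK mul1r.
  rewrite [RHS](cq_split r) (E (r * c)) (E (r * q)) !mulrA qRc0 cRq0.
  by rewrite add0r addr0 addrC.
have qv : val x * q = val x := corner_mulr x.
have qui (i : 'I_n) : q * u i = 0 by rewrite -[q]mulr1 qu.
have vx (i : 'I_n) : v i * val x = 0 by rewrite -qv mulrA vq.
rewrite /f /g /=; congr (_, _).
  rewrite /tq to_cornerD to_cornerK -[RHS]addr0; congr (_ + _).
  apply: val_inj; rewrite val_to_corner val_corner0.
  rewrite mulr_sumr mulr_suml big1 // => i _; rewrite mulr_sumr mulr_suml big1 // => j _.
  by rewrite !mulrA qui !mul0r.
apply/matrixP => i j; rewrite mxE; apply: val_inj; rewrite teE.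
rewrite (mulrDr (v i)) vx add0r (bigD1 i) //= (mulrDr (v i)) (mulrDl _ _ (u j)).
rewrite [X in _ + X = _](_ : _ = 0) ?addr0; last first.
  rewrite mulr_sumr mulr_suml big1 // => k ki; rewrite mulr_sumr mulr_suml big1 // => l _.
  have ik : (i == k :> nat) = false by apply: contraNF ki => /eqP/val_inj->.
  by case: uv => _ _ vu; rewrite !mulrA vu // ik !mul0r.
case: uv => _ _ vu; rewrite (bigD1 j) //= (mulrDr (v i)) (mulrDl _ _ (u j)).
rewrite [X in _ + X = _](_ : _ = 0) ?addr0; last first.
  rewrite mulr_sumr mulr_suml big1 // => l lj; rewrite -!mulrA vu //.
  have -> : (l == j :> nat) = false by apply: contraNF lj => /eqP/val_inj->.
  by rewrite !mulr0.
by rewrite -!mulrA vu // !mulrA vu // !eqxx corner_mull corner_mulr.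
Qed.

Theorem decomposition : exists S' T : pzRingType,
    [/\ ring_iso R (S' * T)%type, semisimple_artinian S', indecomposable_ring T &
        exists (L : pzRingType) (n : nat),
          [/\ local_ring L, quasi_Frobenius L, (0 < n)%N & ring_iso T 'M[L]_n]].
Proof.
exists Q, 'M[L]_n; split.
- exact: decomposition_iso.
- exact: corner_q_semisimple.
- exact: (matrix_local_indecomposable corner_local matrix_units_gt0).
exists L, n; split; [exact: corner_local | | exact: matrix_units_gt0 |].
  by split; [exact: corner_noetherian | exact: corner_selfinjective].
by exists idfun; exists idfun.
Qed.

End Decomposition.

Theorem image_of_injective_decomposition (R : pzRingType) (S E : rmodType R)
    (p : {linear E -> S}) :
  simple_module S -> ~ injective_module S -> indigent S ->
  injective_module E -> (forall s, exists t, p t = s) ->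
  exists S' T : pzRingType,
    [/\ ring_iso R (S' * T)%type, semisimple_artinian S', indecomposable_ring T &
        exists (L : pzRingType) (n : nat),
          [/\ local_ring L, quasi_Frobenius L, (0 < n)%N & ring_iso T 'M[L]_n]].
Proof.
move=> Ssimp Snon Sind Einj psurj.
have selfinj := regular_injective Sind Einj psurj.
have acc := regular_rann_acc Sind Einj psurj.
have [[s /eqP s_neq0] _] := Ssimp.
have [e [eprim s00]] := ex_primitive acc s_neq0.
have s0e : s ** e ** e = s ** e by rewrite ractA (primitive_idem eprim).
have [n [u [v [uv Sq]]]] := ex_matrix_units Ssimp selfinj acc eprim s0e s00.
exact: (decomposition Ssimp Snon Sind selfinj acc eprim s0e s00 uv Sq).
Qed.

(** * Modules over a ring with a full corner *)

(** An isomorphism of L with a corner of R, as a map that is additive and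
    multiplicative but need not preserve 1. *)
Record corner_map (L R : pzRingType) := CornerMap {
  cmap :> L -> R;
  cmapD : forall a b, cmap (a + b) = cmap a + cmap b;
  cmapM : forall a b, cmap (a * b) = cmap a * cmap b }.

Section CornerModule.
Context (L R : pzRingType) (iota : corner_map L R) (N : rmodType R).
Implicit Types (a b : L).
Local Notation e := (iota 1).

Let ee : e * e = e. Proof. by rewrite -cmapM mulr1. Qed.

(** The L-module N e. *)
Definition cmod := {x : N | x ** e == x}.
HB.instance Definition _ := Choice.on cmod.

Lemma cmodP (x : cmod) : val x ** e = val x. Proof. exact/eqP/(valP x). Qed.

Fact to_cmod_subproof (x : N) : x ** e ** e == x ** e.
Proof. by rewrite ractA ee. Qed.

Definition to_cmod (x : N) : cmod := exist _ (x ** e) (introT idP (to_cmod_subproof x)).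

Lemma val_to_cmod x : val (to_cmod x) = x ** e. Proof. by []. Qed.

Definition cmod_add (x y : cmod) := to_cmod (val x + val y).
Definition cmod_opp (x : cmod) := to_cmod (- val x).
Definition cmod_scale (a : L^c) (x : cmod) := to_cmod (val x ** iota a).

Lemma val_cmod_add x y : val (cmod_add x y) = val x + val y.
Proof. by rewrite val_to_cmod ractDl !cmodP. Qed.

Lemma val_cmod_opp x : val (cmod_opp x) = - val x.
Proof. by rewrite val_to_cmod ractNl cmodP. Qed.

Lemma val_cmod_scale a x : val (cmod_scale a x) = val x ** iota a.
Proof. by rewrite val_to_cmod ractA -cmapM mulr1. Qed.

Fact cmod_addA : associative cmod_add.
Proof. by move=> x y z; apply: val_inj; rewrite !val_cmod_add addrA. Qed.
Fact cmod_addC : commutative cmod_add.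
Proof. by move=> x y; apply: val_inj; rewrite !val_cmod_add addrC. Qed.
Fact cmod_add0 : left_id (to_cmod 0) cmod_add.
Proof. by move=> x; apply: val_inj; rewrite val_cmod_add val_to_cmod ract0r add0r. Qed.
Fact cmod_addN : left_inverse (to_cmod 0) cmod_opp cmod_add.
Proof.
by move=> x; apply: val_inj; rewrite val_cmod_add val_cmod_opp addNr val_to_cmod ract0r.
Qed.
HB.instance Definition _ :=
  GRing.isZmodule.Build cmod cmod_addA cmod_addC cmod_add0 cmod_addN.

Lemma val_cmodD (x y : cmod) : val (x + y) = val x + val y.
Proof. exact: val_cmod_add. Qed.

Fact cmod_scaleA (a b : L^c) (x : cmod) :
  cmod_scale a (cmod_scale b x) = cmod_scale (a * b) x.
Proof. by apply: val_inj; rewrite !val_cmod_scale ractA -cmapM. Qed.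
Fact cmod_scale1 : left_id 1 cmod_scale.
Proof. by move=> x; apply: val_inj; rewrite val_cmod_scale cmodP. Qed.
Fact cmod_scaleDr : right_distributive cmod_scale +%R.
Proof.
move=> a x y; apply: val_inj.
by rewrite val_cmod_scale val_cmodD ractDl [RHS]val_cmodD !val_cmod_scale.
Qed.
Fact cmod_scaleDl (x : cmod) : {morph cmod_scale^~ x : a b / a + b}.
Proof.
move=> a b; apply: val_inj.
by rewrite val_cmod_scale [RHS]val_cmodD !val_cmod_scale cmapD ractDr.
Qed.
HB.instance Definition _ := GRing.Zmodule_isLmodule.Build L^c cmod
  cmod_scaleA cmod_scale1 cmod_scaleDr cmod_scaleDl.

Lemma val_cmod_ract (x : cmod) a : val (x ** a) = val x ** iota a.
Proof. exact: val_cmod_scale. Qed.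

Lemma val_cmod0 : val (0 : cmod) = 0.
Proof. by apply: etrans (val_to_cmod 0) _; rewrite ract0r. Qed.

Lemma to_cmodD (x y : N) : to_cmod (x + y) = to_cmod x + to_cmod y.
Proof. by apply: val_inj; rewrite val_cmodD !val_to_cmod ractDl. Qed.

Lemma val_cmod_sum (I : Type) (r : seq I) (F : I -> cmod) :
  val (\sum_(i <- r) F i) = \sum_(i <- r) val (F i).
Proof. exact: (big_morph val val_cmodD val_cmod0). Qed.

End CornerModule.

(** In an injective module, an element annihilated by the common annihilator of
    finitely many elements of R is a combination of them. *)
Lemma injective_divide (R : pzRingType) (E : rmodType R) (js : seq R) (x : E) :
  injective_module E ->
  (forall r, (forall j, j \in js -> j * r = 0) -> x ** r = 0) ->
  exists ps : seq (E * R)%type, (forall p, p \in ps -> p.2 \in js) /\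
    x = \sum_(p <- ps) p.1 ** p.2.
Proof.
move=> Einj; elim: js x => [|j js IH] x xjs.
  by exists [::]; split=> //; rewrite big_nil -[x]ract1 xjs.
pose G : set (right_regular R * E)%type := [set z | exists r,
  [/\ forall j', j' \in js -> j' * r = 0, z.1 = j * r & z.2 = x ** r]].
have [||y yP] := injective_ract (G := G) Einj.
- split=> [|[a b] [a' b'] [r [jr /= -> ->]] [r' [jr' /= -> ->]]|c [a b] [r [jr /= -> ->]]].
  + by exists 0; rewrite mulr0 ractr0; split=> // j' _; rewrite mulr0.
  + exists (r + r'); rewrite mulrDr ractDr; split=> // j' j'js.
    by rewrite mulrDr jr // jr' // addr0.
  + exists (r * (c : R)); split=> [j' j'js||]; first by rewrite mulrA jr // mul0r.
      by rewrite /= mulrA.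
    by rewrite /= -ractA.
- move=> m [r [jr /= jr0 ->]]; apply: xjs => j'; rewrite inE => /orP[/eqP->|]; last exact: jr.
  exact: esym jr0.
have [|ps [psP xE]] := IH (x - y ** j).
  move=> r jr; rewrite ractBl ractA -(yP (j * r) (x ** r)) ?subrr //.
  by exists r.
exists ((y, j) :: ps); split=> [p|].
  by rewrite !inE => /orP[/eqP->|/psP ->]; rewrite ?eqxx ?orbT.
by rewrite big_cons -xE addrCA subrr addr0.
Qed.

(** R is the product of qR, which is semisimple in the sense that its right
    ideals have left identities, and of the ring of n by n matrices over the
    corner L, with matrix units u_i v_j. *)
Section FullCorner.
Context (L R : pzRingType) (iota : corner_map L R).
Variables (n : nat) (u v : nat -> R) (q : R).
Local Notation e := (iota 1).
Hypothesis iota_inj : injective iota.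
Hypothesis iota_corner : forall r, exists b, e * r * e = iota b.
Hypothesis uv : matrix_units e n u v.
Hypothesis qcentral : forall r, q * r = r * q.
Hypothesis splitting : \sum_(j < n) u j * v j + q = 1.
Hypothesis qu : forall j, q * u j = 0.
Hypothesis qe : q * e = 0.
Hypothesis q_left_identity : forall I : set R, rideal I ->
  (forall x, I x -> x * q = x) -> exists z, I z /\ forall x, I x -> z * x = x.

Let ee : e * e = e. Proof. by rewrite -cmapM mulr1. Qed.
Let ue j : u j * e = u j. Proof. by case: uv. Qed.
Let ev j : e * v j = v j. Proof. by case: uv. Qed.
Let qq : q * q = q.
Proof.
rewrite -{3}[q]mulr1 -splitting mulrDr mulr_sumr big1 ?add0r // => j _.
by rewrite mulrA qu mul0r.
Qed.

Lemma ract_split (N : rmodType R) (x : N) :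
  x = \sum_(j < n) x ** u j ** v j + x ** q.
Proof.
rewrite -[LHS]ract1 -splitting ractDr ract_sumr; congr (_ + _).
by apply: eq_bigr => j _; rewrite ractA.
Qed.

(** The extension is forced up to its values on N q, because x is the sum of
    x q and of the (x u_j) v_j, with x u_j in Ne. *)
Lemma corner_extend (N M : rmodType R) (h : {linear cmod iota N -> cmod iota M}) :
  exists f : {linear N -> M},
    (forall x, f x = \sum_(j < n) val (h (to_cmod iota (x ** u j))) ** v j) /\
    (forall x : cmod iota N, f (val x) = val (h x)).
Proof.
pose f0 (x : N) := \sum_(j < n) val (h (to_cmod iota (x ** u j))) ** v j.
have vru i r j : exists b, v i * r * u j = iota b.
  have [b bE] := iota_corner (v i * r * u j).
  by exists b; rewrite -bE !mulrA ev -[_ * u j * e]mulrA ue.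
have xru (x : N) r j : to_cmod iota (x ** r ** u j) =
    \sum_(i < n) to_cmod iota (x ** u i ** (v i * r * u j)).
  have -> : x ** r ** u j = \sum_(i < n) x ** u i ** (v i * r * u j).
    have xqru : x ** q ** r ** u j = 0.
      have qru : q * r * u j = 0 by rewrite qcentral -mulrA qu mulr0.
      by rewrite !ractA ?mulrA qru ractr0.
    rewrite {1}(ract_split x) !ractDl xqru addr0 !ract_suml.
    by apply: eq_bigr => i _; rewrite !ractA !mulrA.
  apply: val_inj; rewrite val_to_cmod ract_suml val_cmod_sum.
  by apply: eq_bigr => i _; rewrite val_to_cmod.
have [f fE] : exists f : {linear N -> M}, f =1 f0.
  apply: ex_linear => [x y|r x].
    rewrite /f0 -big_split; apply: eq_bigr => j _ /=.
    by rewrite ractDl to_cmodD linearD val_cmodD ractDl.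
  rewrite -[RHS]/(f0 x ** (r : R)) -[r *: x]/(x ** (r : R)) /f0 ract_suml.
  transitivity (\sum_(j < n) \sum_(i < n)
      val (h (to_cmod iota (x ** u i))) ** (v i * (r : R) * u j * v j)).
    apply: eq_bigr => j _; rewrite xru linear_sum val_cmod_sum ract_suml.
    apply: eq_bigr => i _; have [b bE] := vru i (r : R) j.
    have -> : to_cmod iota (x ** u i ** (v i * (r : R) * u j)) =
        to_cmod iota (x ** u i) ** b.
      apply: val_inj; rewrite val_cmod_ract !val_to_cmod bE.
      rewrite [x ** u i ** iota b ** e]ractA [x ** u i ** e ** iota b]ractA.
      by rewrite -!cmapM mulr1 mul1r.
    by rewrite ract_linear val_cmod_ract ractA bE.
  rewrite exchange_big; apply: eq_bigr => i _; rewrite -ract_sumr [RHS]ractA.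
  congr (_ ** _); under eq_bigr do rewrite -mulrA.
  rewrite -mulr_sumr -[RHS]mulr1 -splitting mulrDr -[X in _ = _ + X]mulrA -(qcentral (r : R)).
  by rewrite mulrA -qcentral -(ev i) mulrA qe !mul0r addr0.
exists f; split=> [x|x]; first exact: fE.
rewrite fE /f0.
have [b bE] := choice (fun j => iota_corner (u j)).
have xu j : to_cmod iota (val x ** u j) = x ** b j.
  apply: val_inj; rewrite val_to_cmod val_cmod_ract -bE -(cmodP x) !ractA.
  by rewrite !mulrA ee.
transitivity (\sum_(j < n) val (h x) ** u j ** v j).
  apply: eq_bigr => j _; rewrite xu ract_linear val_cmod_ract -bE.
  by rewrite -mulrA ue -[in RHS](cmodP (h x)) !ractA mulrA.
rewrite [RHS](ract_split (val (h x))) -[X in _ = _ + X ** q](cmodP (h x)).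
by rewrite ractA -qcentral qe ractr0 addr0.
Qed.

(** For a map h on a right ideal I, let z be a left identity of I q; the value
    of h at x = x q + x (1 - q) is h (z) x, as N (1 - q) = 0. *)
Lemma q_injective (N : rmodType R) : (forall x : N, x ** q = x) -> injective_module N.
Proof.
move=> Nq; apply: baer_injective => I h Im [hD hZ].
have [|x [] //|z [[Iz zq] zP]] := q_left_identity (I := [set x : R | I x /\ x * q = x]).
  apply: ex_rideal => [|x y [Ix xq] [Iy yq]|x r [Ix xq]] /=.
  - by split; [exact: (submod_set0 Im) | rewrite mul0r].
  - by split; [exact: (submod_setD Im Ix Iy) | rewrite mulrDl xq yq].
  - by split; [exact: (submod_setZ Im (r : R^c) Ix) | rewrite -(mulrA x) -(qcentral r) mulrA xq].
have hM (x r : R) : I x -> h (x * r) = h x ** r by move=> Ix; apply: (hZ r x Ix).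
exists (h z) => x Ix.
have xq : z * ((x : R) * q) = (x : R) * q.
  by apply: zP; split; [exact: (submod_setZ Im (q : R^c) Ix) | rewrite -mulrA qq].
by rewrite -[LHS]Nq -(hM x q Ix) -xq hM // -ractA Nq.
Qed.

(** N is the sum of N (1 - q), on which maps extend along Ne, and of the
    injective module N q. *)
Lemma corner_injective (N : rmodType R) :
  injective_module (cmod iota N) -> injective_module N.
Proof.
move=> Xinj N' K i inji f.
have restrict (A B : rmodType R) (g : {linear A -> B}) :
    exists g' : {linear cmod iota A -> cmod iota B},
      forall x : cmod iota A, val (g' x) = g (val x).
  have [g' g'E] : exists g' : {linear cmod iota A -> cmod iota B},
      g' =1 fun x => to_cmod iota (g (val x)).
    apply: ex_linear => [x y|a x]; first by rewrite val_cmodD linearD to_cmodD.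
    apply: val_inj.
    have e1 : val (a *: x) = val x ** iota a := val_cmod_ract x (a : L).
    have e2 : val (a *: to_cmod iota (g (val x))) = g (val x) ** e ** iota a.
      exact: (val_cmod_ract (to_cmod iota (g (val x))) (a : L)).
    rewrite e2 val_to_cmod e1 -!ract_linear cmodP; congr (g _).
    by rewrite ractA -cmapM mulr1.
  by exists g' => x; rewrite g'E val_to_cmod -ract_linear cmodP.
have [i' i'E] := restrict _ _ i; have [f' f'E] := restrict _ _ f.
have [|g gE] := Xinj _ _ i' _ f'.
  move=> x y exy; apply: val_inj; apply: inji.
  by rewrite -!i'E exy.
have [F1 [F1E _]] := corner_extend g.
have Pm : submod_set [set x : N | x ** q = x].
  split=> [|x y /= xq yq|a x /= xq]; first exact: ract0r.
    by rewrite ractDl xq yq.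
  by rewrite -[a *: x]/(x ** (a : R)) ractA -qcentral -ractA xq.
have [P PE] := ex_submod Pm.
have Pinj : injective_module (submod P).
  apply: q_injective => x; apply: val_inj.
  have : val x \in P by apply: submod_valP.
  by rewrite PE.
have fP y : f y ** q \in P by rewrite PE /= ractA qq.
have [f2 f2E] : exists f2 : {linear N' -> submod P}, f2 =1 fun y => Submod (fP y).
  apply: ex_linear => [x y|a x]; apply: val_inj => /=.
    by rewrite linearD ractDl.
  have -> : f (a *: x) = f x ** (a : R) by exact: (ract_linear f x (a : R)).
  by rewrite ractA -qcentral -ractA.
have [F2 F2E] := Pinj _ _ i inji f2.
have [F FE] : exists F : {linear K -> N}, F =1 fun z => F1 z + val (F2 z).
  apply: ex_linear => [x y|a x]; first by rewrite !linearD addrACA.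
  by rewrite !linearZ scalerDr.
exists F => y /=; rewrite FE [F2 (i y)]F2E f2E /= F1E.
rewrite [RHS]ract_split; congr (_ + _); apply: eq_bigr => j _; congr (_ ** _).
have -> : to_cmod iota (i y ** u j) = i' (to_cmod iota (y ** u j)).
  by apply: val_inj; rewrite i'E !val_to_cmod -!ract_linear.
by rewrite [g _]gE f'E val_to_cmod ractA ue ract_linear.
Qed.

(** * Quasi-Frobenius local corners *)

Hypothesis L_local : local_ring L.
Hypothesis L_QF : quasi_Frobenius L.
Variable M : rmodType R.
Hypothesis Msimp : simple_module M.
Hypothesis Mnon : ~ injective_module M.

(** It is enough to check the hypothesis of [local_injective] on Ne.  Let s be
    a nonzero element of Me.  If x in Ne has x k = 0 but does not lie in NeJ, some
    map f from N to M has f x = s.  In an injective module containing N, x is a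
    combination of elements with coefficients in J, as J has finitely many
    elements with common annihilator kL; an extension of f would thus have
    value 0 at x, because Me J = 0. *)
Theorem simple_indigent_of_corner : indigent M.
Proof.
move=> N; split; last exact: injective_subinjective.
move=> MN; apply: corner_injective.
have [J [Jm J1 Junit Jmax]] := local_ring_ideal L_local.
have [noeth selfinj] := L_QF.
have acc := noetherian_rann_acc noeth.
have Jleft := local_left_ideal Jm J1 Junit.
have [k [k0 kJ]] := ex_socle_elt Jm J1 Junit selfinj acc.
apply: (local_injective Jm J1 Junit selfinj acc k0 kJ noeth) => x xk.
have [s se] : exists s : M, s ** e <> 0.
  apply: contrapT => nos; apply: Mnon; apply: q_injective => s.
  rewrite [RHS]ract_split big1 ?add0r // => j _.
  apply: contrapT => sj; apply: nos; exists (s ** u j) => suje.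
  by apply: sj; rewrite -ue -[s ** _]ractA suje ract0r.
pose s0 : M := s ** e.
have s0e : s0 ** e = s0 by rewrite /s0 ractA ee.
have [b bE] := choice iota_corner.
have s0J m : J m -> s0 ** iota m = 0.
  move=> Jm'; apply: contrapT => sm.
  have [r s0r] := simple_ract s0 Msimp sm.
  have s1 : s0 ** iota (1 - m * b r) = 0.
    have -> : iota (1 - m * b r) = e - iota m * r * e.
      apply: (addIr (iota (m * b r))); rewrite -cmapD subrK cmapM -bE.
      rewrite !mulrA -[iota m * e]cmapM mulr1 -[e - _ + _]addrA.
      by rewrite addNr addr0.
    by rewrite ractBr s0e -!ractA -s0r s0e subrr.
  apply: J1; rewrite -(subrK (m * b r) 1); apply: ridealD => //; last exact: ridealM.
  apply: (Jmax [set a | s0 ** iota a = 0]) => //=.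
  - have i0 : iota 0 = 0 by apply: (addIr (iota 0)); rewrite -cmapD !add0r.
    apply: ex_rideal => [|a a' sa sa'|a a' sa] /=; first by rewrite i0 ractr0.
      by rewrite cmapD ractDr sa sa' addr0.
    by rewrite cmapM -ractA sa ract0r.
  - by rewrite s0e.
have MJ (t : M) m : J m -> t ** iota m = 0.
  move=> Jm'; have [r ->] := simple_ract t Msimp (se : s0 <> 0).
  have -> : s0 ** r ** iota m = s0 ** iota (b r * m).
    rewrite cmapM -bE -[e * r * e * _]mulrA -[e * iota m]cmapM mul1r.
    by rewrite -!ractA s0e.
  by apply: s0J; apply: Jleft.
apply: contrapT => nXJ.
have [|phi phiE] := radical_part_separates Jm Junit (s := to_cmod iota s0) _ nXJ.
  by move=> m Jm'; apply: val_inj; rewrite val_cmod_ract val_to_cmod s0e s0J // val_cmod0.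
have [f [_ fE]] := corner_extend phi.
have fx : f (val x) = s0 by rewrite fE phiE val_to_cmod s0e.
have [E [j [Einj jinj]]] := enough_injectives N.
have [g gE] := MN E j jinj f.
have [js [jsJ jsP]] := finite_annihilation Jm J1 Junit selfinj acc k0 kJ noeth.
have [|ps [psP xE]] := @injective_divide R E (map iota js) (j (val x)) Einj.
  move=> r jr; rewrite -ract_linear [val x ** r]ract_split.
  have -> : val x ** r ** q = 0.
    have erq : e * r * q = 0 by rewrite -qcentral mulrA qe mul0r.
    by rewrite -(cmodP x) !ractA ?mulrA erq ractr0.
  rewrite addr0 big1 ?linear0 // => t _.
  have bru : iota (b (r * u t)) = e * r * u t by rewrite -bE -!mulrA ue.
  have [|a ba] := jsP (b (r * u t)).
    move=> i ijs; apply: iota_inj.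
    have i0 : iota 0 = 0 by apply: (addIr (iota 0)); rewrite -cmapD !add0r.
    rewrite cmapM bru !mulrA -[iota i * e]cmapM mulr1 i0 jr ?mul0r //.
    exact: map_f.
  have -> : val x ** r ** u t = val (x ** b (r * u t)).
    by rewrite val_cmod_ract bru -{1}(cmodP x) !ractA !mulrA.
  by rewrite ba -ractA xk ract0r val_cmod0 ract0r.
apply: se; rewrite -/s0 -fx -gE /= xE linear_sum big_seq big1 // => p /psP /mapP[i /jsJ Ji ->].
by rewrite ract_linear MJ.
Qed.

End FullCorner.

(** * Matrix rings over local quasi-Frobenius rings *)

Section ElementaryMatrices.
Context (L : pzRingType) (n : nat).

Definition elementary_mx (i j : 'I_n) (a : L) : 'M[L]_n :=
  \matrix_(k, l) if (k == i) && (l == j) then a else 0.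

Lemma elementary_mxD i j a b :
  elementary_mx i j (a + b) = elementary_mx i j a + elementary_mx i j b.
Proof. by apply/matrixP => k l; rewrite !mxE; case: ifP => _; rewrite ?addr0. Qed.

Lemma elementary_mx_corner i j k l a b (m : 'M[L]_n) :
  elementary_mx i j a * m * elementary_mx k l b = elementary_mx i l (a * m j k * b).
Proof.
apply/matrixP => x y; rewrite !mxE (bigD1 k) //= big1 => [|z zk]; last first.
  by rewrite [X in _ * X]mxE (negPf zk) mulr0.
rewrite addr0 !mxE eqxx /= (bigD1 j) //= big1 => [|z zj]; last first.
  by rewrite mxE (negPf zj) andbF mul0r.
rewrite addr0 mxE eqxx andbT.
by case: eqP => _; case: eqP => _; rewrite ?mul0r ?mulr0.
Qed.

Lemma elementary_mxM i j k l a b :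
  elementary_mx i j a * elementary_mx k l b = if j == k then elementary_mx i l (a * b) else 0.
Proof.
rewrite -[elementary_mx i j a]mulr1 elementary_mx_corner mxE.
case: eqP => _; first by rewrite mulr1.
by apply/matrixP => x y; rewrite !mxE mulr0 mul0r; case: ifP.
Qed.

Lemma elementary_mx_sum1 : \sum_(j < n) elementary_mx j j 1 = 1.
Proof.
apply/matrixP => k l; rewrite summxE (bigD1 k) //= big1 => [|z zk]; last first.
  by rewrite mxE [k == z]eq_sym (negPf zk).
by rewrite addr0 !mxE eqxx /= eq_sym; case: eqP.
Qed.

End ElementaryMatrices.

Theorem decomposition_indigent (R S T L : pzRingType) n :
  ring_iso R (S * T)%type -> semisimple_artinian S ->
  local_ring L -> quasi_Frobenius L -> (0 < n)%N -> ring_iso T 'M[L]_n ->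
  forall M : rmodType R, simple_module M -> ~ injective_module M -> indigent M.
Proof.
case: n => // n [f [f' fK f'K]] Sss Lloc LQF _ [g [g' gK g'K]] M Msimp Mnon.
pose G (s : S) (m : 'M[L]_n.+1) : R := f' (s, g' m).
have fG s m : f (G s m) = (s, g' m) by rewrite /G f'K.
have g'D a b : g' (a + b) = g' a + g' b by apply: (can_inj gK); rewrite rmorphD !g'K.
have g'M a b : g' (a * b) = g' a * g' b by apply: (can_inj gK); rewrite rmorphM !g'K.
have g'1 : g' 1 = 1 by apply: (can_inj gK); rewrite rmorph1 g'K.
have GD s s' m m' : G (s + s') (m + m') = G s m + G s' m'.
  by apply: (can_inj fK); rewrite rmorphD !fG g'D.
have GM s s' m m' : G (s * s') (m * m') = G s m * G s' m'.
  by apply: (can_inj fK); rewrite rmorphM !fG g'M.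
have G1 : G 1 1 = 1 by apply: (can_inj fK); rewrite rmorph1 fG g'1.
have G0 : G 0 0 = 0 by apply: (addIr (G 0 0)); rewrite -GD !add0r.
have Gsurj r : exists s m, r = G s m.
  exists (f r).1, (g (f r).2); apply: (can_inj fK).
  by rewrite fG gK; case: (f r).
have Ginj s s' m m' : G s m = G s' m' -> s = s' /\ m = m'.
  by move=> /(congr1 f); rewrite !fG => -[-> /(can_inj g'K) ->].
pose E := @elementary_mx L n.+1.
have iotaD a b : G 0 (E 0 0 (a + b)) = G 0 (E 0 0 a) + G 0 (E 0 0 b).
  by rewrite -GD add0r /E elementary_mxD.
have iotaM a b : G 0 (E 0 0 (a * b)) = G 0 (E 0 0 a) * G 0 (E 0 0 b).
  by rewrite -GM mul0r /E elementary_mxM eqxx.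
pose iota := CornerMap iotaD iotaM.
pose u j := G 0 (E (inord j) 0 1).
pose v j := G 0 (E 0 (inord j) 1).
pose q := G 1 0.
apply: (simple_indigent_of_corner (iota := iota) (n := n.+1) (u := u) (v := v) (q := q)) => //.
- move=> a b /= /Ginj[_ /matrixP/(_ 0 0)].
  by rewrite !mxE !eqxx.
- move=> r; have [s [m ->]] := Gsurj r.
  exists (m 0 0); rewrite /= -!GM mul0r mul0r /E elementary_mx_corner.
  by rewrite mul1r mulr1.
- split=> [j|j|i j ni nj]; rewrite /= -GM mul0r /E elementary_mxM ?eqxx ?mul1r //.
  have -> : (inord i == inord j :> 'I_n.+1) = (i == j).
    by rewrite -val_eqE /= !inordK.
  by case: eqP.
- move=> r; have [s [m ->]] := Gsurj r.
  by rewrite -!GM mul1r mulr1 mul0r mulr0.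
- have -> : \sum_(j < n.+1) u j * v j = G 0 1.
    rewrite -elementary_mx_sum1.
    rewrite -[0 in RHS](@big1 S 0 +%R 'I_n.+1 (index_enum _) xpredT (fun=> 0)) //.
    have GDsum : G (\sum_(j < n.+1) 0) (\sum_(j < n.+1) elementary_mx j j 1) =
        \sum_(j < n.+1) G 0 (elementary_mx j j 1).
      apply: (big_rec3 (fun a b c => G a b = c)) => [|j a b c _ <-]; first exact: G0.
      by rewrite -GD.
    rewrite GDsum; apply: eq_bigr => j _.
    by rewrite /u /v -GM mul0r /E elementary_mxM eqxx mul1r inord_val.
  by rewrite -GD add0r addr0 G1.
- by move=> j; rewrite -GM mulr0 mul0r G0.
- by rewrite /= -GM mulr0 mul0r G0.
move=> I Im Iq.
have [|z [Iz zI]] := semisimple_left_identity Sss (I := [set s | I (G s 0)]).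
  apply: ex_rideal => [|s s' Is Is'|s a Is] /=.
  - by rewrite G0; apply: rideal0.
  - by rewrite -[0](addr0 (0 : 'M[L]_n.+1)) GD; apply: ridealD.
  - by rewrite -[0](mul0r (0 : 'M[L]_n.+1)) GM; apply: ridealM.
exists (G z 0); split=> // x Ix.
have [s [m xE]] := Gsurj x.
have xs : x = G s 0 by rewrite -(Iq x Ix) xE -GM mulr1 mulr0.
by rewrite xs -GM mulr0 zI // /mkset -xs.
Qed.

(** * The equivalence *)

Theorem theorem18 (R : pzRingType) (nregR : ~ von_neumann_regular R) :
  (forall M : rmodType R,
     simple_module M -> ~ injective_module M -> indigent M)
  <->
  [\/ right_V_ring R,
      [/\ right_hereditary R,
          right_noetherian R &
          forall M : rmodType R,
            indigent M \/
            exists2 N : submodClosed M,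
              largest_injective_submodule N &
              Soc M = (val : submod N -> M) @` Soc (submod N)]
    | exists S T : pzRingType,
        [/\ ring_iso R (S * T)%type,
            semisimple_artinian S,
            indecomposable_ring T &
            exists (L : pzRingType) (n : nat),
              [/\ local_ring L, quasi_Frobenius L, (0 < n)%N &
                  ring_iso T 'M[L]_n]]].
Proof.
split=> [simple_indigent|].
  have [V|/existsNP[S0 /not_implyP[S0simp S0non]]] := pselect (right_V_ring R).
    exact: Or31.
  have [[S [E [p [Ssimp Snon Einj [x px]]]]]|noimage] := pselect
      (exists (S E : rmodType R) (p : {linear E -> S}),
        [/\ simple_module S, ~ injective_module S, injective_module E &
            exists x, p x <> 0]).
    apply: Or33; apply: (image_of_injective_decomposition (p := p)) => //.
      exact: simple_indigent.
    exact: simple_surj Ssimp px.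
  have hom0 (E : rmodType R) (f : {linear E -> S0}) : injective_module E -> forall x, f x = 0.
    move=> Einj x; apply: contrapT => fx; apply: noimage.
    by exists S0, E, f; split=> //; exists x.
  apply: Or32; split.
  - exact: (hereditary_case_projective S0simp S0non simple_indigent hom0).
  - exact: (hereditary_case_noetherian S0simp S0non simple_indigent hom0).
  - exact: (hereditary_case_dichotomy S0simp S0non simple_indigent hom0).
move=> [V M Msimp []|[_ _ dich] M Msimp Mnon|]; first exact: V.
  have [//|[N [Ninj Nmax] SocN]] := dich M.
  exfalso.
  have [[x /eqP x0] _] := Msimp.
  have [N0|NT] := simple_set Msimp (submodClosed_set N).
    have [T TE] := ex_submod (@submod_setT _ M).
    have : Soc M x.
      exists [:: x]; first by rewrite big_seq1.
      move=> y; rewrite inE => /eqP ->; exists T; last by rewrite TE.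
      have Tm (y' : M) : y' \in T by rewrite TE.
      apply: gen_simple; first by exists (Submod (Tm x)) => /(congr1 val).
      move=> [a Ta] [b Tb] a0; have [|c cE] := simple_gen (s := a) b Msimp.
        by move=> a00; apply: a0; apply: val_inj.
      by exists c; apply: val_inj.
    rewrite SocN => -[u _ ux]; apply: x0; rewrite -ux; apply: N0.
    exact: submod_valP.
  apply: Mnon.
  have [j jE] : exists j : {linear M -> submod N}, j =1 fun y => Submod (NT y).
    by apply: ex_linear => [y z|a y]; apply: val_inj.
  have [k kE] := ex_val_linear N.
  apply: (retract_injective (f := j) (g := k) Ninj) => y.
  by rewrite kE jE.
move=> [S [T [RST Sss _ [L [n [Lloc LQF n0 TL]]]]]].
exact: (decomposition_indigent RST Sss Lloc LQF n0 TL).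
Qed.
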